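(* Let $C_2$ be a projective primitive double curve with associated reduced curve $C$, write $\mathcal{O}_2=\mathcal{O}_{C_2}$, and let $P\in C$ be a closed point. Let $M$ be a quasi free $\mathcal{O}_{2,P}$-module and $r_0$ an integer such that $0<2r_0\leq R(M)$. Then $M$ deforms to quasi free $\mathcal{O}_{2,P}$-modules $N$ such that $r_0(N)=r_0$ if and only if $r_0\geq r_0(M)$.
   Context: Everything is over $\mathbb{C}$. A projective primitive double curve $C_2$ with reduced curve $C$: $C$ is a smooth irreducible projective curve in a smooth connected threefold $X$, $C_2\subset X$ is a closed Cohen–Macaulay subscheme with $(C_2)_{red}=C$ such that near each closed point $P\in C$ it is contained in a surface smooth at $P$, and its multiplicity is $2$: the ideal sheaf $\mathcal{I}_C$ of $C$ in $C_2$ is nonzero, locally generated by one element $z$, and $\mathcal{I}_C^2=0$. A finitely generated $\mathcal{O}_{2,P}$-module is quasi free if it is isomorphic to $a\mathcal{O}_{2,P}\oplus b\mathcal{O}_{C,P}$ (direct sums of $a$, resp. $b$, copies) for some integers $a,b\ge 0$. For a finitely generated $\mathcal{O}_{2,P}$-module $M$, with $z\in\mathcal{O}_{2,P}$ a generator of the ideal of $C$, the generalized rank is $R(M)=\mathrm{rk}_{\mathcal{O}_{C,P}}(M/zM)+\mathrm{rk}_{\mathcal{O}_{C,P}}(zM)$; for $M$ quasi free, $r_0(M)=\mathrm{rk}_{\mathcal{O}_{C,P}}(zM)$. (So for $M\simeq a\mathcal{O}_{2,P}\oplus b\mathcal{O}_{C,P}$, $R(M)=2a+b$ and $r_0(M)=a$.)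 ''$M$ deforms to modules $N$ with a given property'' means: there are a smooth connected affine curve $T$, a closed point $t_0\in T$ and a finitely generated $(\mathcal{O}_{2,P}\otimes_{\mathbb{C}}\mathbb{C}[T])$-module $\mathbf{M}$, flat over $\mathbb{C}[T]$, such that the fibre $\mathbf{M}_{t_0}$ is isomorphic to $M$ and for every closed point $t\neq t_0$ the fibre $\mathbf{M}_t=\mathbf{M}\otimes_{\mathbb{C}[T]}\mathbb{C}(t)$ has the property. *)

(* Defs.v *)
From HB Require Import structures.
From mathcomp Require Import all_boot all_order all_algebra.
From mathcomp Require Import boolp classical_sets reals topology.
From mathcomp Require Import complex mpoly.

Set Implicit Arguments.
Unset Strict Implicit.
Unset Printing Implicit Defensive.

Import Order.TTheory GRing.Theory Num.Theory.

Local Open Scope classical_set_scope.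
Local Open Scope ring_scope.

Definition invertible (A : comNzRingType) (a : A) : Prop :=
  exists b, a * b = 1.

Definition nonunits (A : comNzRingType) : set A := [set a | ~ invertible a].

(* The library's [idealr_closed] only describes proper ideals. *)
Definition proper_ideal (A : comNzRingType) (I : set A) : Prop :=
  idealr_closed (mem I).

Definition prime_ideal (A : comNzRingType) (p : set A) : Prop :=
  proper_ideal p /\ prime_idealr_closed (mem p).

Definition maximal_ideal (A : comNzRingType) (m : set A) : Prop :=
  proper_ideal m /\ forall I, proper_ideal I -> m `<=` I -> I = m.

Definition ideal_of_seq (A : comNzRingType) (s : seq A) : set A :=
  [set a | exists c : 'I_(size s) -> A, a = \sum_(i < size s) c i * s`_i].

(* The improper ideal is generated by 1, so proper ideals suffice. *)
Definition noetherian (A : comNzRingType) : Prop :=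
  forall I : set A, proper_ideal I -> exists s, I = ideal_of_seq s.

Definition local_ring (A : comNzRingType) : Prop :=
  proper_ideal (@nonunits A).

Definition prime_chain (A : comNzRingType) (d : nat) : Prop :=
  exists p : nat -> set A,
    (forall i, (i <= d)%N -> prime_ideal (p i)) /\
    (forall i, (i < d)%N -> p i `<` p i.+1).

Definition krull_dim (A : comNzRingType) (d : nat) : Prop :=
  prime_chain A d /\ ~ prime_chain A d.+1.

Definition regular_local_ring (A : comNzRingType) (d : nat) : Prop :=
  [/\ local_ring A, noetherian A, krull_dim A d
    & exists2 s : seq A, size s = d & ideal_of_seq s = @nonunits A].

Definition regular_sequence (A : comNzRingType) (s : seq A) : Prop :=
  forall (i : nat) (a : A), (i < size s)%N ->
    ideal_of_seq (take i s) (s`_i * a) -> ideal_of_seq (take i s) a.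

(* Depth equals dimension. *)
Definition cohen_macaulay_local_ring (A : comNzRingType) : Prop :=
  [/\ local_ring A, noetherian A
    & exists s : seq A, [/\ forall i, (i < size s)%N -> nonunits s`_i,
        regular_sequence s & krull_dim A (size s)]].

(* [phi] presents L as the localization of A at the multiplicative set S. *)
Definition is_localization (A L : comNzRingType) (S : set A) (phi : A -> L) :
    Prop :=
  [/\ forall s, S s -> invertible (phi s),
      forall l, exists2 s, S s & exists a, phi s * l = phi a
    & forall a, phi a = 0 -> exists2 s, S s & s * a = 0].

Definition finitely_generated_algebra (k : fieldType) (A : comAlgType k) :
    Prop :=
  exists n (f : {lrmorphism {mpoly k[n]} -> A}), forall a, exists p, f p = a.

(* A sheaf of k-algebras with nonzero stalks, described by its espace etale:
   [germ_regular x s] says that the family of germs s is, near x, a section of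
   the sheaf.  The sections over an open set U are the families that are
   regular at every point of U, two of them being identified when they agree
   on U. *)
Record ringed_space (k : fieldType) := RingedSpace {
  space :> topologicalType ;
  stalk : space -> comAlgType k ;
  germ_regular : space -> (forall x, stalk x) -> Prop ;
  germ_regular_near : forall x s,
    germ_regular x s -> \forall y \near x, germ_regular y s ;
  germ_regular_local : forall x (s t : forall x, stalk x),
    germ_regular x s -> (\forall y \near x, s y = t y) -> germ_regular x t ;
  germ_regular_const : forall x (c : k), germ_regular x (fun y => c%:A) ;
  germ_regularD : forall x s t, germ_regular x s -> germ_regular x t ->
    germ_regular x (fun y => s y + t y) ;
  germ_regularM : forall x s t, germ_regular x s -> germ_regular x t ->
    germ_regular x (fun y => s y * t y) ;
  germ_ex : forall x (a : stalk x), exists2 s, germ_regular x s & s x = a ;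
  germ_eq0 : forall x s,
    germ_regular x s -> s x = 0 -> \forall y \near x, s y = 0 }.

Arguments germ_regular {k} r x s.
Arguments stalk {k r} x.

Definition sections (k : fieldType) (X : ringed_space k) : Type :=
  forall x : X, stalk x.

(* [rho] identifies the open subspace U with Spec A: the points of U are the
   primes of A, the sets D(a) form a basis of the topology of U, and the stalks
   are the localizations of A.  Nothing is asked of [rho] outside U. *)
Record affine_chart (k : fieldType) (X : ringed_space k) (U : set X)
    (A : comAlgType k) (rho : A -> sections X) : Prop := AffineChart {
  chart_open : open U ;
  chart_regular : forall a x, U x -> germ_regular X x (rho a) ;
  chart_linear : forall x, U x -> linear (fun a => rho a x) ;
  chart_multiplicative : forall x, U x -> monoid_morphism (fun a => rho a x) ;
  chart_prime : forall x, U x -> prime_ideal [set a | ~ invertible (rho a x)] ;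
  chart_inj : forall x y, U x -> U y ->
    [set a | ~ invertible (rho a x)] = [set a | ~ invertible (rho a y)] ->
    x = y ;
  chart_surj : forall p : set A, prime_ideal p ->
    exists2 x, U x & p = [set a | ~ invertible (rho a x)] ;
  chart_basis : forall (V : set X) x, open V -> U x -> V x ->
    exists a, invertible (rho a x) /\
      [set y | U y /\ invertible (rho a y)] `<=` V ;
  chart_stalk : forall x, U x ->
    is_localization [set a | invertible (rho a x)] (fun a => rho a x) }.

Section Schemes.
Variable k : fieldType.
Implicit Types X Y : ringed_space k.

Definition is_scheme X : Prop :=
  forall x : X, exists (U : set X) (A : comAlgType k) (rho : A -> sections X),
    affine_chart U rho /\ U x.

Definition finite_type X : Prop :=
  exists n, exists U : 'I_n -> set X,
    (forall i, exists (A : comAlgType k) (rho : A -> sections X),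
       affine_chart (U i) rho /\ finitely_generated_algebra A) /\
    (forall x, exists i, U i x).

(* For affine opens U and V, the intersection is affine (or empty, our algebras
   being nonzero) and its algebra is generated by those of U and V. *)
Definition separated X : Prop :=
  forall (U V : set X) (A B : comAlgType k)
    (rho : A -> sections X) (sigma : B -> sections X),
  affine_chart U rho -> affine_chart V sigma -> U `&` V !=set0 ->
  exists (E : comAlgType k) (tau : E -> sections X),
    affine_chart (U `&` V) tau /\
    forall e, exists n (a : 'I_n -> A) (b : 'I_n -> B),
      forall x, (U `&` V) x -> tau e x = \sum_i rho (a i) x * sigma (b i) x.

Definition irreducible_space (T : topologicalType) : Prop :=
  [set: T] !=set0 /\
  forall U V : set T, open U -> open V -> U !=set0 -> V !=set0 ->
    U `&` V !=set0.

Definition reduced X : Prop :=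
  forall (x : X) (a : stalk x) n, a ^+ n = 0 -> a = 0.

Definition cohen_macaulay X : Prop :=
  forall x : X, cohen_macaulay_local_ring (stalk x).

(* Over a perfect field, smoothness at a closed point is regularity. *)
Definition smooth_at X (x : X) (d : nat) : Prop :=
  regular_local_ring (stalk x) d.

Definition smooth_of_dim X (d : nat) : Prop :=
  forall x : X, closed [set x] -> smooth_at x d.

Record morphism Y X := Morphism {
  mfun :> Y -> X ;
  mfun_continuous : continuous mfun ;
  comorphism : forall y, {lrmorphism stalk (mfun y) -> stalk y} ;
  comorphism_local : forall y a, invertible (comorphism y a) -> invertible a ;
  comorphism_regular : forall y (s : sections X),
    germ_regular X (mfun y) s ->
    germ_regular Y y (fun y' => comorphism y' (s (mfun y'))) }.

(* A locally closed immersion, with image closed in the open set U. *)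
Definition immersion_into Y X (U : set X) (f : morphism Y X) : Prop :=
  [/\ open U, injective f, range f `<=` U,
      forall F : set Y, closed F -> exists2 G, closed G & f @` F = U `&` G
    & forall y (a : stalk y), exists b, comorphism f y b = a].

Definition closed_immersion Y X (f : morphism Y X) : Prop :=
  immersion_into [set: X] f.

(* The coordinate x_j/x_i on the i-th standard chart of P^N. *)
Definition proj_coord N (i j : 'I_N.+1) : {mpoly k[N]} :=
  if unlift i j is Some l then 'X_l else 1.

Definition is_projective_space (N : nat) X : Prop :=
  exists (U : 'I_N.+1 -> set X) (rho : 'I_N.+1 -> {mpoly k[N]} -> sections X),
  [/\ forall i, affine_chart (U i) (rho i),
      forall x, exists i, U i x,
      forall i j, U i `&` U j =
        [set x | U i x /\ invertible (rho i (proj_coord i j) x)]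
    & forall i j l x, (U i `&` U j) x ->
        rho i (proj_coord i l) x =
        rho i (proj_coord i j) x * rho j (proj_coord j l) x].

Definition projective X : Prop :=
  exists N PN (f : morphism X PN), is_projective_space N PN /\
    closed_immersion f.

Definition smooth_projective_irreducible_curve X : Prop :=
  [/\ is_scheme X, projective X, irreducible_space X & smooth_of_dim X 1].

Definition smooth_connected_threefold X : Prop :=
  [/\ is_scheme X, separated X, finite_type X, connected [set: X]
    & smooth_of_dim X 3].

(* Y is the reduced scheme associated with X. *)
Definition is_reduction Y X (f : morphism Y X) : Prop :=
  [/\ closed_immersion f, range f = [set: X] & reduced Y].

(* Near y, the closed subscheme Y of X is contained in a surface S of (an open
   subset of) X which is smooth at y.  Containment of subschemes is reverse
   inclusion of ideals; evaluating families of germs [g] on both sides avoids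
   transporting stalks along [j s = i y']. *)
Definition locally_in_smooth_surface Y X (i : morphism Y X) (y : Y) : Prop :=
  exists (S : ringed_space k) (j : morphism S X) (U : set X),
  [/\ is_scheme S, immersion_into U j,
      exists2 s, j s = i y & smooth_at s 2
    & \forall y' \near y, exists2 s, j s = i y' &
        forall g : sections X,
          comorphism j s (g (j s)) = 0 -> comorphism i y' (g (i y')) = 0].

Record primitive_double_curve C C2 X (c : morphism C C2) (i : morphism C2 X) :
    Prop := PrimitiveDoubleCurve {
  pdc_curve : smooth_projective_irreducible_curve C ;
  pdc_threefold : smooth_connected_threefold X ;
  pdc_scheme : is_scheme C2 ;
  pdc_closed : closed_immersion i ;
  pdc_cohen_macaulay : cohen_macaulay C2 ;
  pdc_reduction : is_reduction c ;
  pdc_primitive : forall P : C, closed [set P] ->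
    locally_in_smooth_surface i (c P) ;
  pdc_ideal_neq0 : exists P a, comorphism c P a = 0 /\ a <> 0 ;
  pdc_ideal_principal : forall P : C, exists z : sections C2,
    germ_regular C2 (c P) z /\
    \forall Q \near P, forall a,
      comorphism c Q a = 0 <-> exists b, a = z (c Q) * b ;
  pdc_ideal_sqr0 : forall P a b,
    comorphism c P a = 0 -> comorphism c P b = 0 -> a * b = 0 }.

End Schemes.

Definition finitely_generated (A : comNzRingType) (M : lmodType A) : Prop :=
  exists n (g : 'I_n -> M), forall m, exists a : 'I_n -> A,
    m = \sum_i a i *: g i.

Definition restrict (A B : comNzRingType) (f : {rmorphism A -> B})
  (M : lmodType B) : Type := M.

Section Restrict.
Variables (A B : comNzRingType) (f : {rmorphism A -> B}) (M : lmodType B).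

HB.instance Definition _ := GRing.Zmodule.copy (restrict f M) M.

Let scale (a : A) (m : restrict f M) : restrict f M := f a *: (m : M).

Fact restrict_scaleA a b m : scale a (scale b m) = scale (a * b) m.
Proof. by rewrite /scale scalerA rmorphM. Qed.

Fact restrict_scale1 : left_id 1 scale.
Proof. by move=> m; rewrite /scale rmorph1 scale1r. Qed.

Fact restrict_scaleDr : right_distributive scale +%R.
Proof. by move=> a m n; rewrite /scale scalerDr. Qed.

Fact restrict_scaleDl m : {morph scale^~ m : a b / a + b}.
Proof. by move=> a b; rewrite /scale rmorphD scalerDl. Qed.

HB.instance Definition _ := GRing.Zmodule_isLmodule.Build A (restrict f M)
  restrict_scaleA restrict_scale1 restrict_scaleDr restrict_scaleDl.

End Restrict.

Definition bilinear_map (B : comNzRingType) (V M X : lmodType B)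
    (beta : V -> M -> X) : Prop :=
  (forall v, linear (beta v)) /\ (forall m, linear (beta^~ m)).

(* [beta] is the universal bilinear map: X is the tensor product of V and M. *)
Definition is_tensor (B : comNzRingType) (V M X : lmodType B)
    (beta : V -> M -> X) : Prop :=
  bilinear_map beta /\
  forall (D : lmodType B) (delta : V -> M -> D), bilinear_map delta ->
  exists h : {linear X -> D}, (forall v m, h (beta v m) = delta v m) /\
    forall h' : {linear X -> D}, (forall v m, h' (beta v m) = delta v m) ->
      h' =1 h.

(* Tensoring with M preserves injectivity of linear maps. *)
Definition flat (B : comNzRingType) (M : lmodType B) : Prop :=
  forall (V W : lmodType B) (f : {linear V -> W}), injective f ->
  forall (X Y : lmodType B) (beta : V -> M -> X) (gamma : W -> M -> Y),
  is_tensor beta -> is_tensor gamma ->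
  forall h : {linear X -> Y},
    (forall v m, h (beta v m) = gamma (f v) m) -> injective h.

Definition is_tensor_algebra (k : fieldType) (A B E : comAlgType k)
    (iA : {lrmorphism A -> E}) (iB : {lrmorphism B -> E}) : Prop :=
  is_tensor (fun (a : A) (b : B) => iA a * iB b : E).

Section QuasiFree.
(* A stands for the local ring of the double curve, B for that of the reduced
   curve, and [f] is the restriction A -> B. *)
Variables (A B : comNzRingType) (f : {rmorphism A -> B}).

Definition quasi_free (M : lmodType A) : Prop :=
  exists a b (phi : {linear M -> ('rV[A]_a * restrict f 'rV[B]_b)%type}),
    bijective phi.

(* For submodules V of W of M with W/V killed by the kernel of [f], so that
   W/V is a B-module, "there are n elements of W/V independent over B". *)
Definition independent_mod (M : lmodType A) (W V : set M) (n : nat) : Prop :=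
  exists m : 'I_n -> M, (forall i, W (m i)) /\
    forall a : 'I_n -> A, V (\sum_i a i *: m i) -> forall i, f (a i) = 0.

(* The rank over the domain B of W/V: the maximal number of independent
   elements (0 if there is no maximum). *)
Definition rank_mod (M : lmodType A) (W V : set M) : nat :=
  xget 0%N [set n | independent_mod W V n /\ ~ independent_mod W V n.+1].

Definition zmul (z : A) (M : lmodType A) : set M :=
  [set m | exists m', m = z *: m'].
Arguments zmul : clear implicits.

Definition generalized_rank (z : A) (M : lmodType A) : nat :=
  (rank_mod [set: M] (zmul z M) + rank_mod (zmul z M) [set 0%R])%N.

Definition rank0 (z : A) (M : lmodType A) : nat :=
  rank_mod (zmul z M) [set 0].

End QuasiFree.

(* B is the coordinate ring of a smooth connected affine curve; the closed
   points of the curve are the maximal ideals of B. *)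
Definition smooth_connected_affine_curve (k : fieldType) (B : comAlgType k) :
    Prop :=
  [/\ finitely_generated_algebra B,
      forall e : B, e * e = e -> e = 0 \/ e = 1
    & forall m : set B, maximal_ideal m ->
      exists (L : comNzRingType) (phi : {rmorphism B -> L}),
        is_localization (~` m) phi /\ regular_local_ring L 1].

Definition ideal_mul (B : comNzRingType) (m : set B) (M : lmodType B) : set M :=
  [set x | exists n (b : 'I_n -> B) (y : 'I_n -> M),
     (forall i, m (b i)) /\ x = \sum_i b i *: y i].
Arguments ideal_mul : clear implicits.

Section Deformation.
Variables (k : fieldType) (A B E : comAlgType k).
Variables (iA : {lrmorphism A -> E}) (iB : {lrmorphism B -> E}).

(* N is the fibre MM / t MM = MM (x)_B B/t at the closed point t. *)
Definition is_fibre (MM : lmodType E) (t : set B) (N : lmodType A) : Prop :=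
  exists pi : {linear restrict iA MM -> N},
    (forall n, exists m, pi m = n) /\
    forall m : MM, pi m = 0 <-> ideal_mul B t (restrict iB MM) m.

End Deformation.

Definition deforms_to (k : fieldType) (A : comAlgType k) (M : lmodType A)
    (property : lmodType A -> Prop) : Prop :=
  exists (B E : comAlgType k)
    (iA : {lrmorphism A -> E}) (iB : {lrmorphism B -> E})
    (MM : lmodType E) (t0 : set B),
  [/\ smooth_connected_affine_curve B, maximal_ideal t0 & is_tensor_algebra iA iB]
  /\ [/\ finitely_generated MM, flat (restrict iB MM), is_fibre iA iB MM t0 M
    & forall t, maximal_ideal t -> t <> t0 ->
        exists2 N, is_fibre iA iB MM t N & property N].

(* Main.v *)
(* Write A -> O for O_{2,P} -> O_{C,P}.  Cohen-Macaulayness and the fact that the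
   ideal of C does not vanish at P (it does not vanish at the generic point)
   make the kernel z A isomorphic to the discrete valuation ring O, so that
   r_0(a A + b O) = a and R(a A + b O) = 2a + b.

   If r_0(M) <= r_0, take k = r_0 - r_0(M) <= b / 2.  The ideal (z, t) of A[t] is
   flat over C[t], with fibre O + O at t = 0 and A elsewhere; k copies of it and
   constant families deform a A + b O to (a + k) A + (b - 2k) O.

   Conversely, let MM be a flat family over E = A (x) C[T] with special fibre M,
   and lift the generators of the free part of M to m_1, ..., m_a in MM.  By
   flatness a relation between the z m_i over O (x) C[T] can be divided by a
   uniformizer at t_0, so the z m_i are independent.  The (O (x) C[T])-modules
   MM / z MM and z MM are finitely generated, hence free after inverting some
   nonzero s; at a point t where s does not vanish the z m_i remain independent
   in the fibre N, so r_0(N) >= a. *)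

Require Import Defs.
From HB Require Import structures.
From mathcomp Require Import all_boot all_order all_algebra.
From mathcomp Require Import boolp classical_sets reals topology.
From mathcomp Require Import complex mpoly.
From mathcomp Require Import ring zify.
From mathcomp Require lebesgue_measure cardinality finmap.
Set Implicit Arguments.
Unset Strict Implicit.
Unset Printing Implicit Defensive.
Import Order.TTheory GRing.Theory Num.Theory.
Local Open Scope classical_set_scope.
Local Open Scope ring_scope.
(* Again, since ring_quotient shadows the [proper_ideal] of Defs. *)
Import Defs.

(** * Ideals *)

Section Ideals.
Variable A : comNzRingType.
Implicit Types (I : set A) (a b u v x y p : A).

(** The ring O (x) C[T] and its localizations are never formed. The maps phi (x) id on E, for
    C-linear functionals phi on O, give coordinates in C[T]; their common kernel is z E, and it is
    prime because two elements outside it have nonzero values in O at a common closed point.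
    Localizing at t_0 becomes multiplying an equation by an element outside t_0. Division by the
    uniformizer comes to an end because the coordinates lie in C[T], where valuations are finite.
    That closed points of T are evaluations C[T] -> C rests on the uncountability of C.

    Both MM / z MM and z MM are needed: a relation in the fibre at t lifts only to z sum c_i m_i =
    tau y, up to a factor outside t and with tau a uniformizer at t. A basis of MM / z MM first
    shows that y lies in z MM, up to s; only then does a basis of z MM yield the c_i.

    The families of the first half are in general of infinite rank over C[t], so flatness comes from
    dual bases for finitely many elements at a time. *)

Definition ideal I : Prop :=
  [/\ I 0, forall x y, I x -> I y -> I (x + y) & forall a x, I x -> I (a * x)].

Lemma proper_idealP I : proper_ideal I <-> ideal I /\ ~ I 1.
Proof.
rewrite /proper_ideal /idealr_closed; split.
  case=> I0 I1 hI; split; last by move=> /mem_set h; rewrite h in I1.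
  have I00 : I 0 by apply: set_mem.
  split=> // [x y Ix Iy|a x Ix]; apply: set_mem.
    by rewrite -[x]mul1r; apply: hI; apply: mem_set.
  by rewrite -[a * x]addr0; apply: hI; apply: mem_set.
case=> -[I0 ID IM] I1; split; first exact: mem_set.
  by apply/negP => /set_mem.
move=> a u v /set_mem Iu /set_mem Iv; apply: mem_set.
by apply: ID => //; apply: IM.
Qed.

Lemma prime_idealP I :
  prime_ideal I <-> [/\ ideal I, ~ I 1 & forall u v, I (u * v) -> I u \/ I v].
Proof.
split.
  case=> /proper_idealP[Ii I1] Ip; split=> // u v Iuv.
  by have /orP[/set_mem|/set_mem] := Ip u v (mem_set Iuv); [left|right].
case=> Ii I1 Ip; split; first exact/proper_idealP.
by move=> u v /set_mem/Ip[] h; apply/orP; [left|right]; apply: mem_set.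
Qed.

Lemma idealB I x y : ideal I -> I x -> I y -> I (x - y).
Proof. by case=> I0 ID IM Ix Iy; apply: ID => //; rewrite -mulN1r; apply: IM. Qed.

Lemma ideal_sum I (T : Type) (r : seq T) (P : pred T) (F : T -> A) :
  ideal I -> (forall i, P i -> I (F i)) -> I (\sum_(i <- r | P i) F i).
Proof. by case=> I0 ID _ h; elim/big_ind: _. Qed.

Lemma ideal_invertible I x : ideal I -> I x -> invertible x -> I 1.
Proof. by case=> _ _ IM Ix [y] <-; rewrite mulrC; apply: IM. Qed.

Lemma invertibleM x y : invertible (x * y) <-> invertible x /\ invertible y.
Proof.
split=> [[c e]|[[c ec] [d ed]]].
  by split; [exists (y * c); rewrite mulrA|exists (x * c); rewrite mulrCA mulrA].
by exists (c * d); rewrite mulrACA ec ed mulr1.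
Qed.

Lemma not_invertible0 : ~ invertible (0 : A).
Proof. by case=> b; rewrite mul0r => /eqP; rewrite eq_sym oner_eq0. Qed.

End Ideals.

Lemma prime_preimage (A B : comNzRingType) (f : {rmorphism A -> B}) (J : set B) :
  prime_ideal J -> prime_ideal [set a | J (f a)].
Proof.
move=> /prime_idealP[[J0 JD JM] J1 Jp]; apply/prime_idealP; split => /=.
- split=> /= [|x y|a x]; rewrite ?rmorph0 ?rmorphD ?rmorphM //; [exact: JD|exact: JM].
- by rewrite rmorph1.
- by move=> u v; rewrite rmorphM => /Jp.
Qed.

Section MaximalIdeals.
Variable A : comNzRingType.
Implicit Types (I m : set A) (a x : A).

Lemma maximal_prime m : maximal_ideal m -> prime_ideal m.
Proof.
case=> pm mmax; have /proper_idealP[[m0 mD mM] m1] := pm.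
apply/prime_idealP; split=> // u v muv.
have [mu|nmu] := pselect (m u); first by left.
right; apply: contrapT => nmv.
have [h|h] := pselect (exists2 x, m x & exists a, x + a * u = 1).
  have [x mx [a e]] := h; apply: nmv; rewrite -[v]mul1r -e mulrDl mulrC.
  by apply: mD; [exact: mM|rewrite -mulrA; exact: mM].
have E : [set y | exists2 x, m x & exists a, y = x + a * u] = m.
  apply: mmax; last by move=> x mx /=; exists x => //; exists 0; rewrite mul0r addr0.
  apply/proper_idealP; split; last first.
    by case=> x mx [a e]; apply: h; exists x => //; exists a.
  split=> /=; first by exists 0 => //; exists 0; rewrite mul0r addr0.
    move=> _ _ [x mx [a ->]] [y my [b ->]]; exists (x + y); first exact: mD.
    by exists (a + b); rewrite mulrDl addrACA.
  move=> b _ [x mx [a ->]]; exists (b * x); first exact: mM.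
  by exists (b * a); rewrite mulrDr mulrA.
by apply: nmu; rewrite -E /=; exists 0 => //; exists 1; rewrite mul1r add0r.
Qed.

(** Zorn's lemma runs over the sets J whose union with I is a proper ideal, rather than over the
    ideals containing I, because the union of the empty chain has to qualify as well. *)
Lemma exists_maximal_ideal I :
  proper_ideal I -> exists2 m, maximal_ideal m & I `<=` m.
Proof.
move=> /proper_idealP[[I0 ID IM] I1].
have [|J [pJ Jmax]] := @Zorn_bigcup A [set J | proper_ideal (I `|` J)].
  move=> F FP Ftot /=; apply/proper_idealP; split; last first.
    case=> // -[J FJ J1]; have /proper_idealP[_] := FP _ FJ; apply; by right.
  split; first by left.
    move=> x y [Ix|[J FJ Jx]] [Iy|[K FK Ky]].
    - by left; apply: ID.
    - have /proper_idealP[[_ KD _] _] := FP _ FK.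
      have [||h|h] := KD x y; [by left|by right|by left|by right; exists K].
    - have /proper_idealP[[_ KD _] _] := FP _ FJ.
      have [||h|h] := KD x y; [by right|by left|by left|by right; exists J].
    - have [JK|KJ] := Ftot _ _ FJ FK.
        have /proper_idealP[[_ KD _] _] := FP _ FK.
        have [||h|h] := KD x y; [by right; apply: JK|by right|by left|by right; exists K].
      have /proper_idealP[[_ KD _] _] := FP _ FJ.
      have [||h|h] := KD x y; [by right|by right; apply: KJ|by left|by right; exists J].
  move=> a x [Ix|[J FJ Jx]]; first by left; apply: IM.
  have /proper_idealP[[_ _ KM] _] := FP _ FJ.
  have [|h|h] := KM a x; [by right|by left|by right; exists J].
exists (I `|` J); last by left.
split=> // K pK IJK; apply/seteqP; split=> //.
apply: contrapT => nK; apply: (Jmax K) => /=.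
  split; first by move=> x Jx; apply: IJK; right.
  by move=> KJ; apply: nK => x /KJ; right.
suff -> : I `|` K = K by [].
by apply/setUidPr => x Ix; apply: IJK; left.
Qed.

Lemma not_invertible_maximal a :
  ~ invertible a -> exists2 m, maximal_ideal m & m a.
Proof.
move=> na; have [|m mm h] := @exists_maximal_ideal [set x | exists b, x = b * a].
  apply/proper_idealP; split; last by case=> b e; apply: na; exists b; rewrite mulrC.
  split=> [|_ _ [b ->] [c ->]|b _ [c ->]].
  - by exists 0; rewrite mul0r.
  - by exists (b + c); rewrite mulrDl.
  - by exists (b * c); rewrite mulrA.
by exists m => //; apply: h; exists 1; rewrite mul1r.
Qed.

End MaximalIdeals.

Lemma prime_idealX (A : comNzRingType) (p : set A) a n :
  prime_ideal p -> p (a ^+ n) -> p a.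
Proof.
move=> /prime_idealP[_ p1 pp]; elim: n => [/p1 //|n IH].
by rewrite exprS => /pp[|/IH].
Qed.

Lemma ideal_of_seqP (A : comNzRingType) (s : seq A) : ideal (ideal_of_seq s).
Proof.
split=> [|x y [c ->] [d ->]|a x [c ->]].
- by exists (fun=> 0); rewrite big1 // => i _; rewrite mul0r.
- exists (fun i => c i + d i); rewrite -big_split /=.
  by apply: eq_bigr => i _; rewrite mulrDl.
- exists (fun i => a * c i); rewrite big_distrr /=.
  by apply: eq_bigr => i _; rewrite mulrA.
Qed.

Lemma ideal_of_seq_mem (A : comNzRingType) (s : seq A) x :
  x \in s -> ideal_of_seq s x.
Proof.
move=> xs; have ix : (index x s < size s)%N by rewrite index_mem.
exists (fun i => (i == Ordinal ix)%:R); rewrite (bigD1 (Ordinal ix)) //= eqxx mul1r.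
rewrite nth_index // big1 ?addr0 // => i /negPf ->; by rewrite mul0r.
Qed.

Lemma ideal_of_seq_sub (A : comNzRingType) (s : seq A) (I : set A) :
  ideal I -> (forall x, x \in s -> I x) -> ideal_of_seq s `<=` I.
Proof.
move=> iI h _ [c ->]; apply: ideal_sum => // i _; have [_ _ IM] := iI.
by apply: IM; apply: h; apply: mem_nth.
Qed.

Lemma ideal_of_seq1 (A : comNzRingType) (p a : A) :
  ideal_of_seq [:: p] a <-> exists b, a = b * p.
Proof.
split=> [[c ->]|[b ->]]; first by exists (c ord0); rewrite big_ord1.
by exists (fun=> b); rewrite big_ord1.
Qed.

(** Finitely many generators of the union already lie in one term. If the union contains 1, some
    term is the whole ring; this case is separate because [noetherian] speaks of proper ideals. *)
Lemma noetherian_acc (A : comNzRingType) (I : nat -> set A) :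
  noetherian A -> (forall n, ideal (I n)) -> (forall n, I n `<=` I n.+1) ->
  exists n, forall m, I m `<=` I n.
Proof.
move=> An iI Iinc.
have inc m n : (m <= n)%N -> I m `<=` I n.
  elim: n => [|n IH]; first by rewrite leqn0 => /eqP->.
  by rewrite leq_eqVlt => /orP[/eqP->//|/IH h x /h /Iinc].
have iU : ideal (\bigcup_n I n).
  split=> [|x y [m _ Ix] [n _ Iy]|a x [n _ Ix]].
  - by exists 0%N => //; case: (iI 0%N).
  - exists (maxn m n) => //; have [_ ID _] := iI (maxn m n).
    by apply: ID; [apply: (inc m)|apply: (inc n)] => //; rewrite ?leq_maxl ?leq_maxr.
  - by exists n => //; have [_ _ IM] := iI n; apply: IM.
have [[n _ I1]|U1] := pselect ((\bigcup_n I n) 1).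
  exists n => m x _; rewrite -[x]mulr1; by have [_ _ IM] := iI n; apply: IM.
have [|s e] := An (\bigcup_n I n); first exact/proper_idealP.
have : forall t : seq A, (forall x, x \in t -> (\bigcup_n I n) x) ->
    exists n, forall x, x \in t -> I n x.
  elim=> [_|x t IH h]; first by exists 0%N.
  have [|n hn] := IH; first by move=> y yt; apply: h; rewrite inE yt orbT.
  have [|m _ Ix] := h x; first by rewrite mem_head.
  exists (maxn m n) => y; rewrite inE => /orP[/eqP->|yt].
    by apply: (inc m) => //; rewrite leq_maxl.
  by apply: (inc n); [rewrite leq_maxr|apply: hn].
move=> /(_ s)[x xs|n hn]; first by rewrite e; apply: ideal_of_seq_mem.
exists n => m x Ix; have : (\bigcup_n I n) x by exists m.
by rewrite e; apply: ideal_of_seq_sub.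
Qed.

(** * One-dimensional regular local rings *)

(** A discrete valuation ring seen through a generator of its maximal ideal. Nonzero powers exclude
    Artinian principal local rings. *)
Definition uniformizer (A : comNzRingType) (p : A) : Prop :=
  [/\ ~ invertible p, forall n, p ^+ n <> 0
    & forall a, a <> 0 -> exists n u, invertible u /\ a = u * p ^+ n].

Lemma uniformizer_domain (A : comNzRingType) (p : A) : uniformizer p ->
  forall x y : A, x * y = 0 -> x = 0 \/ y = 0.
Proof.
case=> _ p0 hp x y xy; have [|x0] := pselect (x = 0); first by left.
have [|y0] := pselect (y = 0); first by right.
have [n [u [[u' hu] ex]]] := hp _ x0; have [m [v [[v' hv] ey]]] := hp _ y0.
case: (p0 (n + m)%N).
have -> : p ^+ (n + m) = (u * u') * (v * v') * p ^+ n * p ^+ m.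
  by rewrite hu hv !mul1r exprD.
transitivity (u' * v' * (x * y)); last by rewrite xy mulr0.
by rewrite ex ey; ring.
Qed.

Section RegularDim1.
Variable A : comNzRingType.
Implicit Types (p x : A).

(* Krull's intersection theorem for a principal ideal: the annihilators of the
   powers of p stabilize, so x = p^n u_n can be rewritten as x = p^n y_n with
   y_n = p y_{n+1}, and the ideals (y_n) stabilize too. *)
Lemma local_krull_intersection p x : local_ring A -> noetherian A ->
  ~ invertible p -> (forall n, exists u, x = u * p ^+ n) -> x = 0.
Proof.
move=> /proper_idealP[[_ UD UM] _] An np /choice[u hu].
have [||m hm] := @noetherian_acc A (fun n => [set a | p ^+ n * a = 0]) An.
- move=> n; split=> /= [|a b ha hb|a b hb]; first by rewrite mulr0.
    by rewrite mulrDr ha hb addr0.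
  by rewrite mulrCA hb mulr0.
- by move=> n a /= h; rewrite exprS -mulrA h mulr0.
pose y n := p ^+ m * u (m + n)%N.
have y0 : y 0%N = x by rewrite /y addn0 [RHS](hu m) mulrC.
have yS n : y n = p * y n.+1.
  apply/eqP; rewrite -subr_eq0; apply/eqP.
  have /hm /= : [set a | p ^+ (m + n) * a = 0] (u (m + n)%N - p * u (m + n.+1)%N).
    rewrite /= mulrBr mulrC -hu mulrA -exprSr mulrC.
    by rewrite -addnS -hu subrr.
  by rewrite mulrBr mulrCA.
have xy n : x = p ^+ n * y n.
  by elim: n => [|n IH]; rewrite ?mul1r ?y0 // IH yS mulrA -exprSr.
have [||n hn] := @noetherian_acc A (fun n => [set a | exists b, a = b * y n]) An.
- move=> n; split=> /= [|_ _ [b ->] [c ->]|a _ [b ->]].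
  + by exists 0; rewrite mul0r.
  + by exists (b + c); rewrite mulrDl.
  + by exists (a * b); rewrite mulrA.
- by move=> n _ /= [b ->]; exists (b * p); rewrite yS mulrA.
have [|c ec] := hn n.+1 (y n.+1); first by exists 1; rewrite mul1r.
suff y0' : y n.+1 = 0 by rewrite (xy n.+1) y0' mulr0.
have [[d hd]|nd] := pselect (invertible (1 - c * p)).
  rewrite -[y n.+1]mul1r -hd mulrAC mulrBl mul1r -mulrA -yS -ec subrr; exact: mul0r.
have : nonunits (1 - c * p + c * p) by apply: UD => //; apply: UM.
by rewrite subrK; case; exists 1; rewrite mulr1.
Qed.

(** The generator p of the maximal ideal is not nilpotent, or the smaller prime of a chain of length
    1 would contain p and hence the larger prime. Krull's intersection theorem bounds the power of p
    dividing a nonzero element, and the cofactor of the largest such power is a unit. *)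
Lemma regular_dim1_uniformizer :
  regular_local_ring A 1 -> exists p : A, uniformizer p.
Proof.
case=> lA An [[q [qp qs]] _] [[|p [|//]] //= _ ep]; exists p.
have np a : ~ invertible a <-> exists b, a = b * p.
  by rewrite -ideal_of_seq1 ep.
have npp : ~ invertible p by apply/np; exists 1; rewrite mul1r.
split=> // [n pn|a a0].
  have /prime_idealP[q0 q01 _] := qp 0%N isT.
  have /prime_idealP[q1 q11 _] := qp 1%N isT.
  have [_] := qs 0%N isT; apply=> a q1a.
  have /np[b ->] : ~ invertible a by move=> /(ideal_invertible q1 q1a).
  have [q00 _ q0M] := q0; apply: q0M.
  by apply: (@prime_idealX _ _ _ n); [exact: qp|rewrite pn].
have [n hn] : exists n, ~ exists u, a = u * p ^+ n.
  apply: contrapT => /forallNP h; apply: a0.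
  by apply: (local_krull_intersection lA An npp) => n; apply: contrapT.
elim: n hn => [|n IH] hn; first by case: hn; exists a; rewrite mulr1.
have [[u eu]|/IH //] := pselect (exists u, a = u * p ^+ n).
exists n, u; split=> //; apply: contrapT => /np[b eb].
by apply: hn; exists b; rewrite eu eb -mulrA -exprS.
Qed.

(** A nonzero ideal is generated by the least power of p in it, and a nonzero prime contains p, so
    the only primes are 0 and (p). This serves for the local rings of the affine line. *)
Lemma uniformizer_regular p : uniformizer p -> regular_local_ring A 1.
Proof.
move=> up; have [np p0 hp] := up.
have dom := uniformizer_domain up.
have nu a : ~ invertible a <-> exists b, a = b * p.
  split=> [na|[b ->] /invertibleM[_]//].
  have [->|/eqP a0] := eqVneq a 0; first by exists 0; rewrite mul0r.
  have [[|n] [u [iu ea]]] := hp _ a0; first by case: na; rewrite ea mulr1.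
  by exists (u * p ^+ n); rewrite ea exprSr mulrA.
have id_n n : ideal [set a | exists b, a = b * p ^+ n].
  split=> /= [|_ _ [b ->] [c ->]|a _ [b ->]].
  - by exists 0; rewrite mul0r.
  - by exists (b + c); rewrite mulrDl.
  - by exists (a * b); rewrite mulrA.
have nuE : @nonunits A = [set a | exists b, a = b * p ^+ 1].
  by apply/seteqP; split=> a /=; rewrite /nonunits /= expr1 => /nu.
have i1 : invertible (1 : A) by exists 1; rewrite mulr1.
have pm : proper_ideal (@nonunits A).
  by apply/proper_idealP; split; [rewrite nuE; exact: id_n|case].
have prm : prime_ideal (@nonunits A).
  apply/prime_idealP; split; [by rewrite nuE; exact: id_n|by case|].
  move=> u v; rewrite /nonunits /= => nuv.
  apply: contrapT => /not_orP[/contrapT iu /contrapT iv].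
  by apply: nuv; apply/invertibleM.
have pr0 : prime_ideal [set 0 : A].
  apply/prime_idealP; split=> /=; last exact: dom.
    by split=> [|x y -> ->|a x ->]; rewrite ?addr0 ?mulr0.
  by apply/eqP; rewrite oner_eq0.
have prE (q : set A) a : prime_ideal q -> q a -> a <> 0 -> q = @nonunits A.
  move=> pq qa a0; have /prime_idealP[iq q1 qM] := pq.
  have [n [u [iu ea]]] := hp _ a0.
  have qp : q p.
    move: qa; rewrite ea => /qM[qu|/(prime_idealX pq)//].
    by case: q1; apply: ideal_invertible iu.
  apply/seteqP; split=> b; first by move=> qb /(ideal_invertible iq qb).
  by move=> /nu[c ->]; have [_ _ qMl] := iq; apply: qMl.
split=> //.
- move=> I /proper_idealP[iI I1].
  have [h|] := pselect (forall a, I a -> a = 0).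
    exists [::]; apply/seteqP; split=> a.
      by move=> /h ->; exists (fun=> 0); rewrite big_ord0.
    by case=> c ->; rewrite big_ord0; case: iI.
  move=> /existsNP[a /not_implyP[Ia a0]].
  have ex : exists n, `[< I (p ^+ n) >].
    have [n [u [[v uv] ea]]] := hp _ a0; exists n; apply/asboolP.
    by rewrite -[p ^+ n]mul1r -uv mulrAC -ea mulrC; case: iI => _ _; apply.
  have [n /asboolP In nmin] := ex_minnP ex.
  exists [:: p ^+ n]; apply/seteqP; split=> b; last first.
    by move=> /ideal_of_seq1[c ->]; case: iI => _ _; apply.
  move=> Ib; apply/ideal_of_seq1.
  have [->|/eqP b0] := eqVneq b 0; first by exists 0; rewrite mul0r.
  have [k [u [[v uv] eb]]] := hp _ b0.
  have /nmin nk : `[< I (p ^+ k) >].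
    apply/asboolP; rewrite -[p ^+ k]mul1r -uv mulrAC -eb mulrC.
    by case: iI => _ _; apply.
  by exists (u * p ^+ (k - n)); rewrite eb -mulrA -exprD subnK.
- split.
    exists (fun n => if n is 0%N then [set 0] else @nonunits A); split.
      by case=> [|[]].
    case=> // _; split; first by move=> _ ->; exact: not_invertible0.
    by move=> /(_ p np) /= /eqP; rewrite -[p]expr1 => /eqP; apply: p0.
  case=> q [qp qs].
  have nz n (le_n : (n < 2)%N) : q n.+1 = @nonunits A.
    have [s01 /existsNP[a /not_implyP[qa nqa]]] := qs n le_n.
    apply: (prE _ a) => //; first exact: qp.
    by move=> a0; apply: nqa; rewrite a0; have /prime_idealP[[]] := qp n (ltnW le_n).
  have [_] := qs 1%N isT; apply; by rewrite !nz.
- exists [:: p] => //; apply/seteqP; split=> a.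
    by move=> /ideal_of_seq1 /nu.
  by move=> /nu /ideal_of_seq1.
Qed.

End RegularDim1.

Lemma prime_chain_preimage (A B : comNzRingType) (f : {rmorphism A -> B}) d :
  (forall b, exists a, f a = b) -> prime_chain B d -> prime_chain A d.
Proof.
move=> fs [q [qp qs]]; exists (fun n => [set a | q n (f a)]); split.
  by move=> n le_n; apply: prime_preimage; apply: qp.
move=> n lt_n; have [h1 h2] := qs n lt_n; split=> [a /=|h]; first exact: h1.
by apply: h2 => b qb; have [a ea] := fs b; rewrite -ea; apply: h; rewrite /= ea.
Qed.

(* A Cohen-Macaulay ring has no embedded components: f s <> 0 makes s divide a
   power of a regular element modulo z. *)
Lemma cohen_macaulay_torsionfree (A O : comNzRingType) (f : {rmorphism A -> O})
    (z s : A) :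
  (forall b, exists a, f a = b) -> (forall a, f a = 0 <-> exists b, a = z * b) ->
  z * z = 0 -> regular_local_ring O 1 -> cohen_macaulay_local_ring A ->
  s * z = 0 -> f s <> 0 -> z = 0.
Proof.
move=> fs fz zz rO [_ _ [t [tn tr td]]] sz fs0.
have [_ _ [cO _] _] := rO.
have {td} t0 : (0 < size t)%N.
  by case: (posnP (size t)) td => // -> [_ []]; apply: prime_chain_preimage cO.
have xr a : t`_0 * a = 0 -> a = 0.
  move=> xa; have := tr 0%N a t0; rewrite take0 xa => h.
  by have [|c ->] := h; [exists (fun=> 0)|]; rewrite big_ord0.
have [p up] := regular_dim1_uniformizer rO.
(* The first term t_0 of the regular sequence is not a zero divisor. If it is a multiple of z, it
   kills z, so z = 0. Otherwise f t_0 = v p^n, and n > 0: the kernel of f being nilpotent, a unit f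
   t_0 would make t_0 a unit. *)
have [x0|x0] := pselect (f t`_0 = 0).
  by have [b eb] := (fz _).1 x0; apply: xr; rewrite eb mulrAC zz mul0r.
have [_ _ hp] := up.
have [m [u [[u' uu] es]]] := hp _ fs0.
have [n [v [iv et]]] := hp _ x0.
case: n et => [|n] et.
  have /invertibleM[_ [w]] : invertible (v * p ^+ 0).
    by rewrite mulr1.
  case: (tn 0%N t0); have [v' hv] := iv; have [w' ew] := fs v'.
  have /fz[b eb] : f (t`_0 * w' - 1) = 0.
    by rewrite rmorphB rmorphM rmorph1 et ew mulr1 hv subrr.
  exists (w' * (1 - z * b)); rewrite mulrA.
  have -> : t`_0 * w' = 1 + z * b by rewrite -eb addrC subrK.
  transitivity (1 - (z * z) * b * b); first by ring.
  by rewrite zz !mul0r subr0.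
(* From f s = u p^m and f t_0 = v p^(n+1), f s divides f t_0^m, and w lifts the quotient. Then t_0^m
   kills z, since s and the kernel of f do. *)
have [w ew] := fs (v ^+ m * u' * p ^+ (n * m)).
have /fz[b eb] : f (t`_0 ^+ m - w * s) = 0.
  rewrite rmorphB rmorphM rmorphXn ew es et exprMn -exprM mulSn exprD.
  apply/eqP; rewrite subr_eq0; apply/eqP.
  transitivity (u * u' * (v ^+ m * (p ^+ m * p ^+ (n * m)))); last by ring.
  by rewrite uu mul1r.
have : t`_0 ^+ m * z = 0.
  rewrite -[t`_0 ^+ m](subrK (w * s)) eb mulrDl -(mulrA w) sz mulr0 addr0.
  by rewrite mulrAC zz mul0r.
elim: m {es et ew eb w} => [|k IH]; first by rewrite mul1r.
by rewrite exprS -mulrA => /xr.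
Qed.

(** * Specialization of points *)

Lemma near_open (T : topologicalType) (x : T) (Q : set T) :
  (\forall y \near x, Q y) <-> exists W, [/\ open W, W x & W `<=` Q].
Proof.
rewrite -[X in X <-> _]/(nbhs x Q) nbhsE; split; first by case=> W [oW Wx] WQ; exists W.
by case=> W [oW Wx WQ]; exists W.
Qed.

(** That is, y lies in the closure of x: the first argument is the more generic point. *)
Definition specializes (T : topologicalType) (x y : T) : Prop :=
  forall W, open W -> W y -> W x.

Lemma closed_set1P (T : topologicalType) (x : T) :
  closed [set x] <-> forall y, specializes x y -> y = x.
Proof.
split=> [cx y xy|h].
  apply: contrapT => nyx.
  by have := xy (~` [set x]) (closed_openC cx); apply.
move=> y cly; apply: h => W oW Wy.
by have [w [/= -> Ww]] := cly W (open_nbhs_nbhs (conj oW Wy)).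
Qed.

Section Germs.
Variables (k : fieldType) (X : ringed_space k).
Implicit Types (x y : X) (s t : sections X).

Lemma germ_regularB x s t : germ_regular X x s -> germ_regular X x t ->
  germ_regular X x (fun y => s y - t y).
Proof.
move=> rs rt; have rN := germ_regularM (germ_regular_const x (- 1)) rt.
have : germ_regular X x (fun y => s y + (- 1)%:A * t y) by exact: germ_regularD.
move/germ_regular_local; apply; apply/near_open.
exists setT; split=> // [|y _]; first exact: openT.
by rewrite mulr_algl scaleN1r.
Qed.

Lemma germ_eq_near x s t : germ_regular X x s -> germ_regular X x t ->
  s x = t x -> \forall y \near x, s y = t y.
Proof.
move=> rs rt e; have /germ_eq0 : germ_regular X x (fun y => s y - t y).
  exact: germ_regularB.
rewrite e subrr => /(_ erefl) /near_open[W [oW Wx h]].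
by apply/near_open; exists W; split=> // y /h /eqP; rewrite subr_eq0 => /eqP.
Qed.

Lemma invertible_near x s : germ_regular X x s -> invertible (s x) ->
  \forall y \near x, invertible (s y).
Proof.
move=> rs [b eb]; have [t rt et] := germ_ex b.
have r1 := germ_regular_const x 1.
have /near_open[W [oW Wx h]] : \forall y \near x, s y * t y = 1%:A.
  apply: (germ_eq_near (germ_regularM rs rt) r1).
  by rewrite /= et eb scale1r.
apply/near_open; exists W; split=> // y /h e.
by exists (t y); rewrite e scale1r.
Qed.

Section Chart.
Variables (U : set X) (A : comAlgType k) (rho : A -> sections X).
Hypothesis cU : affine_chart U rho.

Lemma chart_rmorph x : U x ->
  [/\ rho 0 x = 0, {morph (fun a => rho a x) : a b / a + b >-> a + b}
    & {morph (fun a => rho a x) : a b / a * b >-> a * b}].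
Proof.
move=> Ux; have lin := chart_linear cU Ux; have [_ mul] := chart_multiplicative cU Ux.
have D a b : rho (a + b) x = rho a x + rho b x.
  by have := lin 1 a b; rewrite !scale1r.
split=> //; have := D 0 0; rewrite addr0 => /eqP.
by rewrite -subr_eq0 opprD addrA subrr sub0r oppr_eq0 => /eqP.
Qed.

Lemma open_chart_locus a : open [set x | U x /\ invertible (rho a x)].
Proof.
rewrite openE => x [Ux ix]; rewrite /interior /=.
have /near_open[W [oW Wx h]] := invertible_near (chart_regular cU a Ux) ix.
apply/near_open; exists (U `&` W); split; [|by split|].
  by apply: openI => //; exact: chart_open cU.
by move=> y [Uy Wy] /=; split=> //; apply: h.
Qed.

Lemma chart_specializes x y : U x -> U y ->
  specializes x y <-> forall a, invertible (rho a y) -> invertible (rho a x).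
Proof.
move=> Ux Uy; split=> [xy a iy|h W oW Wy].
  by have [] := xy _ (open_chart_locus a) (conj Uy iy).
have [a [iy DW]] := chart_basis cU oW Uy Wy.
by apply: DW; split=> //; apply: h.
Qed.

Lemma chart_closed_specialization y : U y ->
  exists x, [/\ U x, specializes y x
    & forall x', U x' -> specializes x x' -> x' = x].
Proof.
move=> Uy; have [py _] := chart_prime cU Uy.
have [m mm pm] := exists_maximal_ideal py.
have [x Ux em] := chart_surj cU (maximal_prime mm).
exists x; split=> //.
  apply/chart_specializes => // a ix; apply: contrapT => ny.
  by have := pm a ny; rewrite em.
move=> x' Ux' /(chart_specializes Ux Ux') h.
apply: (chart_inj cU) => //; rewrite -em; case: mm => _; apply.
  by have [] := chart_prime cU Ux'.
by move=> a; rewrite em /= => nx /h.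
Qed.

End Chart.

(** A point of a chart specializes to one that is closed in the chart. If the latter is not closed
    in X, it specializes to a point outside the chart, all of whose specializations stay outside; so
    the finite list of charts that can still be met gets shorter. *)
Lemma exists_closed_specialization n (U : 'I_n -> set X) :
  (forall i, exists (A : comAlgType k) (rho : A -> sections X),
    affine_chart (U i) rho) ->
  (forall x, exists i, U i x) ->
  forall y, exists2 x, closed [set x] & specializes y x.
Proof.
move=> cU covU.
suff H (L : seq 'I_n) y : (forall x, specializes y x -> exists2 i, i \in L & U i x) ->
    exists2 x, closed [set x] & specializes y x.
  move=> y; apply: (H (enum 'I_n)) => x _; have [j Uj] := covU x.
  by exists j => //; rewrite mem_enum.
have [d] := ubnP (size L); elim: d L y => // d IH L y szL hL.
have [|j jL Ujy] := hL y; first by [].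
have [A [rho cj]] := cU j.
have [x [Ux yx xcl]] := chart_closed_specialization cj Ujy.
have [cx|ncx] := pselect (closed [set x]); first by exists x.
have [y' /not_implyP[xy' ny']] : exists y', ~ (specializes x y' -> y' = x).
  by apply/existsNP => h; apply/ncx/closed_set1P.
have nUy' : ~ U j y' by move=> /xcl /(_ xy').
have [|w xw|x' cx' y'x'] := IH (rem j L) y'.
- rewrite size_rem // -ltnS (leq_trans _ szL) // ltnS prednK //.
  by case: L jL {hL szL}.
- have [|l lL Ulw] := hL w.
    by move=> W oW /xw -/(_ oW) /xy' -/(_ oW) /yx; apply.
  exists l => //; have [e|nlj] := eqVneq l j.
    case: nUy'; rewrite -e; apply: xw => //.
    by rewrite e; exact: chart_open cj.
  by move: lL; rewrite (perm_mem (perm_to_rem jL)) inE (negPf nlj).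
- exists x' => // W oW /y'x' -/(_ oW) /xy' -/(_ oW) /yx; exact.
Qed.

End Germs.

Section ClosedImmersions.
Variables (k : fieldType) (Y X : ringed_space k) (f : morphism Y X).
Hypothesis imm_f : closed_immersion f.

Lemma closed_immersion_specializes x y :
  specializes (f x) (f y) <-> specializes x y.
Proof.
have [_ finj _ fcl _] := imm_f; split=> h W oW Wy; last first.
  by have := h _ ((continuousP f).1 (@mfun_continuous _ _ _ f) _ oW); apply.
apply: contrapT => nWx.
have [G clG eG] := fcl _ (open_closedC oW).
have Gx : G (f x).
  have : (f @` ~` W) (f x) by exists x.
  by rewrite eG => -[].
have Gy : G (f y).
  apply: contrapT => nG; have := h (~` G) (closed_openC clG) nG; exact.
have : (f @` ~` W) (f y) by rewrite eG.
by case=> y' nWy' /finj e; apply: nWy'; rewrite e.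
Qed.

Lemma closed_immersion_range y x : specializes (f y) x -> exists y', f y' = x.
Proof.
have [_ _ _ fcl _] := imm_f => h.
have [G clG eG] := fcl setT closedT.
have Gx : G x.
  apply: contrapT => nG; have := h (~` G) (closed_openC clG) nG; apply.
  have : (f @` setT) (f y) by exists y.
  by rewrite eG => -[].
have : (f @` setT) x by rewrite eG.
by case=> y' _ <-; exists y'.
Qed.

End ClosedImmersions.

Lemma projective_closed_specialization (k : fieldType) (X : ringed_space k) :
  projective X -> forall y : X, exists2 x, closed [set x] & specializes y x.
Proof.
case=> N [PN [f [[U [rho [chU covU _ _]]] imm]]] y.
have [|x cx yx] := @exists_closed_specialization _ PN _ U _ covU (f y).
  by move=> j; exists {mpoly k[N]}, (rho j).
have [y' ey'] := closed_immersion_range imm yx.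
exists y'; last by apply/(closed_immersion_specializes imm); rewrite ey'.
apply/closed_set1P => w y'w; have [_ finj _ _ _] := imm; apply: finj.
rewrite ey'; move/closed_set1P: cx; apply.
by rewrite -ey'; apply/closed_immersion_specializes.
Qed.

(** * The local ring of a primitive double curve *)

(* The part of the structure of O_{2,P} -> O_{C,P} that the theorem depends on:
   the kernel is generated by z and is isomorphic to the domain O_{C,P}. *)
Definition double_ring (A O : comNzRingType) (f : {rmorphism A -> O}) (z : A) :
    Prop :=
  [/\ forall b, exists a, f a = b,
      forall a, f a = 0 <-> exists b, a = z * b,
      forall a, z * a = 0 <-> f a = 0
    & forall x y : O, x * y = 0 -> x = 0 \/ y = 0].

Section PrimitiveDoubleCurve.
Variables (k : fieldType) (C C2 X : ringed_space k).
Variables (c : morphism C C2) (i : morphism C2 X).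
Hypothesis hC2 : primitive_double_curve c i.

Let reduction := pdc_reduction hC2.

Lemma pdc_surjective Q b : exists a, comorphism c Q a = b.
Proof. by have [[_ _ _ _ h] _ _] := reduction; exact: h. Qed.

(** Geometrically, C2 coincides with C at Q. The aim is to show that this happens nowhere. *)
Definition conormal_zero (Q : C) : Prop :=
  forall a, comorphism c Q a = 0 -> a = 0.

Lemma conormal_zero_near Q : conormal_zero Q ->
  exists W, [/\ open W, W Q & W `<=` conormal_zero].
Proof.
move=> Q0; have [zs [rzs /near_open[W [oW WQ hW]]]] := pdc_ideal_principal hC2 Q.
have : zs (c Q) = 0 by apply: Q0; apply/(hW _ WQ); exists 1; rewrite mulr1.
move=> /(germ_eq0 rzs)/near_open[W2 [oW2 W2Q hW2]].
exists (W `&` c @^-1` W2); split=> //.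
  by apply: openI => //; apply: ((continuousP c).1 (@mfun_continuous _ _ _ c)).
by move=> Q' [WQ' /= /hW2 z0] a /(hW _ WQ')[b ->]; rewrite z0 mul0r.
Qed.

Lemma reduction_open (W : set C) : open W -> open (c @` W).
Proof.
move=> oW; have [[_ cinj _ ccl _] cT _] := reduction.
have [G clG eG] := ccl _ (open_closedC oW).
suff -> : c @` W = ~` G by apply: closed_openC.
apply/seteqP; split=> [_ [x Wx <-] Gx|x nGx].
  have : (c @` ~` W) (c x) by rewrite eG.
  by case=> x' nW /cinj e; apply: nW; rewrite e.
have : range c x by rewrite cT.
case=> x' _ e; exists x' => //; apply: contrapT => nW.
apply: nGx; have : (c @` ~` W) x by exists x'.
by rewrite eG => -[].
Qed.

Lemma closed_point_domain (Q : C) : closed [set Q] ->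
  forall x y : stalk Q, x * y = 0 -> x = 0 \/ y = 0.
Proof.
move=> clQ; have [_ _ _ smC] := pdc_curve hC2.
have [p /uniformizer_domain] := regular_dim1_uniformizer (smC Q clQ); exact.
Qed.

(* Every nonempty open subset of C contains the generic point of a chart
   around Q. *)
Lemma conormal_neq0_closed (P Q : C) : closed [set Q] ->
  ~ conormal_zero Q -> ~ conormal_zero P.
Proof.
move=> clQ nQ zP; have [_ _ irC smC] := pdc_curve hC2.
have [W [oW WP hW]] := conormal_zero_near zP.
have [V [A [rho [cV VQ]]]] := pdc_scheme hC2 (c Q).
have [_ cT _] := reduction.
have ccont := (continuousP c).1 (@mfun_continuous _ _ _ c).
(* h maps the coordinate ring of the chart to the local ring of C at Q, a domain. The point of its
   prime kernel is the generic point eta, and h a <> 0 means that a is invertible at eta. *)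
pose h a := comorphism c Q (rho a (c Q)).
have [rho0 rhoD rhoM] := chart_rmorph cV VQ.
have rho1 : rho 1 (c Q) = 1 by have [] := chart_multiplicative cV VQ.
have hD a b : h (a + b) = h a + h b by rewrite /h rhoD rmorphD.
have hM a b : h (a * b) = h a * h b by rewrite /h rhoM rmorphM.
have h_inv a : invertible (rho a (c Q)) -> h a <> 0.
  move=> [b eb] h0; apply: (@not_invertible0 (@stalk k C Q)).
  by exists (comorphism c Q b); rewrite -h0 -rmorphM eb rmorph1.
have prh : prime_ideal [set a | h a = 0].
  apply/prime_idealP; split.
  - split=> /= [|a b ha hb|a b hb]; first by rewrite /h rho0 rmorph0.
      by rewrite hD ha hb addr0.
    by rewrite hM hb mulr0.
  - by rewrite /= /h rho1 rmorph1; apply/eqP; rewrite oner_eq0.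
  - by move=> a b /=; rewrite hM; apply: closed_point_domain.
have [x Vx ex] := chart_surj cV prh.
have : range c x by rewrite cT.
case=> eta _ eeta; rewrite -{}eeta in Vx ex.
have gen a : h a <> 0 <-> invertible (rho a (c eta)).
  have /= e : [set a | h a = 0] a <-> ~ invertible (rho a (c eta)) by rewrite ex.
  by rewrite e; split=> [/contrapT|iv niv] //; exact: niv.
have [y [Wy Vy]] : W `&` c @^-1` V !=set0.
  apply: irC.2 => //; [|by exists P|by exists Q].
  by apply: ccont; exact: chart_open cV.
have [a [ia DW]] := chart_basis cV (reduction_open oW) Vy (ex_intro2 _ _ y Wy erefl).
(* Otherwise a would vanish on C near Q, and by irreducibility this neighbourhood meets the open set
   where a is invertible. It follows that eta lies in W, where the ideal of C vanishes. *)
have h_a : h a <> 0.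
  move=> ha0.
  have /germ_eq0/(_ ha0)/near_open[W1 [oW1 W1Q hW1]] :=
    comorphism_regular (chart_regular cV a VQ).
  have [w [W1w [Vw [b eb]]]] :
      W1 `&` c @^-1` [set y | V y /\ invertible (rho a y)] !=set0.
    apply: irC.2 => //; [|by exists Q|by exists y].
    by apply: ccont; exact: open_chart_locus.
  apply: (@not_invertible0 (@stalk k C w)); exists (comorphism c w b).
  by rewrite -(hW1 w W1w) -rmorphM eb rmorph1.
have : (c @` W) (c eta) by apply: DW; split=> //; apply/gen.
case=> eta' Weta' ce.
have {ce} ee : eta' = eta by have [[_ cinj _ _ _] _ _] := reduction; exact: cinj.
have zeta : conormal_zero eta by apply: hW; rewrite -ee.
(* The generator z of the ideal at Q is a1 / s1 with a1, s1 in A, and s1 z = a1 still holds at eta.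
   There z = 0, so some s invertible at eta kills a1; hence s z = 0 at Q while h s <> 0. *)
have [zs [rzs /near_open[W1 [oW1 W1Q hW1]]]] := pdc_ideal_principal hC2 Q.
have [_ loc _] := chart_stalk cV VQ.
have [s1 is1 [a1 e1]] := loc (zs (c Q)).
have /near_open[W2 [oW2 W2Q hW2]] := germ_eq_near
  (germ_regularM (chart_regular cV s1 VQ) rzs) (chart_regular cV a1 VQ) e1.
have [|b [ib DW1]] := chart_basis cV (openI (reduction_open oW1) oW2) VQ.
  by split=> //; exists Q.
have [[eta1 W1eta1 ce1] W2eta] : (c @` W1 `&` W2) (c eta).
  by apply: DW1; split=> //; apply/gen; apply: h_inv.
have {ce1} ee1 : eta1 = eta by have [[_ cinj _ _ _] _ _] := reduction; exact: cinj.
rewrite ee1 in W1eta1.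
have z0 : zs (c eta) = 0.
  by apply: zeta; apply/(hW1 _ W1eta1); exists 1; rewrite mulr1.
have := hW2 _ W2eta; rewrite /= z0 mulr0 => /esym a10.
have [_ _ loc0] := chart_stalk cV Vx.
have [s is0 sa] := loc0 _ a10.
have zQ : zs (c Q) = 0.
  apply: (@cohen_macaulay_torsionfree _ _ (comorphism c Q) _ (rho s (c Q))).
  - exact: pdc_surjective.
  - exact: hW1.
  - by apply: (pdc_ideal_sqr0 hC2); apply/(hW1 _ W1Q); exists 1; rewrite mulr1.
  - exact: smC.
  - exact: (pdc_cohen_macaulay hC2).
  - have [t et] := is1; rewrite -[zs _]mul1r -et -mulrA (mulrCA _ t) (mulrC t) e1.
    by rewrite mulrA -rhoM sa rho0 mul0r.
  - exact/gen.
by apply: nQ => d /(hW1 _ W1Q)[e ->]; rewrite zQ mul0r.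
Qed.

(** Vanishing of the stalk is an open condition, so nonvanishing passes from the given point to a
    closed specialization, and from a closed point to every P. *)
Lemma pdc_conormal_neq0 P : ~ conormal_zero P.
Proof.
have [Q0 [a [ca a0]]] := pdc_ideal_neq0 hC2.
have [_ pC _ _] := pdc_curve hC2.
have [Q clQ Q0Q] := projective_closed_specialization pC Q0.
apply: (conormal_neq0_closed clQ) => zQ; apply: a0.
have [W [oW WQ hW]] := conormal_zero_near zQ.
exact: (hW _ (Q0Q _ oW WQ)).
Qed.

Lemma pdc_double_ring (P : C) (z : stalk (c P)) : closed [set P] ->
  (forall a, comorphism c P a = 0 <-> exists b, a = z * b) ->
  double_ring (comorphism c P) z.
Proof.
move=> clP hz; have [_ _ _ smC] := pdc_curve hC2.
have fz : comorphism c P z = 0 by apply/hz; exists 1; rewrite mulr1.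
have zz : z * z = 0 by exact: (pdc_ideal_sqr0 hC2).
split=> //; [exact: pdc_surjective| |exact: closed_point_domain].
move=> a; split=> [za|/hz[b ->]]; last by rewrite mulrA zz mul0r.
apply: contrapT => fa; apply: (@pdc_conormal_neq0 P) => b /hz[d ->].
suff -> : z = 0 by rewrite mul0r.
apply: (@cohen_macaulay_torsionfree _ _ (comorphism c P) _ a) => //.
- exact: pdc_surjective.
- exact: smC.
- exact: (pdc_cohen_macaulay hC2).
- by rewrite mulrC.
Qed.

End PrimitiveDoubleCurve.

(** * Ranks of quasi free modules *)

Lemma restrict_scaleE (A B : comNzRingType) (f : {rmorphism A -> B})
    (M : lmodType B) a (m : restrict f M) : a *: m = f a *: (m : M) :> M.
Proof. by []. Qed.

(** Gaussian elimination without fractions: a nonzero entry d of the first column is the pivot, and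
    the other rows are multiplied by d before it clears them. *)
Lemma domain_dependent (O : comNzRingType) :
  (forall x y : O, x * y = 0 -> x = 0 \/ y = 0) ->
  forall n (v : 'I_n.+1 -> 'I_n -> O), exists c : 'I_n.+1 -> O,
    (exists i, c i <> 0) /\ forall j, \sum_i c i * v i j = 0.
Proof.
move=> dom; elim=> [|n IH] v.
  exists (fun=> 1); split=> [|[]//]; exists ord0; apply/eqP; exact: oner_neq0.
have [h|/existsNP[i0 vi0]] := pselect (forall i, v i ord0 = 0).
  have [c [[i ci] hc]] := IH (fun i j => v (lift ord0 i) (lift ord0 j)).
  exists (fun i => if unlift ord0 i is Some k then c k else 0); split.
    by exists (lift ord0 i); rewrite liftK.
  move=> j; rewrite big_ord_recl unlift_none mul0r add0r.
  have [->|[k ->]] : j = ord0 \/ exists k, j = lift ord0 k.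
    by case: (unliftP ord0 j) => [k ->|->]; [right; exists k|left].
    by rewrite big1 // => i' _; rewrite h mulr0.
  by rewrite -[RHS](hc k); apply: eq_bigr => i' _; rewrite liftK.
set d := v i0 ord0 in vi0.
have [c [[i ci] hc]] := IH (fun i j => d * v (lift i0 i) (lift ord0 j)
                                 - v (lift i0 i) ord0 * v i0 (lift ord0 j)).
exists (fun i => if unlift i0 i is Some k then d * c k
                 else - \sum_k c k * v (lift i0 k) ord0); split.
  exists (lift i0 i); rewrite liftK => /dom[]//.
move=> j; rewrite (bigD1_ord i0) //= unlift_none mulNr big_distrl /= -sumrN -big_split /=.
have [->|[k ->]] : j = ord0 \/ exists k, j = lift ord0 k.
  by case: (unliftP ord0 j) => [k ->|->]; [right; exists k|left].
  by rewrite big1 // => i' _; rewrite liftK -/d; ring.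
by rewrite -[RHS](hc k); apply: eq_bigr => i' _; rewrite liftK; ring.
Qed.

Lemma domain_dependent_gt (O : comNzRingType) :
  (forall x y : O, x * y = 0 -> x = 0 \/ y = 0) ->
  forall r n (v : 'I_n -> 'rV[O]_r), (r < n)%N -> exists c : 'I_n -> O,
    (exists i, c i <> 0) /\ \sum_i c i *: v i = 0.
Proof.
move=> dom r [//|n] v; rewrite ltnS => le_rn.
pose w i (j : 'I_n) := if insub (val j) : option 'I_r is Some j' then v i ord0 j' else 0.
have [c [ci hc]] := domain_dependent dom w; exists c; split=> //.
apply/rowP => j; rewrite summxE mxE -[RHS](hc (widen_ord le_rn j)).
by apply: eq_bigr => i _; rewrite mxE /w /= insubT //= => ?;
   congr (_ * v i _ _); apply: val_inj.
Qed.

Lemma sum_pair (U V : zmodType) (I : Type) (r : seq I) (P : pred I) (F : I -> U * V) :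
  \sum_(i <- r | P i) F i = (\sum_(i <- r | P i) (F i).1, \sum_(i <- r | P i) (F i).2).
Proof.
elim/big_rec3: _ => // i x y [u v] _ e; rewrite e; by case: (F i).
Qed.

Lemma rank_modE (A B : comNzRingType) (f : {rmorphism A -> B}) (M : lmodType A)
    (W V : set M) r :
  (forall n, independent_mod f W V n <-> (n <= r)%N) -> rank_mod f W V = r.
Proof.
move=> h; rewrite /rank_mod.
have -> : [set n | independent_mod f W V n /\ ~ independent_mod f W V n.+1] = [set r].
  apply/seteqP; split=> n /=.
    by rewrite !h => -[nr /negP]; rewrite -ltnNge ltnS => rn; apply/eqP; rewrite eqn_leq nr.
  by move=> ->; rewrite !h ltnn leqnn.
by apply: xget_unique => //= y ->.
Qed.

Section QuasiFreeRanks.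
Variables (A O : comNzRingType) (f : {rmorphism A -> O}) (z : A).
Hypothesis fz : double_ring f z.
Variables (M : lmodType A) (a b : nat).
Variable phi : {linear M -> ('rV[A]_a * restrict f 'rV[O]_b)%type}.
Hypothesis phi_bij : bijective phi.

Let fz0 : f z = 0.
Proof. by have [_ h _ _] := fz; apply/h; exists 1; rewrite mulr1. Qed.

Let phi_inj : injective phi := bij_inj phi_bij.

Let phi_surj w : exists m, phi m = w.
Proof. by have [g _ gK] := phi_bij; exists (g w); rewrite gK. Qed.

Let phi_sum n (c : 'I_n -> A) (m : 'I_n -> M) :
  phi (\sum_i c i *: m i)
  = (\sum_i c i *: (phi (m i)).1, \sum_i f (c i) *: ((phi (m i)).2 : 'rV[O]_b)).
Proof. by rewrite linear_sum sum_pair; congr pair; apply: eq_bigr => i _; rewrite linearZ. Qed.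

Let sum_map n (c : 'I_n -> A) (x : 'I_n -> 'rV[A]_a) :
  map_mx f (\sum_i c i *: x i) = \sum_i f (c i) *: map_mx f (x i).
Proof. by rewrite map_mx_sum; apply: eq_bigr => i _; rewrite map_mxZ. Qed.

Let z_row0 (x : 'rV[A]_a) : z *: x = 0 <-> map_mx f x = 0.
Proof.
have [_ _ fz1 _] := fz; split=> /rowP h; apply/rowP => j.
  by rewrite mxE [RHS]mxE; apply/fz1; have := h j; rewrite !mxE.
by have := h j; rewrite !mxE => /fz1.
Qed.

Let row_z (x : 'rV[A]_a) : map_mx f x = 0 <-> exists y, x = z *: y.
Proof.
have [_ hf _ _] := fz; split=> [/rowP h|[y ->]].
  have /choice[y hy] : forall j, exists y, x ord0 j = z * y.
    by move=> j; apply/hf; have := h j; rewrite !mxE.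
  by exists (\row_j y j); apply/rowP => j; rewrite !mxE.
by apply/rowP => j; rewrite !mxE rmorphM fz0 mul0r.
Qed.

Lemma independent_zmul n : independent_mod f (@zmul A z M) [set 0] n <-> (n <= a)%N.
Proof.
have [fs _ fz1 dom] := fz; split.
  case=> m [/choice[m' hm] hc]; rewrite leqNgt; apply/negP => an.
  have [d [[i di] hd]] := domain_dependent_gt dom (fun i => map_mx f (phi (m' i)).1) an.
  have [c ec] := choice (fun i => fs (d i)).
  apply: di; rewrite -ec; apply: hc => /=.
  have -> : \sum_i0 c i0 *: m i0 = z *: \sum_i c i *: m' i.
    by rewrite scaler_sumr; apply: eq_bigr => j _; rewrite hm !scalerA mulrC.
  apply: phi_inj; rewrite linearZ phi_sum linear0; congr pair.
    apply/z_row0; rewrite sum_map -[RHS]hd.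
    by apply: eq_bigr => j _; rewrite ec.
  by rewrite /= restrict_scaleE fz0 scale0r.
move=> na; have [m hm] := choice (fun i : 'I_n =>
  phi_surj (delta_mx 0 (widen_ord na i), 0)).
exists (fun i => z *: m i); split=> [i|c /= h i]; first by exists (m i).
have : z *: \sum_i c i *: m i = 0.
  by rewrite -[RHS]h scaler_sumr; apply: eq_bigr => j _; rewrite !scalerA mulrC.
move=> /(congr1 phi); rewrite linearZ phi_sum linear0 => -[/z_row0].
rewrite sum_map => /rowP/(_ (widen_ord na i)); rewrite summxE mxE (bigD1 i) //= !mxE.
rewrite hm /= !mxE !eqxx rmorph1 mulr1 big1 ?addr0 // => j nji.
rewrite !mxE hm /= mxE eqxx; have -> : (widen_ord na i == widen_ord na j) = false.
  by apply: contraNF nji => /eqP/(congr1 val)/= e; apply/eqP/val_inj.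
by rewrite rmorph0 mulr0.
Qed.

Lemma independent_mod_zmul n :
  independent_mod f [set: M] (@zmul A z M) n <-> (n <= a + b)%N.
Proof.
have [fs _ _ dom] := fz; split.
  case=> m [_ hc]; rewrite leqNgt; apply/negP => an.
  have [d [[i di] hd]] := domain_dependent_gt dom
    (fun i => row_mx (map_mx f (phi (m i)).1) ((phi (m i)).2 : 'rV[O]_b)) an.
  have [c ec] := choice (fun i => fs (d i)).
  apply: di; rewrite -ec; apply: hc => /=.
  have {hd} : row_mx (\sum_i d i *: map_mx f (phi (m i)).1)
      (\sum_i d i *: ((phi (m i)).2 : 'rV[O]_b)) = 0.
    rewrite -[RHS]hd; apply/rowP => j; rewrite !mxE summxE.
    by case: splitP => k jk; rewrite summxE; apply: eq_bigr => i' _; rewrite !mxE;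
      case: splitP => k' jk' //; rewrite ?mxE; congr (_ * _);
      [ congr (f ((phi (m i')).1 _ _)); apply: val_inj; rewrite /= -jk
      | by have := ltn_ord k; rewrite -jk jk' ltnNge leq_addr
      | by have := ltn_ord k'; rewrite -jk' jk ltnNge leq_addr
      | congr ((_ : 'rV[O]_b) _ _); apply/val_inj/(@addnI a); rewrite -jk ].
  rewrite -[RHS]row_mx0 => /eq_row_mx[h1 h2].
  have [|y ey] := (row_z (\sum_i c i *: (phi (m i)).1)).1.
    by rewrite sum_map -[RHS]h1; apply: eq_bigr => j _; rewrite ec.
  have [m' em'] := phi_surj (y, 0); exists m'.
  apply: phi_inj; rewrite linearZ phi_sum em'; congr pair; first exact: ey.
  rewrite /= scaler0 -[RHS]h2; by apply: eq_bigr => j _; rewrite ec.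
move=> nab; pose w := widen_ord nab.
have [m hm] := choice (fun i : 'I_n =>
  phi_surj (lsubmx (delta_mx 0 (w i)), rsubmx (delta_mx 0 (w i)))).
exists m; split=> // c [m' em'] i.
have := congr1 phi em'; rewrite linearZ phi_sum => -[e1 e2].
have h1 : \sum_i f (c i) *: map_mx f (phi (m i)).1 = 0.
  by rewrite -sum_map e1; apply/row_z; exists (phi m').1.
have h2 : \sum_i f (c i) *: ((phi (m i)).2 : 'rV[O]_b) = 0.
  by rewrite e2 restrict_scaleE fz0 scale0r.
have : \sum_i f (c i) *: (delta_mx 0 (w i) : 'rV[O]_(a + b)) = 0.
  rewrite -[LHS]hsubmxK -[RHS]row_mx0; congr row_mx.
    rewrite linear_sum -[RHS]h1; apply: eq_bigr => j _; rewrite linearZ hm /=.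
    by congr (_ *: _); apply/rowP => l; rewrite !mxE rmorph_nat.
  rewrite linear_sum -[RHS]h2; apply: eq_bigr => j _; by rewrite linearZ hm.
move=> /rowP/(_ (w i)); rewrite summxE mxE (bigD1 i) //= !mxE !eqxx mulr1.
rewrite big1 ?addr0 // => j nji; rewrite !mxE eqxx.
have -> : (w i == w j) = false.
  by apply: contraNF nji => /eqP/(congr1 val)/= e; apply/eqP/val_inj.
by rewrite mulr0.
Qed.

Lemma rank0_quasi_free : rank0 f z M = a.
Proof. exact/rank_modE/independent_zmul. Qed.

Lemma generalized_rank_quasi_free : generalized_rank f z M = (a + b + a)%N.
Proof.
by congr addn; apply: rank_modE; [exact: independent_mod_zmul|exact: independent_zmul].
Qed.

End QuasiFreeRanks.

(** * Quotient modules, linear functionals and dual bases *)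

Lemma linear_ex (R : pzRingType) (U : lmodType R) (V : zmodType)
    (s : GRing.Scale.law R V) (g : U -> V) :
  linear_for s g -> exists h : {linear U -> V | s}, h =1 g.
Proof.
move=> lin.
by exists (HB.pack_for {linear U -> V | s} g (GRing.isLinear.Build R U V s g lin)).
Qed.

Section LinearFunctions.
Variables (B : comNzRingType) (V W : lmodType B) (g : V -> W).
Hypothesis lin_g : linear g.

Lemma linear_zero : g 0 = 0.
Proof. by have [h eh] := linear_ex lin_g; rewrite -eh linear0. Qed.

Lemma linear_scale a x : g (a *: x) = a *: g x.
Proof. by have [h eh] := linear_ex lin_g; rewrite -!eh linearZ. Qed.

Lemma linear_add x y : g (x + y) = g x + g y.
Proof. by have [h eh] := linear_ex lin_g; rewrite -!eh linearD. Qed.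

End LinearFunctions.

Section Submodules.
Variables (B : comNzRingType) (X : lmodType B).
Implicit Types S : set X.

Definition submodule S : Prop :=
  [/\ S 0, forall x y, S x -> S y -> S (x + y) & forall a x, S x -> S (a *: x)].

Lemma submoduleB S x y : submodule S -> S x -> S y -> S (x - y).
Proof. by case=> _ SD SZ Sx Sy; apply: SD => //; rewrite -scaleN1r; apply: SZ. Qed.

Lemma submodule_sum S (T : Type) (r : seq T) (P : pred T) (F : T -> X) :
  submodule S -> (forall i, P i -> S (F i)) -> S (\sum_(i <- r | P i) F i).
Proof. by case=> S0 SD _ h; elim/big_ind: _. Qed.

Lemma submodule0 : submodule [set 0].
Proof. by split=> [|x y -> ->|a x ->]; rewrite ?addr0 ?scaler0. Qed.

Definition submodule_pred S (hS : submodule S) : pred X := fun x => `[< S x >].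

Section Quotient.
Variables (S : set X) (hS : submodule S).

Fact submodule_pred_zmod : zmod_closed (submodule_pred hS).
Proof.
have [S0 _ _] := hS; split=> [|x y /asboolP Sx /asboolP Sy]; first exact/asboolP.
by apply/asboolP; apply: submoduleB.
Qed.

Definition submodule_closed : zmodClosed X :=
  HB.pack_for (zmodClosed X) (submodule_pred hS)
    (GRing.isZmodClosed.Build X (submodule_pred hS) submodule_pred_zmod).

Definition quotient_module : Type := Quotient.quot submodule_closed.
HB.instance Definition _ := GRing.Zmodule.on quotient_module.

Local Notation proj := (\pi_(Quotient.quot submodule_closed)%qT).

Let proj_eq x y : proj x = proj y <-> S (x - y).
Proof.
split=> [/eqP|Sxy]; first by rewrite -Quotient.idealrBE => /asboolP.
by apply/eqP; rewrite -Quotient.idealrBE; apply/asboolP.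
Qed.

Let scale (a : B) (x : quotient_module) : quotient_module := proj (a *: repr x).

Let scale_proj a x : scale a (proj x) = proj (a *: x).
Proof.
apply/proj_eq; rewrite -scalerBr; case: hS => _ _; apply; apply/proj_eq.
by rewrite reprK.
Qed.

Let projP (x : quotient_module) : exists y, x = proj y.
Proof. by exists (repr x); rewrite reprK. Qed.

Fact quotient_scaleA a b x : scale a (scale b x) = scale (a * b) x.
Proof. by have [y ->] := projP x; rewrite !scale_proj scalerA. Qed.

Fact quotient_scale1 : left_id 1 scale.
Proof. by move=> x; have [y ->] := projP x; rewrite !scale_proj scale1r. Qed.

Fact quotient_scaleDr : right_distributive scale +%R.
Proof.
move=> a x x'; have [y ->] := projP x; have [y' ->] := projP x'.
by rewrite -[proj y + proj y']raddfD !scale_proj scalerDr raddfD.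
Qed.

Fact quotient_scaleDl x : {morph scale^~ x : a b / a + b}.
Proof.
by move=> a b; have [y ->] := projP x; rewrite !scale_proj scalerDl raddfD.
Qed.

HB.instance Definition _ := GRing.Zmodule_isLmodule.Build B quotient_module
  quotient_scaleA quotient_scale1 quotient_scaleDr quotient_scaleDl.

Lemma quotient_ex : exists (D : lmodType B) (p : {linear X -> D}),
  forall x, p x = 0 <-> S x.
Proof.
exists quotient_module.
have [|p ep] := @linear_ex B X quotient_module *:%R (fun x => proj x).
  by move=> a x y; rewrite raddfD /= -scale_proj.
exists p => x; rewrite ep -[x in S x]subr0 -proj_eq raddf0; split=> ->; exact.
Qed.

End Quotient.
End Submodules.

(** The projection of X onto its quotient by the span of the pure tensors agrees with the zero map
    on pure tensors, hence is zero by uniqueness. *)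
Lemma tensor_span (B : comNzRingType) (V M X : lmodType B) (beta : V -> M -> X) :
  is_tensor beta ->
  forall x, exists L : seq (V * M), x = \sum_(p <- L) beta p.1 p.2.
Proof.
move=> [[lr ll] univ] x.
have hS : submodule [set x | exists L : seq (V * M), x = \sum_(p <- L) beta p.1 p.2].
  split=> [|_ _ [L ->] [L' ->]|a _ [L ->]].
  - by exists [::]; rewrite big_nil.
  - by exists (L ++ L'); rewrite big_cat.
  - exists [seq (a *: p.1, p.2) | p <- L]; rewrite big_map scaler_sumr.
    by apply: eq_bigr => p _ /=; rewrite (linear_scale (ll p.2)).
have [D [p hp]] := quotient_ex hS.
have [|h [h1 h2]] := univ D (fun _ _ => 0).
  by split=> ? a ? ?; rewrite scaler0 addr0.
apply/hp; rewrite (h2 p); first by rewrite -(h2 \0%R).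
by move=> v m; apply/hp; exists [:: (v, m)]; rewrite big_seq1.
Qed.

Section Functionals.
Variables (k : fieldType) (V : lmodType k).

(** A subspace maximal among those containing S and avoiding r is a hyperplane complementary to the
    line of r; phi is the coordinate along r. *)
Lemma exists_functional (S : set V) (r : V) : submodule S -> ~ S r ->
  exists phi : {scalar V}, (forall v, S v -> phi v = 0) /\ phi r = 1.
Proof.
move=> hS nSr; have [S0 SD SZ] := hS.
have [|J [[hH nHr] Jmax]] :=
    @Zorn_bigcup V [set J | submodule (S `|` J) /\ ~ (S `|` J) r].
  move=> F FP Ftot /=; split; last first.
    by case=> // -[J FJ Jr]; have [_] := FP _ FJ; apply; right.
  split; first by left.
    move=> x y [Sx|[J FJ Jx]] [Sy|[K FK Ky]].
    - by left; apply: SD.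
    - have [[_ KD _] _] := FP _ FK.
      have [||h|h] := KD x y; [by left|by right|by left|by right; exists K].
    - have [[_ KD _] _] := FP _ FJ.
      have [||h|h] := KD x y; [by right|by left|by left|by right; exists J].
    - have [JK|KJ] := Ftot _ _ FJ FK.
        have [[_ KD _] _] := FP _ FK.
        have [||h|h] := KD x y; [by right; apply: JK|by right|by left|by right; exists K].
      have [[_ KD _] _] := FP _ FJ.
      have [||h|h] := KD x y; [by right|by right; apply: KJ|by left|by right; exists J].
  move=> a x [Sx|[J FJ Jx]]; first by left; apply: SZ.
  have [[_ _ KZ] _] := FP _ FJ.
  have [|h|h] := KZ a x; [by right|by left|by right; exists J].
set H := S `|` J in hH nHr.
have [H0 HD HZ] := hH.
have coord w : exists a : k, H (w - a *: r).
  have [Hw|nHw] := pselect (H w); first by exists 0; rewrite scale0r subr0.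
  pose K := [set v | exists h a, H h /\ v = h + a *: w].
  have hK : submodule K.
    split=> [|_ _ [h [a [Hh ->]]] [h' [a' [Hh' ->]]]|c _ [h [a [Hh ->]]]].
    - by exists 0, 0; rewrite scale0r addr0.
    - by exists (h + h'), (a + a'); split; [exact: HD|rewrite scalerDl addrACA].
    - by exists (c *: h), (c * a); split; [exact: HZ|rewrite scalerDr scalerA].
  have HK : H `<=` K by move=> h Hh; exists h, 0; rewrite scale0r addr0.
  have [h [a [Hh er]]] : K r.
    apply: contrapT => nKr; apply: (Jmax K).
      split=> [v Jv|KJ]; first by apply: HK; right.
      by apply: nHw; right; apply: KJ; exists 0, 1; rewrite scale1r add0r.
    have SK : S `|` K = K by apply/setUidPr => v Sv; apply: HK; left.
    by rewrite /mkset SK.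
  have a0 : a != 0.
    by apply/eqP => a0; apply: nHr; rewrite er a0 scale0r addr0.
  exists a^-1; have -> : w - a^-1 *: r = - a^-1 *: h.
    by rewrite er scalerDr scalerA mulVf // scale1r opprD addrCA subrr addr0 scaleNr.
  exact: HZ.
have [phi hphi] := choice coord.
have uniq w a : H (w - a *: r) -> phi w = a.
  move=> Hw; apply: contrapT => /eqP; rewrite -subr_eq0 => na; apply: nHr.
  have := HZ (phi w - a)^-1 _ (submoduleB hH Hw (hphi w)).
  by rewrite opprB [X in _ *: X]addrC addrA subrK -scalerBl scalerA mulVf // scale1r.
have [|g eg] := @linear_ex k V k *%R phi.
  move=> a u v; apply: uniq.
  have -> : a *: u + v - (a * phi u + phi v) *: r
            = a *: (u - phi u *: r) + (v - phi v *: r).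
    by rewrite scalerDl scalerBr scalerA opprD addrACA.
  by apply: HD; [apply: HZ|]; apply: hphi.
exists g; split=> [v Sv|]; rewrite eg; apply: uniq.
  by rewrite scale0r subr0; left.
by rewrite scale1r subrr.
Qed.

Definition dual_sum n (e : 'I_n -> V) (phi : 'I_n -> {scalar V}) (v : V) : V :=
  \sum_i phi i v *: e i.

Lemma dual_sum_linear n (e : 'I_n -> V) (phi : 'I_n -> {scalar V}) :
  linear (dual_sum e phi).
Proof.
move=> a u v; rewrite /dual_sum scaler_sumr -big_split /=.
by apply: eq_bigr => p _; rewrite linearP scalerDl scalerA.
Qed.

(** A finite substitute for a basis of V adapted to S: the vectors of the list are recovered, modulo
    S, from finitely many functionals vanishing on S. The last clause places the e_i in the span of
    the list. *)
Lemma local_dual_basis (S : set V) (s : seq V) : submodule S ->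
  exists n (e : 'I_n -> V) (phi : 'I_n -> {scalar V}),
    [/\ forall i v, S v -> phi i v = 0,
        forall v, v \in s -> S (v - dual_sum e phi v)
      & forall T, submodule T -> (forall v, v \in s -> T v) -> forall i, T (e i)].
Proof.
move=> hS; have [S0 _ _] := hS.
elim: s => [|x s [n [e [phi [phiS sS eT]]]]].
  by exists 0%N, (fun=> 0), (fun=> \0%R); split=> [[]|v|T _ _ []] //.
pose r := x - dual_sum e phi x.
have [Sr|nSr] := pselect (S r).
  exists n, e, phi; split=> // [v|T hT hv].
    by rewrite inE => /orP[/eqP->//|/sS].
  by apply: eT => // v vs; apply: hv; rewrite inE vs orbT.
have [psi0 [psiS psir]] := exists_functional hS nSr.
(* Composing with the remainder makes the new functional vanish on the vectors already recovered
   modulo S, which are thus undisturbed, while its value at x is 1. *)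
have [|psi epsi] := @linear_ex k V k *%R (fun v => psi0 (v - dual_sum e phi v)).
  move=> a u v; rewrite dual_sum_linear -linearP; congr (psi0 _).
  by rewrite scalerBr opprD addrACA.
pose e' i := if unlift ord0 i is Some j then e j else r.
pose phi' i := if unlift ord0 i is Some j then phi j else psi.
have sumE v : dual_sum e' phi' v = psi0 (v - dual_sum e phi v) *: r + dual_sum e phi v.
  rewrite /dual_sum big_ord_recl /e' /phi' unlift_none epsi; congr (_ + _).
  by apply: eq_bigr => i _; rewrite liftK.
exists n.+1, e', phi'; split.
- move=> i v Sv; rewrite /phi'; case: unlift => [j|]; first exact: phiS.
  by rewrite epsi /dual_sum big1 ?subr0 ?psiS // => j _; rewrite phiS ?scale0r.
- move=> v; rewrite inE sumE => /orP[/eqP->|vs].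
    by rewrite psir scale1r subrK subrr.
  by rewrite (psiS _ (sS _ vs)) scale0r add0r; apply: sS.
- move=> T hT hv i.
  have hTe j : T (e j).
    by apply: (eT _ hT) => v vs; apply: hv; rewrite inE vs orbT.
  rewrite /e'; case: unlift => [j|]; first exact: hTe.
  apply: submoduleB => //; first by apply: hv; rewrite mem_head.
  apply: submodule_sum => // j _.
  by case: hT => _ _; apply.
Qed.

End Functionals.

(** * Noetherian algebras *)

(** Unlike [noetherian], this includes the unit ideal, so that no ideal has to be checked for
    properness. *)
Definition ideals_finitely_generated (A : comNzRingType) : Prop :=
  forall I : set A, ideal I -> exists s, I = ideal_of_seq s.

Section HilbertBasis.
Variable A : comNzRingType.
Hypothesis fgA : ideals_finitely_generated A.

(* Hilbert's basis theorem: f_n is chosen of least degree in I outside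
   (f_0, ..., f_{n-1}); once the leading coefficient of f_N is a combination of
   the previous ones, f_N can be replaced by an element of smaller degree. *)
Lemma hilbert_basis : ideals_finitely_generated {poly A}.
Proof.
move=> I iI; apply: contrapT => nfg; have [I0 ID IM] := iI.
have next (s : seq {poly A}) : exists g, (forall x, x \in s -> I x) ->
    [/\ I g, ~ ideal_of_seq s g
      & forall h, I h -> ~ ideal_of_seq s h -> (size g <= size h)%N].
  have [sI|nsI] := pselect (forall x, x \in s -> I x); last by exists 0.
  have [g0 [Ig0 ng0]] : exists g, I g /\ ~ ideal_of_seq s g.
    apply: contrapT => /forallNP h; apply: nfg; exists s; apply/seteqP; split.
      by move=> g Ig; apply: contrapT => ng; apply: (h g).
    exact: ideal_of_seq_sub.
  have ex : exists n, `[< exists g, [/\ I g, ~ ideal_of_seq s g & size g = n] >].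
    by exists (size g0); apply/asboolP; exists g0.
  have [n /asboolP[g [Ig ng <-]] nmin] := ex_minnP ex.
  exists g => _; split=> // h Ih nh; apply: nmin; apply/asboolP; by exists h.
have {next}[g hg] := choice next.
pose S := fix S n := if n is m.+1 then rcons (S m) (g (S m)) else [::].
have SI n : forall x, x \in S n -> I x.
  elim: n => [//|n IH] x /=; rewrite mem_rcons inE => /orP[/eqP->|/IH//].
  by have [] := hg _ IH.
have szS n : size (S n) = n by elim: n => //= n IH; rewrite size_rcons IH.
pose F n := g (S n).
have nthS m n : (n < m)%N -> nth 0 (S m) n = F n.
  elim: m => // m IH; rewrite ltnS leq_eqVlt => /orP[/eqP->|nm] /=.
    by rewrite nth_rcons szS ltnn eqxx.
  by rewrite nth_rcons szS nm IH.
have IF n : I (F n) by have [] := hg _ (SI n).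
have nF n : ~ ideal_of_seq (S n) (F n) by have [] := hg _ (SI n).
have Smono m n : (n <= m)%N -> ideal_of_seq (S n) `<=` ideal_of_seq (S m).
  move=> nm; apply: ideal_of_seq_sub; first exact: ideal_of_seqP.
  move=> x xS; have [j] := nthP (0 : {poly A}) xS; rewrite szS => i_n <-.
  rewrite nthS // -(nthS m) ?(leq_trans i_n) //.
  by apply: ideal_of_seq_mem; rewrite mem_nth // szS (leq_trans i_n).
have szF m n : (n <= m)%N -> (size (F n) <= size (F m))%N.
  move=> nm; have [_ _ ] := hg _ (SI n); apply; first exact: IF.
  by move=> /(Smono _ _ nm); apply: nF.
have F0 n : F n != 0.
  by apply/eqP => F0; apply: (nF n); rewrite F0; have [] := ideal_of_seqP (S n).
pose J n : set A := ideal_of_seq (map lead_coef (S n)).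
have noethA : noetherian A by move=> K /proper_idealP[iK _]; exact: fgA.
have [n|n|N hN] := @noetherian_acc _ J noethA.
- exact: ideal_of_seqP.
- apply: ideal_of_seq_sub; first exact: ideal_of_seqP.
  by move=> x xs; apply: ideal_of_seq_mem; rewrite /= map_rcons mem_rcons inE xs orbT.
have [|c ec] := hN N.+1 (lead_coef (F N)).
  by apply: ideal_of_seq_mem; rewrite /= map_rcons mem_rcons mem_head.
rewrite size_map in c ec; rewrite szS in c ec.
(* d and e i are the degrees of F N and F i. Shifting each F i by X^(d - e i) gives q the degree and
   the leading coefficient of F N. *)
pose d := (size (F N)).-1; pose e n := (size (F n)).-1.
pose q := \sum_(i < N) (c i)%:P * ('X^(d - e i) * F i).
have q_S : ideal_of_seq (S N) q.
  have [_ _ SM] := ideal_of_seqP (S N).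
  apply: ideal_sum; first exact: ideal_of_seqP.
  move=> i _; apply/SM/SM; rewrite -(nthS N) //.
  by apply: ideal_of_seq_mem; rewrite mem_nth ?szS.
have szd n : size (F n) = (e n).+1 by rewrite /e prednK // size_poly_gt0.
have coefq j : (d <= j)%N -> q`_j = if j == d then lead_coef (F N) else 0.
  move=> dj; rewrite /q coef_sum.
  have ed (i : 'I_N) : (e i <= d)%N.
    by have := szF N i (ltnW (ltn_ord i)); rewrite !szd.
  have [->|jd] := eqVneq j d.
    rewrite ec; apply: eq_bigr => i _; rewrite coefCM coefXnM.
    rewrite ltnNge leq_subr /= subKn // (nth_map 0) ?szS // nthS //.
  rewrite big1 // => i _; rewrite coefCM coefXnM ltnNge (leq_trans (leq_subr _ _) dj) /=.
  rewrite nth_default ?mulr0 // szd ltn_subRL.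
  by rewrite addnC subnKC // ltn_neqAle eq_sym jd.
have : (size (F N) <= size (F N - q)%R)%N.
  have [_ _ ] := hg _ (SI N); apply.
    apply: idealB => //; apply: (ideal_of_seq_sub iI (SI N)) q_S.
  move=> h; apply: (nF N); rewrite -[F N](subrK q).
  by have [_ SD _] := ideal_of_seqP (S N); apply: SD.
apply/negP; rewrite -ltnNge szd ltnS; apply/leq_sizeP => j dj.
rewrite coefB coefq //; have [->|jd] := eqVneq j d.
  by rewrite lead_coefE subrr.
by rewrite nth_default ?subrr // szd ltn_neqAle eq_sym jd.
Qed.

End HilbertBasis.

Lemma ideals_finitely_generated_image (A B : comNzRingType) (f : {rmorphism A -> B}) :
  (forall b, exists a, f a = b) -> ideals_finitely_generated A ->
  ideals_finitely_generated B.
Proof.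
move=> fs fgA I [I0 ID IM].
have [|s es] := fgA [set a | I (f a)].
  split=> /= [|a b ha hb|a b hb]; rewrite ?rmorph0 ?rmorphD ?rmorphM //.
    exact: ID.
  exact: IM.
exists (map f s); apply/seteqP; split=> b; last first.
  apply: ideal_of_seq_sub => // _ /mapP[a sa ->].
  have : ideal_of_seq s a by apply: ideal_of_seq_mem.
  by rewrite -es.
have [a <-] := fs b => Ia.
have : [set a | I (f a)] a by [].
rewrite es => -[c ->]; rewrite rmorph_sum; apply: ideal_sum => [|i _].
  exact: ideal_of_seqP.
rewrite rmorphM; have [_ _] := ideal_of_seqP (map f s); apply.
by apply: ideal_of_seq_mem; rewrite map_f // mem_nth.
Qed.

(** The x_i are adjoined one at a time: A is replaced by A[X], with X sent to the first of them.
    Generation, phrased by subsets closed under sums and products, carries over to the new base. *)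
Lemma ideals_finitely_generated_ext n (A B : comNzRingType) (f : {rmorphism A -> B})
    (x : 'I_n -> B) :
  (forall S : set B, (forall a, S (f a)) -> (forall i, S (x i)) ->
    (forall u v, S u -> S v -> S (u + v)) -> (forall u v, S u -> S v -> S (u * v)) ->
    forall b, S b) ->
  ideals_finitely_generated A -> ideals_finitely_generated B.
Proof.
elim: n A f x => [|n IH] A f x gen fgA.
  apply: ideals_finitely_generated_image fgA => b.
  apply: (gen [set b | exists a, f a = b]) => [a|[]//|u v [a <-] [c <-]|u v [a <-] [c <-]].
  - by exists a.
  - by exists (a + c); rewrite rmorphD.
  - by exists (a * c); rewrite rmorphM.
have cf : commr_rmorph f (x ord0) by move=> a; exact: mulrC.
apply: (IH {poly A} (horner_morph cf) (fun i => x (lift ord0 i))); last first.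
  exact: hilbert_basis.
move=> S Sf Sx SD SM; apply: gen => // [a|i].
  by rewrite -(horner_morphC cf); apply: Sf.
have [j ->|->] := unliftP ord0 i; first exact: Sx.
by rewrite -(horner_morphX cf); apply: Sf.
Qed.

Lemma finitely_generated_algebra_noetherian (k : fieldType) (B : comAlgType k) :
  finitely_generated_algebra B -> ideals_finitely_generated B.
Proof.
move=> [n [F Fs]].
apply: (@ideals_finitely_generated_ext n k B (in_alg B) (fun i => F 'X_i)); last first.
  move=> I [I0 ID IM]; have [h|] := pselect (forall a, I a -> a = 0).
    exists [::]; apply/seteqP; split=> a.
      by move=> /h ->; exists (fun=> 0); rewrite big_ord0.
    by case=> c ->; rewrite big_ord0.
  move=> /existsNP[a /not_implyP[Ia /eqP a0]]; exists [:: a].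
  apply/seteqP; split=> b; last by move=> /ideal_of_seq1[c ->]; apply: IM.
  by move=> _; apply/ideal_of_seq1; exists (b / a); rewrite mulfVK.
move=> S Sa Sx SD SM b; have [p <-] := Fs b.
have S1 : S 1 by rewrite -(scale1r (1 : B)); exact: Sa.
have SX u m : S u -> S (u ^+ m).
  by move=> Su; elim: m => [|m IH]; [exact: S1|rewrite exprS; exact: SM].
have S0 : S 0 by rewrite -(scale0r (1 : B)); exact: Sa.
rewrite [p]mpolyE linear_sum /=; elim/big_ind: _ => // m _.
rewrite linearZ /= -mulr_algl; apply: (SM); first exact: Sa.
rewrite mpolyXE_id rmorph_prod; apply: (big_ind S) => // i _.
by rewrite rmorphXn; apply/SX/Sx.
Qed.

(* Locally a domain, noetherian and connected: Ann(a) and Ann(Ann(a)) generate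
   the unit ideal, which yields an idempotent. *)
Lemma connected_domain (B : comNzRingType) :
  ideals_finitely_generated B ->
  (forall e : B, e * e = e -> e = 0 \/ e = 1) ->
  (forall m : set B, maximal_ideal m ->
    exists (L : comNzRingType) (phi : {rmorphism B -> L}),
      is_localization (~` m) phi /\ forall x y : L, x * y = 0 -> x = 0 \/ y = 0) ->
  forall x y : B, x * y = 0 -> x = 0 \/ y = 0.
Proof.
move=> fgB conn loc y a ya.
pose An := [set b | b * a = 0]; pose An2 := [set c | forall b, b * a = 0 -> c * b = 0].
have iAn : ideal An.
  rewrite /An; split=> /= [|b c hb hc|b c hc]; first by rewrite mul0r.
    by rewrite mulrDl hb hc addr0.
  by rewrite -mulrA hc mulr0.
have iAn2 : ideal An2.
  rewrite /An2; split=> /= [|b c hb hc|b c hc] d hd; first by rewrite mul0r.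
    by rewrite mulrDl hb // hc // addr0.
  by rewrite -mulrA hc // mulr0.
pose J := [set w | exists u v, [/\ An u, An2 v & w = u + v]].
have [A0 AD AM] := iAn; have [A20 A2D A2M] := iAn2.
have iJ : ideal J.
  split=> [|_ _ [u [v [hu hv ->]]] [u' [v' [hu' hv' ->]]]|b _ [u [v [hu hv ->]]]].
  - by exists 0, 0; split; rewrite ?addr0.
  - by exists (u + u'), (v + v'); split; [exact: AD|exact: A2D|rewrite addrACA].
  - by exists (b * u), (b * v); split; [exact: AM|exact: A2M|rewrite mulrDr].
have [[u [v [Au A2v e1]]]|nJ] := pselect (J 1).
  have uu : u * u = u.
    by rewrite -[RHS]mul1r e1 mulrDl (A2v u Au) addr0.
  have [u0|u1] := conn u uu; last by right; rewrite -[a]mul1r -u1.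
  by left; rewrite -[y]mul1r e1 u0 add0r (A2v y ya).
(* A maximal ideal m containing both annihilators is impossible. If a dies in the localization at m,
   an element outside m kills a. Otherwise all of Ann(a) dies there and, being finitely generated,
   is killed by a single element outside m. *)
have [|m mm Jm] := @exists_maximal_ideal _ J; first exact/proper_idealP.
have /prime_idealP[[m0 mD mM] m1 mp] := maximal_prime mm.
have [L [phi [[_ _ loc0] domL]]] := loc m mm.
exfalso; have [fa0|fa0] := pselect (phi a = 0).
  have [s ns sa] := loc0 a fa0; apply: ns; apply: Jm.
  by exists s, 0; split; rewrite ?addr0.
have [s es] := fgB An iAn.
have kill b : An b -> exists2 u, ~ m u & u * b = 0.
  move=> ba; apply: loc0; have : phi b * phi a = 0 by rewrite -rmorphM ba rmorph0.
  by case/domL.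
have kills (t : seq B) : (forall b, b \in t -> An b) ->
    exists2 u, ~ m u & forall b, b \in t -> u * b = 0.
  elim: t => [_|b t IH ht]; first by exists 1.
  have [u nu hu] := kill b (ht b (mem_head _ _)).
  have [w nw hw] := IH (fun b' h => ht b' (mem_behead (s := b :: t) h)).
  exists (u * w); first by move=> /mp[].
  move=> b'; rewrite inE => /orP[/eqP->|b't]; first by rewrite mulrAC hu mul0r.
  by rewrite -mulrA hw // mulr0.
have [|u nu hu] := kills s; first by move=> b bs; rewrite es; exact: ideal_of_seq_mem.
apply: nu; apply: Jm; exists 0, u; split; rewrite ?add0r // => b ba.
have : An b by [].
rewrite es => -[c ->]; rewrite big_distrr big1 //= => i _.
by rewrite mulrCA hu ?mulr0 // mem_nth.
Qed.

(** * Points of affine varieties *)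

(** The interval ]0, 1[ has positive Lebesgue measure, so it is uncountable and not covered by
    countably many finite fibres. *)
Lemma infinite_fibre (R : realType) (g : R[i] -> nat) :
  exists d, forall n, exists s : seq R[i],
    [/\ uniq s, size s = n & forall x, x \in s -> x != 0 /\ g x = d].
Proof.
pose D d := [set x : R | x != 0 /\ g x%:C%C = d].
have [d infD] : exists d, cardinality.infinite_set (D d).
  apply: contrapT => /forallNP fin.
  have cD : cardinality.countable (\bigcup_d D d).
    apply: cardinality.bigcup_countable; first exact: cardinality.countableP.
    move=> d _; apply: cardinality.finite_set_countable.
    exact: contrapT (fin d).
  have /lebesgue_measure.countable_lebesgue_measure0 :
      cardinality.countable (`]0, 1[%classic : set R).
    apply: cardinality.sub_countable cD; apply: cardinality.subset_card_le => x.
    rewrite /= in_itv /= => /andP[x0 _]; exists (g x%:C%C) => //=.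
    by split=> //; rewrite gt_eqF.
  rewrite lebesgue_measure.lebesgue_measure_itv /= constructive_ereal.lte01.
  by case=> /eqP; rewrite oppr0 addr0 oner_eq0.
exists d => n; have [F FD nF] := cardinality.infinite_set_fset n infD.
exists [seq x%:C%C | x <- take n (finmap.enum_fset F)]; split.
- rewrite map_inj_uniq ?take_uniq ?finmap.fset_uniq //; exact: complexI.
- by rewrite size_map size_takel.
- move=> _ /mapP[x /mem_take xF ->].
  have [x0 gx] : D d x by apply: FD.
  by split=> //; apply: contraNneq x0 => /complexI ->.
Qed.

(** As [msize] is the degree plus one, the q i lie in the span of the monomials of degree < d; D is
    one more than the number of these. *)
Lemma mpoly_dependent (k : fieldType) n d :
  exists D, forall q : 'I_D -> {mpoly k[n]}, (forall i, (msize (q i) <= d)%N) ->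
    exists mu : 'I_D -> k, (exists i, mu i != 0) /\ \sum_i mu i *: q i = 0.
Proof.
pose D := #|{: 'X_{1..n < d}}|; exists D.+1 => q szq.
pose Q := \matrix_(i < D.+1, j < D) (q i)@_(enum_val j : 'X_{1..n < d}).
have kQ : kermx Q != 0.
  rewrite -mxrank_eq0 mxrank_ker subn_eq0 -ltnNge ltnS; exact: rank_leq_col.
exists (nz_row (kermx Q) 0); split.
  have : nz_row (kermx Q) != 0 by rewrite nz_row_eq0.
  by move=> /rV0Pn[j hj]; exists j.
apply/mpolyP => m; rewrite mcoeff0 linear_sum /=.
have [md|md] := ltnP (mdeg m) d; last first.
  rewrite big1 // => j _; rewrite mcoeffZ memN_msupp_eq0 ?mulr0 //.
  by apply/negP => /msize_mdeg_lt; apply/negP; rewrite -leqNgt (leq_trans (szq j)).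
have /sub_kermxP/rowP/(_ (enum_rank (BMultinom md))) := nz_row_sub (kermx Q).
rewrite !mxE => e; rewrite -[RHS]e; apply: eq_bigr => j _.
by rewrite mcoeffZ mxE enum_rankK.
Qed.

Section Points.
Variables (R : realType) (B : comAlgType R[i]).
Hypothesis fgB : finitely_generated_algebra B.

(* Zariski's lemma through the uncountability of the field: uncountably many
   inverses of b - l in a space of countable dimension satisfy a linear
   relation, which becomes an algebraic equation for b. *)
Lemma prime_residue (p : set B) (b : B) : prime_ideal p ->
  (forall l : R[i], l != 0 -> exists e, p ((b - l%:A) * e - 1)) ->
  exists l : R[i], p (b - l%:A).
Proof.
move=> /[dup] prp /prime_idealP[ip p1 pp] hinv; have [n [F Fs]] := fgB.
have [p0 pD pM] := ip.
have hq l : exists q : {mpoly R[i][n]}, l != 0 -> p ((b - l%:A) * F q - 1).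
  have [->|l0] := eqVneq l 0; first by exists 0.
  by have [e he] := hinv l l0; have [q eq] := Fs e; exists q => _; rewrite eq.
have [q {}hq] := choice hq.
have [d hd] := infinite_fibre (fun l => msize (q l)).
have [D hD] := mpoly_dependent R[i] n d.
have [s [us ss hs]] := hd D.
pose l (j : 'I_D) := s`_j.
have hl j : l j != 0 /\ msize (q (l j)) = d by apply: hs; rewrite mem_nth ?ss.
have linj j j' : l j = l j' -> j = j'.
  by move=> /eqP; rewrite nth_uniq ?ss // => /eqP/val_inj.
have [j|mu [[j0 mu0] hmu]] := hD (fun j => q (l j)); first by rewrite (hl j).2.
pose e j := F (q (l j)).
have he : \sum_j mu j *: e j = 0.
  have := congr1 F hmu; rewrite linear_sum linear0 => h; rewrite -[RHS]h.
  by apply: eq_bigr => j _; rewrite linearZ.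
(* G is the numerator of sum_j mu_j / (X - l_j) over the common denominator. At X = l_j0 only the
   term of j0 survives, so G is not zero. *)
pose G := \sum_j mu j *: \prod_(j' | j' != j) ('X - (l j')%:P) : {poly R[i]}.
have G0 : G != 0.
  apply/eqP => /(congr1 (horner^~ (l j0))); rewrite horner0 horner_sum.
  rewrite (bigD1 j0) //= [X in _ + X]big1 => [|j jj0]; last first.
    rewrite hornerZ horner_prod (bigD1 j0) 1?eq_sym //= hornerXsubC subrr.
    by rewrite mul0r mulr0.
  rewrite addr0 hornerZ horner_prod => /eqP; rewrite mulf_eq0 (negPf mu0) /=.
  apply/negP/prodf_neq0 => j jj0; rewrite hornerXsubC subr_eq0.
  by apply: contraNneq jj0 => /linj ->.
pose T := \prod_j (b - (l j)%:A).
have evX a : horner_alg b ('X - a%:P) = b - a%:A.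
  by rewrite rmorphB /= horner_algX horner_algC.
have pG : p (horner_alg b G).
  have -> : horner_alg b G = \sum_j mu j *: \prod_(j' | j' != j) (b - (l j')%:A).
    rewrite /G linear_sum; apply: eq_bigr => j _; rewrite linearZ /= mulr_algl; congr (_ *: _).
    by rewrite rmorph_prod; apply: eq_bigr => j' _; exact: evX.
  (* Subtracting T times the relation sum_j mu_j e_j = 0 brings out the factors (b - l_j) e_j - 1,
     which lie in p. *)
  have -> : \sum_j mu j *: \prod_(j' | j' != j) (b - (l j')%:A)
     = \sum_j (mu j)%:A * (\prod_(j' | j' != j) (b - (l j')%:A) * -1
          * ((b - (l j)%:A) * e j - 1)).
    rewrite -[LHS]subr0 -[X in _ - X = _](mulr0 T) -[X in T * X]he mulr_sumr -sumrB.
    apply: eq_bigr => j _.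
    have -> : T = (b - (l j)%:A) * \prod_(j' | j' != j) (b - (l j')%:A).
      by rewrite /T (bigD1 j).
    rewrite -[mu j *: e j]mulr_algl -[mu j *: \prod_(j' | _) _]mulr_algl.
    move: (mu j)%:A (e j) (l j)%:A => u1 u2 u3; ring.
  apply: ideal_sum => // j _; apply/pM/pM; rewrite /e; apply: hq.
  by have [] := hl j.
(* Over an algebraically closed field G splits, and the prime p must contain one of the linear
   factors evaluated at b. *)
have [r er] := closed_field_poly_normal G.
have := pG; rewrite er linearZ rmorph_prod /= => /pp[|].
  move=> pl; case: p1; apply: (ideal_invertible ip pl).
  exists ((lead_coef G)^-1)%:A.
  by rewrite mulr_algl scalerA divff ?scale1r // lead_coef_eq0.
have : forall r : seq R[i], p (\prod_(x <- r) (b - x%:A)) -> exists x, p (b - x%:A).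
  elim=> [|x r' IH]; first by rewrite big_nil => /p1.
  by rewrite big_cons => /pp[hx|/IH//]; exists x.
move=> /(_ r) h pr; apply: h; move: pr.
by congr (p _); apply: eq_bigr => x _; exact: evX.
Qed.

(** Nullstellensatz. Each b is congruent to a scalar modulo m, since otherwise all b - l would be
    invertible modulo m; the scalar is unique and is the value of b at the point. *)
Lemma maximal_point (m : set B) : maximal_ideal m ->
  exists chi : {rmorphism B -> R[i]},
    (forall l, chi l%:A = l) /\ m = [set b | chi b = 0].
Proof.
move=> mm; have prm := maximal_prime mm; have /prime_idealP[im m1 mp] := prm.
have [m0 mD mM] := im; have mB := idealB im.
have res b : exists l : R[i], m (b - l%:A).
  have [//|nres] := pselect (exists l : R[i], m (b - l%:A)).
  apply: (prime_residue prm) => l _.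
  have [[x [y [mx e1]]]|h] := pselect (exists x y, m x /\ x + (b - l%:A) * y = 1).
    exists y; have -> : (b - l%:A) * y - 1 = - 1 * x
      by rewrite -[X in _ - X = _]e1 opprD addrCA subrr addr0 mulN1r.
    exact: mM.
  case: nres; exists l; case: mm => _ mmax.
  have <- : [set w | exists x y, m x /\ w = x + (b - l%:A) * y] = m.
    apply: mmax; last by move=> x mx; exists x, 0; rewrite mulr0 addr0.
    apply/proper_idealP; split; last by case=> x [y [mx e]]; apply: h; exists x, y.
    split=> [|_ _ [x [y [mx ->]]] [x' [y' [mx' ->]]]|a _ [x [y [mx ->]]]].
    - by exists 0, 0; rewrite mulr0 addr0.
    - by exists (x + x'), (y + y'); split; [exact: mD|rewrite mulrDr addrACA].
    - by exists (a * x), (a * y); split; [exact: mM|rewrite mulrDr mulrCA].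
  by exists 0, 1; rewrite mulr1 add0r.
have [chi hchi] := choice res.
have uniq b l : m (b - l%:A) -> chi b = l.
  move=> hl; apply: contrapT => /eqP; rewrite -subr_eq0 => nl; apply: m1.
  have := mM ((chi b - l)^-1)%:A _ (mB _ _ hl (hchi b)).
  rewrite opprB [X in _ * X]addrC addrA subrK -scalerBl mulr_algl scalerA mulVf //.
  by rewrite scale1r.
have chiD : zmod_morphism chi.
  move=> x y; apply: uniq; rewrite scalerBl.
  have -> : x - y - ((chi x)%:A - (chi y)%:A) = (x - (chi x)%:A) - (y - (chi y)%:A).
    by ring.
  exact: mB.
have chiM : monoid_morphism chi.
  split; first by apply: uniq; rewrite scale1r subrr.
  move=> x y; apply: uniq.
  have -> : x * y - (chi x * chi y)%:A
     = y * (x - (chi x)%:A) + (chi x)%:A * (y - (chi y)%:A).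
    by rewrite -scalerA -[chi x *: _]mulr_algl; ring.
  by apply: mD; apply: mM.
exists (HB.pack_for {rmorphism B -> R[i]} chi
  (GRing.isZmodMorphism.Build B R[i] chi chiD)
  (GRing.isMonoidMorphism.Build B R[i] chi chiM)); split=> /=.
  by move=> l; apply: uniq; rewrite subrr.
apply/seteqP; split=> b /=.
  by move=> mb; apply: uniq; rewrite scale0r subr0.
by move=> cb; have := hchi b; rewrite cb scale0r subr0.
Qed.

Lemma point_maximal (chi : {rmorphism B -> R[i]}) :
  (forall l, chi l%:A = l) -> maximal_ideal [set b | chi b = 0].
Proof.
move=> hchi; split.
  apply/proper_idealP; split; last by rewrite /= rmorph1; apply/eqP; rewrite oner_eq0.
  split=> /= [|x y hx hy|a x hx]; first exact: rmorph0.
    by rewrite rmorphD hx hy addr0.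
  by rewrite rmorphM hx mulr0.
move=> I /proper_idealP[[I0 ID IM] I1] sI; apply/seteqP; split=> // b Ib /=.
apply: contrapT => /eqP cb; apply: I1.
have -> : 1 = ((chi b)^-1)%:A * b + (1 - ((chi b)^-1)%:A * b) by ring.
apply: ID; first exact: IM.
by apply: sI; rewrite /= rmorphB rmorph1 rmorphM hchi mulVf ?subrr.
Qed.

(** If b vanished at every closed point other than t0, then b tau would vanish at all closed points,
    and b tau - l would be invertible for each scalar l <> 0; hence b tau would itself be a scalar.
    It is nonzero in a domain, and a nonzero scalar cannot lie in t0. *)
Lemma jacobson (t0 : set B) (tau b : B) :
  (forall x y : B, x * y = 0 -> x = 0 \/ y = 0) ->
  maximal_ideal t0 -> t0 tau -> tau <> 0 -> b <> 0 ->
  exists2 t, maximal_ideal t & t <> t0 /\ ~ t b.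
Proof.
move=> dom mt0 t0tau tau0 b0; apply: contrapT => h.
have all_t t : maximal_ideal t -> t (b * tau).
  move=> mt; have /prime_idealP[[_ _ tM] _ _] := maximal_prime mt.
  have [->|ntt0] := pselect (t = t0).
    by have /prime_idealP[[_ _ t0M] _ _] := maximal_prime mt0; apply: t0M.
  have [tb|ntb] := pselect (t b); first by rewrite mulrC; apply: tM.
  by case: h; exists t.
have pr0 : prime_ideal [set 0 : B].
  apply/prime_idealP; split=> /=; last exact: dom.
    by split=> [|x y -> ->|a x ->]; rewrite ?addr0 ?mulr0.
  by apply/eqP; rewrite oner_eq0.
have [l /= /eqP] : exists l : R[i], [set 0 : B] (b * tau - l%:A).
  apply: prime_residue => // l l0.
  have [e ee] : invertible (b * tau - l%:A).
    apply: contrapT => /not_invertible_maximal[t mt tb].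
    have /prime_idealP[it t1 _] := maximal_prime mt.
    have := idealB it (all_t t mt) tb; rewrite opprB addrC subrK => tl.
    apply: t1; apply: (ideal_invertible it tl); exists (l^-1)%:A.
    by rewrite mulr_algl scalerA divff // scale1r.
  by exists e; rewrite /= ee subrr.
rewrite subr_eq0 => /eqP el.
have [l0|l0] := eqVneq l 0.
  by move: el; rewrite l0 scale0r => /dom[].
have := all_t t0 mt0; rewrite el => tl.
have /prime_idealP[it t1 _] := maximal_prime mt0.
apply: t1; apply: (ideal_invertible it tl); exists (l^-1)%:A.
by rewrite mulr_algl scalerA divff // scale1r.
Qed.

End Points.

(** * Lower semicontinuity of the rank *)

Section SmoothCurve.
Variables (k : fieldType) (B : comAlgType k).
Hypothesis cB : smooth_connected_affine_curve B.

Lemma curve_domain (x y : B) : x * y = 0 -> x = 0 \/ y = 0.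
Proof.
have [fgB conn loc] := cB; apply: connected_domain conn _ x y => [|m mm].
  exact: finitely_generated_algebra_noetherian.
have [L [phi [hphi rL]]] := loc m mm; exists L, phi; split=> //.
by have [p /uniformizer_domain] := regular_dim1_uniformizer rL.
Qed.

(** The valuation of the local ring at m with denominators cleared: b is tau^n up to factors outside
    m. *)
Lemma curve_valuation (m : set B) : maximal_ideal m ->
  exists tau, [/\ m tau, tau <> 0 & forall b, b <> 0 ->
    exists n u v, [/\ ~ m u, ~ m v & u * b = tau ^+ n * v]].
Proof.
move=> mm; have [_ _ loc] := cB; have [L [phi [[inv frac ker] rL]]] := loc m mm.
have /prime_idealP[[m0 mD mM] m1 mp] := maximal_prime mm.
have inj x y : phi x = phi y -> x = y.
  move=> e; have [|s ns sx] := ker (x - y); first by rewrite rmorphB e subrr.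
  have [s0|/eqP] := curve_domain sx; first by case: ns; rewrite s0.
  by rewrite subr_eq0 => /eqP.
have notm v : invertible (phi v) -> ~ m v.
  move=> [l el] mv; have [s ns [a ea]] := frac l; apply: ns.
  have -> : s = a * v by apply: inj; rewrite rmorphM -ea -mulrA (mulrC l) el mulr1.
  exact: mM.
have [p up] := regular_dim1_uniformizer rL; have [np p0 hp] := up.
have [s ns [tau etau]] := frac p.
have nmX u n : ~ m u -> ~ m (u ^+ n).
  by move=> nu /(prime_idealX (maximal_prime mm)).
exists tau; split.
- by apply: contrapT => /inv; rewrite -etau => /invertibleM[].
- move=> tau0; have : phi s * p = 0 by rewrite etau tau0 rmorph0.
  case/(uniformizer_domain up) => [s0|]; last by rewrite -[p]expr1; exact: p0.
  by have := inv _ ns; rewrite s0 => /not_invertible0.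
- move=> b b0; have [|n [w [iw eb]]] := hp (phi b).
    by move=> fb; apply: b0; apply: inj; rewrite fb rmorph0.
  have [sw nsw [v ev]] := frac w.
  exists n, (sw * s ^+ n), v; split.
  + by move=> /mp[//|]; apply: nmX.
  + by apply: notm; rewrite -ev; apply/invertibleM; split=> //; apply: inv.
  + apply: inj; rewrite !rmorphM !rmorphXn -ev -etau eb exprMn; ring.
Qed.

Lemma curve_uniformizer_divides (m : set B) tau b :
  maximal_ideal m -> m tau ->
  (forall b, b <> 0 -> exists n u v, [/\ ~ m u, ~ m v & u * b = tau ^+ n * v]) ->
  m b -> exists u b', ~ m u /\ u * b = tau * b'.
Proof.
move=> mm mtau val mb; have /prime_idealP[[m0 mD mM] m1 mp] := maximal_prime mm.
have [->|/eqP/val[[|n] [u [v [nu nv e]]]]] := eqVneq b 0.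
- by exists 1, 0; rewrite !mulr0.
- by case: nv; rewrite -[v]mul1r -e; apply: mM.
- by exists u, (tau ^+ n * v); rewrite e exprS mulrA.
Qed.

End SmoothCurve.

(** M is its own tensor product with B, and multiplication by b is injective on the domain B. *)
Lemma flat_torsionfree (B : comNzRingType) (M : lmodType B) (b : B) :
  (forall x y : B, x * y = 0 -> x = 0 \/ y = 0) -> flat M -> b <> 0 ->
  forall m : M, b *: m = 0 -> m = 0.
Proof.
move=> dom flM b0 m bm.
have [|f ef] := @linear_ex B B^o B^o *:%R (fun x : B => b * x).
  by move=> a x y; rewrite mulrDr mulrCA.
have [|h eh] := @linear_ex B M M *:%R (fun m => b *: m).
  by move=> a x y; rewrite /= scalerDr !scalerA [b * a]mulrC.
have tM : is_tensor (fun (v : B^o) (m : M) => (v : B) *: m).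
  split.
    split=> [v a x y|x a u v]; first by rewrite scalerDr !scalerA mulrC.
    by rewrite scalerDl; congr (_ + _); exact: (esym (scalerA a (u : B) x)).
  move=> D delta [d1 d2].
  have [|g eg] := @linear_ex B M D *:%R (delta 1); first exact: d1.
  exists g; split=> [v x|g' hg' x]; last by rewrite eg -hg' scale1r.
  rewrite eg (linear_scale (d1 1)) -(linear_scale (d2 x)).
  by congr (delta _ _); exact: mulr1.
have hinj : injective h.
  apply: (flM _ _ f _ _ _ _ _ tM tM) => [x y|v w].
    rewrite !ef => /eqP; rewrite -subr_eq0 -mulrBr => /eqP/dom[//|/eqP].
    by rewrite subr_eq0 => /eqP.
  by rewrite eh ef scalerA.
by apply: hinj; rewrite linear0 eh.
Qed.

(** * Generic freeness of finitely generated modules *)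

Section GenericFreeness.
Variables (E : comNzRingType) (Z : set E) (Md : lmodType E).
Hypothesis prZ : prime_ideal Z.

Definition lincomb (c : nat -> E) (x : seq Md) : Md := \sum_(i < size x) c i *: x`_i.

Definition span_mod (V : set Md) (x : seq Md) : set Md :=
  [set w | exists c v, V v /\ w = lincomb c x + v].

(** When Z Md is contained in V, this is independence in Md / V over the domain E / Z. *)
Definition independent_over (V : set Md) (x : seq Md) : Prop :=
  forall c, V (lincomb c x) -> forall i, (i < size x)%N -> Z (c i).

Lemma lincombD c d x : lincomb (fun i => c i + d i) x = lincomb c x + lincomb d x.
Proof. by rewrite -big_split; apply: eq_bigr => j _; rewrite scalerDl. Qed.

Lemma lincombZ a c x : lincomb (fun i => a * c i) x = a *: lincomb c x.
Proof. by rewrite /lincomb scaler_sumr; apply: eq_bigr => j _; rewrite scalerA. Qed.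

Lemma span_mod_submodule V x : submodule V -> submodule (span_mod V x).
Proof.
move=> [V0 VD VZ]; split.
- exists (fun=> 0), 0; split=> //.
  by rewrite addr0 /lincomb big1 // => j _; rewrite scale0r.
- move=> _ _ [c [v [Vv ->]]] [d [v' [Vv' ->]]].
  exists (fun j => c j + d j), (v + v'); split; first exact: VD.
  by rewrite lincombD addrACA.
- move=> a _ [c [v [Vv ->]]]; exists (fun j => a * c j), (a *: v).
  by rewrite lincombZ scalerDr; split=> //; apply: VZ.
Qed.

Lemma span_mod_base V x v : V v -> span_mod V x v.
Proof.
move=> Vv; exists (fun=> 0), v; split=> //.
by rewrite /lincomb big1 ?add0r // => j _; rewrite scale0r.
Qed.

Lemma span_mod_nth V x j : submodule V -> (j < size x)%N -> span_mod V x x`_j.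
Proof.
move=> [V0 _ _] jx; exists (fun l => (l == j)%:R), 0; split=> //.
rewrite addr0 /lincomb (bigD1 (Ordinal jx)) //= eqxx scale1r big1 ?addr0 // => l nl.
by rewrite (_ : (l == j :> nat) = false) ?scale0r //; exact: negbTE.
Qed.

Lemma span_mod_cat V x y : submodule V -> span_mod V x `<=` span_mod V (x ++ y).
Proof.
move=> hV _ [c [v [Vv ->]]]; have [S0 SD SZ] := span_mod_submodule (x ++ y) hV.
apply: SD; last exact: span_mod_base.
apply: submodule_sum => [|j _]; [exact: span_mod_submodule|apply: SZ].
have := @span_mod_nth V (x ++ y) j hV; rewrite nth_cat ltn_ord; apply.
by rewrite size_cat ltn_addr.
Qed.

(* x ++ y is a maximal independent family, with y taken from the generators ws. *)
Lemma generic_freeness (V : set Md) (x ws : seq Md) : submodule V ->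
  (forall w, w \in ws -> forall e, Z e -> V (e *: w)) -> independent_over V x ->
  exists y s, [/\ independent_over V (x ++ y), ~ Z s
    & forall w, w \in ws -> span_mod V (x ++ y) (s *: w)].
Proof.
have /prime_idealP[[Z0 ZD ZM] Z1 Zp] := prZ.
move=> hV; elim: ws x => [|w ws IH] x hws indx.
  by exists [::], 1; rewrite cats0.
have hws' w' : w' \in ws -> forall e, Z e -> V (e *: w').
  by move=> w'ws; apply: hws; rewrite inE w'ws orbT.
have [ind|nind] := pselect (independent_over V (rcons x w)).
  have [y [s [indy ns hs]]] := IH _ hws' ind.
  exists (w :: y), s; rewrite -cat_rcons; split=> // w'.
  rewrite inE => /orP[/eqP->|]; last exact: hs.
  have [_ _ SZ] := span_mod_submodule (rcons x w ++ y) hV; apply: SZ.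
  have := @span_mod_nth V (rcons x w ++ y) (size x) hV.
  rewrite nth_cat size_rcons ltnS leqnn nth_rcons ltnn eqxx; apply.
  by rewrite size_cat size_rcons addSn ltnS leq_addr.
have [c [Vc [j [jx nZj]]]] : exists c, V (lincomb c (rcons x w)) /\
    exists j, (j < size (rcons x w))%N /\ ~ Z (c j).
  apply: contrapT => h; apply: nind => c Vc j jx; apply: contrapT => nZ.
  by apply: h; exists c; split=> //; exists j.
have lcE : lincomb c (rcons x w) = lincomb c x + c (size x) *: w.
  rewrite /lincomb size_rcons big_ord_recr /= nth_rcons ltnn eqxx; congr (_ + _).
  by apply: eq_bigr => l _; rewrite nth_rcons ltn_ord.
have hV' := hV; have [V0 VD VZ] := hV'.
(* If the coefficient of w were in Z, which kills w modulo V, a relation among x alone would remain.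
   So w lies in the span of x up to the factor c (size x). *)
have nZs : ~ Z (c (size x)).
  move=> Zs; have Vw : V (c (size x) *: w) by apply: hws => //; rewrite mem_head.
  have /indx hx : V (lincomb c x).
    by rewrite -[lincomb c x](addrK (c (size x) *: w)) -lcE; apply: submoduleB.
  move: jx; rewrite size_rcons ltnS leq_eqVlt => /orP[/eqP je|/hx//].
  by apply: nZj; rewrite je.
have [y [s [indy ns hs]]] := IH _ hws' indx.
exists y, (s * c (size x)); split=> // [/Zp[]//|w'].
have [_ SD SZ] := span_mod_submodule (x ++ y) hV.
rewrite inE => /orP[/eqP->|w'ws]; last by rewrite mulrC -scalerA; apply/SZ/hs.
rewrite -scalerA; apply: SZ; apply: span_mod_cat => //.
exists (fun l => - c l), (lincomb c (rcons x w)); split=> //.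
rewrite lcE addrA -lincombD /lincomb big1 ?add0r // => l _.
by rewrite addNr scale0r.
Qed.

End GenericFreeness.

(** * Coordinates and evaluation on the tensor algebra *)

Section TensorAlgebra.
Variables (k : fieldType) (A O B E : comAlgType k) (f : {lrmorphism A -> O}) (z : A).
Variables (iA : {lrmorphism A -> E}) (iB : {lrmorphism B -> E}).
Hypotheses (hf : double_ring f z) (tE : is_tensor_algebra iA iB).

Let fz0 : f z = 0.
Proof. by have [_ h _ _] := hf; apply/h; exists 1; rewrite mulr1. Qed.

Lemma tensor_algebra_ind (S : E -> Prop) :
  (forall u v, S u -> S v -> S (u + v)) -> S 0 ->
  (forall a b, S (iA a * iB b)) -> forall e, S e.
Proof.
move=> SD S0 Sab e; have [L ->] := tensor_span tE e.
by elim/big_ind: _ => // p _; exact: Sab.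
Qed.

Lemma coord_ex (phi : {scalar O}) :
  exists h : {linear E -> B}, forall a b, h (iA a * iB b) = phi (f a) *: b.
Proof.
have [_ univ] := tE.
have [|h [hh _]] := univ B (fun a b => phi (f a) *: b); last by exists h.
split=> [a c x y|b c x y]; first by rewrite scalerDr !scalerA mulrC.
by rewrite !linearP scalerDl scalerA.
Qed.

(* The map phi (x) id : O (x) B -> B, composed with E = A (x) B -> O (x) B. *)
Definition scalar_coord (phi : {scalar O}) : {linear E -> B} := projT1 (cid (coord_ex phi)).

Lemma coordE phi a b : scalar_coord phi (iA a * iB b) = phi (f a) *: b.
Proof. exact: (projT2 (cid (coord_ex phi))). Qed.

Lemma coordM phi b e : scalar_coord phi (iB b * e) = b * scalar_coord phi e.
Proof.
elim/tensor_algebra_ind: e => [u v hu hv||a b'].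
- by rewrite mulrDr !linearD hu hv mulrDr.
- by rewrite mulr0 linear0 mulr0.
- by rewrite mulrCA -rmorphM !coordE scalerAr.
Qed.

Lemma coord_mulA phi a : exists psi : {scalar O},
  forall e, scalar_coord phi (iA a * e) = scalar_coord psi e.
Proof.
have [|psi hpsi] := @linear_ex k O k *%R (fun x => phi (f a * x)).
  by move=> c x y; rewrite mulrDr linearD -scalerAr linearZ.
exists psi; elim/tensor_algebra_ind => [u v hu hv||a' b].
- by rewrite mulrDr !linearD hu hv.
- by rewrite mulr0 !linear0.
- by rewrite mulrA -rmorphM !coordE hpsi rmorphM.
Qed.

(** The kernel of E -> O (x) B, since functionals on O separate the elements of O (x) B. *)
Definition coord_zero : set E := [set e | forall phi, scalar_coord phi e = 0].

Lemma coord_zero_ideal : ideal coord_zero.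
Proof.
split=> [phi|x y hx hy phi|e x hx]; first exact: linear0.
  by rewrite linearD hx hy addr0.
elim/tensor_algebra_ind: e => [u v hu hv phi||a b phi].
- by rewrite mulrDl linearD hu hv addr0.
- by move=> phi; rewrite mul0r linear0.
- have [psi hpsi] := coord_mulA phi a.
  by rewrite -mulrA hpsi coordM hx mulr0.
Qed.

(** For e = sum a_i b_i, a local dual basis (o_j, phi_j) of the f a_i is lifted to elements al_j of
    A. Up to a multiple of z, e is the sum of the al_j times its coordinates along the phi_j. *)
Lemma coord_zeroP e : coord_zero e <-> exists e', e = iA z * e'.
Proof.
split=> [|[e' ->]]; last first.
  have [_ _ ZM] := coord_zero_ideal; rewrite mulrC; apply: ZM => phi.
  by rewrite -[iA z]mulr1 -(rmorph1 iB) coordE fz0 linear0 scale0r.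
have [L eL] := tensor_span tE e.
have [n [o [phi [_ hs _]]]] :=
  @local_dual_basis k O [set 0] [seq f p.1 | p <- L] (submodule0 O).
have [fs fker _ _] := hf; have [al hal] := choice (fun j => fs (o j)).
suff [e' ee] : exists e', e = \sum_j iA (al j) * iB (scalar_coord (phi j) e) + iA z * e'.
  move=> hZ; exists e'; rewrite [LHS]ee big1 ?add0r // => j _.
  by rewrite hZ rmorph0 mulr0.
rewrite {}eL; elim: L hs => [_|[a b] L IH hs].
  by exists 0; rewrite big_nil mulr0 addr0 big1 // => j _; rewrite linear0 rmorph0 mulr0.
have [v vL|e' IHe] := IH; first by apply: hs; rewrite inE vL orbT.
have /fker[w ew] : f (a - \sum_j phi j (f a) *: al j) = 0.
  rewrite -[RHS](hs (f a)) ?mem_head // linearB linear_sum; congr (_ - _).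
  by apply: eq_bigr => j _; rewrite linearZ /= hal.
exists (e' + iA w * iB b); rewrite big_cons /=.
move: IHe; set S := \sum_(p <- L) _ => IHe.
pose P := \sum_j phi j (f a) *: al j.
have e1 : \sum_j iA (al j) * iB (scalar_coord (phi j) (iA a * iB b + S))
    = iA P * iB b + \sum_j iA (al j) * iB (scalar_coord (phi j) S).
  rewrite linear_sum mulr_suml -big_split; apply: eq_bigr => j _ /=.
  rewrite linearD coordE [iB (_ + _)]linearD /= mulrDr [iB (_ *: _)]linearZ /=.
  by rewrite [iA (_ *: _)]linearZ /= -scalerAl -scalerAr.
have e2 : iA a = iA P + iA z * iA w.
  by rewrite -rmorphM -ew rmorphB addrC subrK.
rewrite e1 [in LHS]e2 [in LHS]IHe.
move: (iA P) (\sum_j _) (iA z) (iA w) (iB b) => u1 u2 u3 u4 u5; ring.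
Qed.

Section Evaluation.
Variable chi : {rmorphism B -> k}.
Hypothesis chi_k : forall l, chi l%:A = l.

Let chiZ l b : chi (l *: b) = l * chi b.
Proof. by rewrite -mulr_algl rmorphM chi_k. Qed.

Lemma eval_ex : exists h : {linear E -> A}, forall a b, h (iA a * iB b) = chi b *: a.
Proof.
have [_ univ] := tE.
have [|h [hh _]] := univ A (fun a b => chi b *: a); last by exists h.
split=> [a c x y|b c x y]; first by rewrite rmorphD chiZ scalerDl scalerA.
by rewrite scalerDr !scalerA mulrC.
Qed.

Definition eval_at : {linear E -> A} := projT1 (cid eval_ex).

Lemma evalE a b : eval_at (iA a * iB b) = chi b *: a.
Proof. exact: (projT2 (cid eval_ex)). Qed.

Lemma evalA a : eval_at (iA a) = a.
Proof. by rewrite -[iA a]mulr1 -(rmorph1 iB) evalE rmorph1 scale1r. Qed.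

Lemma evalB b : eval_at (iB b) = (chi b)%:A.
Proof. by rewrite -[iB b]mul1r -(rmorph1 iA) evalE. Qed.

Lemma evalM e e' : eval_at (e * e') = eval_at e * eval_at e'.
Proof.
elim/tensor_algebra_ind: e => [u v hu hv||a b].
- by rewrite mulrDl !linearD hu hv mulrDl.
- by rewrite mul0r !linear0 mul0r.
elim/tensor_algebra_ind: e' => [u v hu hv||a' b'].
- by rewrite mulrDr !linearD hu hv mulrDr.
- by rewrite mulr0 !linear0 mulr0.
- by rewrite mulrACA -!rmorphM !evalE rmorphM -scalerAl -scalerAr scalerA.
Qed.

(** Both sides are (phi o f) (x) chi on A (x) B. *)
Lemma chi_coord phi e : chi (scalar_coord phi e) = phi (f (eval_at e)).
Proof.
elim/tensor_algebra_ind: e => [u v hu hv||a b].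
- by rewrite !linearD rmorphD hu hv.
- by rewrite !linear0 rmorph0.
- by rewrite coordE evalE chiZ !linearZ /= mulrC.
Qed.

Lemma coord_zero_eval e : coord_zero e -> f (eval_at e) = 0.
Proof.
move=> he; apply: contrapT => fe.
have [phi [_ p1]] := exists_functional (submodule0 O) (r := f (eval_at e)) fe.
by move: p1; rewrite -chi_coord he rmorph0 => /eqP; rewrite eq_sym oner_eq0.
Qed.

Lemma fibre_eval (MM : lmodType E) (N : lmodType A)
    (p : {linear restrict iA MM -> N}) :
  (forall m : MM, p m = 0 <-> ideal_mul B [set b | chi b = 0] (restrict iB MM) m) ->
  forall e (m : MM), p (e *: m) = eval_at e *: p m.
Proof.
move=> hp; have pA a (m : MM) : p (iA a *: m) = a *: p m by exact: (linearZZ p a m).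
have pD (m m' : MM) : p (m + m') = p m + p m' by exact: (linearD p).
have pB b (m : MM) : p (iB b *: m) = ((chi b)%:A : A) *: p m.
  have h0 : p (iB (b - (chi b)%:A) *: m) = 0.
    apply/hp; exists 1%N, (fun=> b - (chi b)%:A), (fun=> m); split.
      by move=> _ /=; rewrite rmorphB chi_k subrr.
    by rewrite big_ord1.
  have iBA : iB (chi b)%:A = iA (chi b)%:A by rewrite !linearZ /= !rmorph1.
  by rewrite -[b in LHS](subrK (chi b)%:A) rmorphD /= scalerDl pD h0 add0r iBA pA.
elim/tensor_algebra_ind => [u v hu hv m||a b m].
- by rewrite scalerDl pD hu hv linearD scalerDl.
- by move=> m; rewrite scale0r !linear0 scale0r.
- by rewrite -scalerA pA pB evalE scalerA mulr_algr.
Qed.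
End Evaluation.
End TensorAlgebra.

(** * From independence in the special fibre to another fibre *)

Section Necessity.
Variables (R : realType) (A O B E : comAlgType R[i]).
Variables (f : {lrmorphism A -> O}) (z : A).
Variables (iA : {lrmorphism A -> E}) (iB : {lrmorphism B -> E}).
Hypotheses (hf : double_ring f z) (tE : is_tensor_algebra iA iB).
Hypothesis cB : smooth_connected_affine_curve B.

Let fgB : finitely_generated_algebra B. Proof. by have [] := cB. Qed.

Let domB := curve_domain cB.

Let domO : forall x y : O, x * y = 0 -> x = 0 \/ y = 0.
Proof. by have [] := hf. Qed.

Lemma scalar_neq0 : exists phi : {scalar O}, phi 1 = 1.
Proof.
have [|phi [_ h]] := @exists_functional R[i] O [set 0] 1 (submodule0 O); last by exists phi.
by move=> /eqP; rewrite oner_eq0.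
Qed.

(** Two elements with a nonzero coordinate each have nonzero values at a common closed point, by the
    Jacobson property, and these values multiply in the domain O. *)
Lemma coord_zero_prime (t0 : set B) : maximal_ideal t0 ->
  prime_ideal (coord_zero f tE).
Proof.
move=> mt0; have [tau [t0tau tau0 _]] := curve_valuation cB mt0.
apply/prime_idealP; split; first exact: coord_zero_ideal.
  move=> h; have [phi p1] := scalar_neq0; have := h phi.
  rewrite -[1]mulr1 -{1}(rmorph1 iA) -(rmorph1 iB) coordE rmorph1 p1 scale1r.
  by move=> /eqP; rewrite oner_eq0.
move=> e e' hee; apply: contrapT => /not_orP[/existsNP[phi he] /existsNP[psi he']].
have [|t mt [_ nt]] := jacobson fgB domB mt0 t0tau tau0
    (b := scalar_coord f tE phi e * scalar_coord f tE psi e').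
  by move=> /domB[].
have [chi [chi_k et]] := maximal_point fgB mt.
have {}nt : chi (scalar_coord f tE phi e) <> 0 /\ chi (scalar_coord f tE psi e') <> 0.
  by split=> h; apply: nt; rewrite et /= rmorphM h ?mul0r ?mulr0.
have := coord_zero_eval chi_k hee; rewrite evalM rmorphM => /domO[] h0.
  by apply: nt.1; rewrite chi_coord h0 linear0.
by apply: nt.2; rewrite chi_coord h0 linear0.
Qed.

Section SpecialFibre.
Variables (MM : lmodType E) (t0 : set B).
Hypotheses (flMM : flat (restrict iB MM)) (mt0 : maximal_ideal t0).
Variables (M : lmodType A) (p : {linear restrict iA MM -> M}).
Hypothesis fibre0 :
  forall m : MM, p m = 0 <-> ideal_mul B t0 (restrict iB MM) m.

Lemma torsionfree (b : B) (m : MM) : b <> 0 -> iB b *: m = 0 -> m = 0.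
Proof. by move=> b0; apply: (flat_torsionfree domB flMM b0 (m := m)). Qed.

(** A pure tensor a b differs from its value at t0 by a (b - b(t0)), which tau divides up to a
    factor outside t0. The value of e, being in the kernel of f, is a multiple of z. *)
Lemma divide_uniformizer tau (e : E) (chi : {rmorphism B -> R[i]})
    (chi_k : forall l, chi l%:A = l) :
  t0 = [set b | chi b = 0] -> t0 tau ->
  (forall b, b <> 0 -> exists n u v, [/\ ~ t0 u, ~ t0 v & u * b = tau ^+ n * v]) ->
  f (eval_at tE chi_k e) = 0 ->
  exists u e', ~ t0 u /\ coord_zero f tE (iB u * e - iB tau * e').
Proof.
move=> et0 ttau val fe.
have /prime_idealP[[m0 mD mM] m1 mp] := maximal_prime mt0.
have [u [e' [nu ue]]] : exists u e', ~ t0 u /\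
    iB u * (e - iA (eval_at tE chi_k e)) = iB tau * e'.
  elim/(tensor_algebra_ind tE): e {fe} => [e1 e2 [u1 [e1' [nu1 h1]]] [u2 [e2' [nu2 h2]]]||a b].
  - exists (u1 * u2), (iB u2 * e1' + iB u1 * e2'); split; first by move=> /mp[].
    rewrite rmorphM linearD rmorphD mulrDr [RHS]mulrDr mulrCA -[RHS]/(_ + _).
    transitivity (iB u2 * (iB u1 * (e1 - iA (eval_at tE chi_k e1)))
                + iB u1 * (iB u2 * (e2 - iA (eval_at tE chi_k e2)))); first by ring.
    by rewrite h1 h2; ring.
  - by exists 1, 0; rewrite linear0 rmorph0 subrr !mulr0.
  - have [|u [b' [nu ub]]] := curve_uniformizer_divides (b := b - (chi b)%:A) mt0 ttau val.
      by rewrite et0 /= rmorphB chi_k subrr.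
    exists u, (iA a * iB b'); split=> //.
    have -> : iA a * iB b - iA (eval_at tE chi_k (iA a * iB b)) = iA a * iB (b - (chi b)%:A).
      rewrite evalE [iB (_ - _)]linearB /= mulrBr; congr (_ - _).
      by rewrite [iA (_ *: _)]linearZ [iB (_ *: _)]linearZ /= rmorph1 mulr_algr.
    by rewrite mulrCA -rmorphM ub rmorphM mulrCA.
exists u, e'; split=> //; have [_ fker _ _] := hf.
have [w ew] := (fker _).1 fe.
apply/(coord_zeroP hf tE _); exists (iB u * iA w).
by rewrite -ue mulrBr opprB addrCA subrr addr0 ew rmorphM mulrCA.
Qed.

Variables (a : nat) (m : 'I_a -> MM).
Hypothesis indep0 : forall c : 'I_a -> A,
  \sum_j c j *: (z *: (p (m j) : M)) = 0 -> forall j, f (c j) = 0.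

(** Infinite descent. At t0 the relation gives f (e_j(t0)) = 0, so up to a factor outside t0 and
    modulo z it is tau times another relation, which holds by torsion-freeness. The coordinates of
    the e_j are thus divisible by all powers of tau, up to factors outside t0, hence zero. *)
Lemma independent_lift (e : 'I_a -> E) :
  \sum_j e j *: (iA z *: m j) = 0 -> forall j, coord_zero f tE (e j).
Proof.
have [chi [chi_k et0]] := maximal_point fgB mt0.
have [tau [ttau tau0 val]] := curve_valuation cB mt0.
have /prime_idealP[[m0 mD mM] m1 mp] := maximal_prime mt0.
have fib : forall e (m : MM), p (e *: m) = eval_at tE chi_k e *: p m.
  by apply: fibre_eval; rewrite -et0.
have pD (x y : MM) : p (x + y) = p x + p y by exact: (linearD p).
have p0 : p (0 : MM) = 0 by exact: (linear0 p).
have pow n : forall e : 'I_a -> E, \sum_j e j *: (iA z *: m j) = 0 ->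
    forall j phi, exists u c, ~ t0 u /\ u * scalar_coord f tE phi (e j) = tau ^+ n * c.
  elim: n => [|n IH] {}e he j phi.
    by exists 1, (scalar_coord f tE phi (e j)).
  have ev0 i : f (eval_at tE chi_k (e i)) = 0.
    apply: (indep0 (c := fun i => eval_at tE chi_k (e i))).
    have := congr1 p he; rewrite p0 => h; rewrite -[RHS]h.
    rewrite (big_morph (fun x : MM => p x) pD p0); apply: eq_bigr => l _.
    by rewrite !fib evalA.
  have /choice[ue hue] : forall i, exists ue : B * E, ~ t0 ue.1 /\
      coord_zero f tE (iB ue.1 * e i - iB tau * ue.2).
    move=> i; have [u [e' h]] := divide_uniformizer et0 ttau val (ev0 i).
    by exists (u, e').
  pose U := \prod_i (ue i).1.
  have nU : ~ t0 U.
    rewrite /U; elim/big_ind: _ => // [x y nx ny /mp[]//|i _]; exact: (hue i).1.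
  pose e' i := iB (\prod_(l | l != i) (ue l).1) * (ue i).2.
  have hU i : coord_zero f tE (iB U * e i - iB tau * e' i).
    have -> : iB U * e i - iB tau * e' i = iB (\prod_(l | l != i) (ue l).1) *
        (iB (ue i).1 * e i - iB tau * (ue i).2).
      by rewrite /U (bigD1 i) //= rmorphM /e'; ring.
    have [_ _ ZM] := coord_zero_ideal f tE; apply: ZM; exact: (hue i).2.
  have zz : iA z * iA z = 0.
    rewrite -rmorphM; have [_ fker fann _] := hf.
    by rewrite (fann z).2 ?rmorph0 //; apply/fker; exists 1; rewrite mulr1.
  (* The difference of U e_i and tau e'_i is a multiple of z, which kills the vectors z m_i. *)
  have he' : \sum_i e' i *: (iA z *: m i) = 0.
    apply: (torsionfree tau0); rewrite scaler_sumr.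
    have := congr1 (fun x => iB U *: x) he; rewrite scaler0 scaler_sumr => h; rewrite -[RHS]h.
    apply: eq_bigr => i _; apply/eqP; rewrite eq_sym -subr_eq0 !scalerA -scalerBl -mulrBl.
    by have [w ->] := (coord_zeroP hf tE _).1 (hU i); rewrite mulrAC zz mul0r scale0r.
  have [u [c [nu euc]]] := IH e' he' j phi.
  exists (u * U), c; split; first by move=> /mp[].
  have := hU j phi; rewrite linearB !coordM => /eqP; rewrite subr_eq0 => /eqP h.
  transitivity (tau * (u * scalar_coord f tE phi (e' j))).
    by rewrite -mulrA h mulrCA /e' coordM.
  by rewrite euc exprS mulrA.
move=> he j phi; apply: contrapT => b0.
(* A coordinate of exact valuation N is also divisible by tau^(N+1) up to a factor outside t0, which
   forces u' v into t0. *)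
have [N [u [v [nu nv euv]]]] := val _ b0.
have [u' [c [nu' ec]]] := pow N.+1 e he j phi.
have : tau ^+ N * (u' * v - u * (tau * c)) = 0.
  rewrite mulrBr mulrCA -euv.
  have -> : tau ^+ N * (u * (tau * c)) = u * (tau ^+ N.+1 * c) by rewrite exprS; ring.
  by rewrite -ec mulrCA subrr.
have tN n : tau ^+ n <> 0.
  by elim: n => [|n IH]; [apply/eqP; rewrite oner_eq0|rewrite exprS => /domB[]].
case/domB => [/tN//|/eqP]; rewrite subr_eq0 => /eqP h.
have : t0 (u' * v) by rewrite h; apply: (mM); rewrite mulrC; apply: mM.
by case/mp.
Qed.

End SpecialFibre.

(** s1 and s2 are the denominators of generic bases of MM / z MM and of z MM, the second containing
    the z m_j, and t is a point where neither vanishes. By the first basis, tau y in z MM implies s1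
    y in z MM; the second reads off the c_j. *)
Lemma independent_generic (MM : lmodType E) (t0 : set B) (a : nat) (m : 'I_a -> MM) :
  finitely_generated MM -> maximal_ideal t0 ->
  (forall e : 'I_a -> E, \sum_j e j *: (iA z *: m j) = 0 ->
     forall j, coord_zero f tE (e j)) ->
  exists2 t, maximal_ideal t & t <> t0 /\
    forall (N : lmodType A) (p : {linear restrict iA MM -> N}),
    (forall m : MM, p m = 0 <-> ideal_mul B t (restrict iB MM) m) ->
    forall c : 'I_a -> A, \sum_j c j *: (z *: (p (m j) : N)) = 0 ->
    forall j, f (c j) = 0.
Proof.
move=> [n [g gen]] mt0 indm.
have prZ := coord_zero_prime mt0.
have /prime_idealP[[Z0 ZD ZM] Z1 Zp] := prZ.
have [tau0 [t0tau tau0_0 _]] := curve_valuation cB mt0.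
have zz : iA z * iA z = 0.
  rewrite -rmorphM; have [_ fker fann _] := hf.
  by rewrite (fann z).2 ?rmorph0 //; apply/fker; exists 1; rewrite mulr1.
pose V := [set w : MM | exists w', w = iA z *: w'].
have hV : submodule V.
  split=> [|_ _ [w ->] [w' ->]|e _ [w ->]].
  - by exists 0; rewrite scaler0.
  - by exists (w + w'); rewrite scalerDr.
  - by exists (e *: w); rewrite !scalerA mulrC.
have ZV e : coord_zero f tE e -> forall w, V (e *: w).
  by move=> /(coord_zeroP hf tE _)[e' ->] w; exists (e' *: w); rewrite scalerA.
have [||x1 [s1 [ind1 ns1 hs1]]] :=
    @generic_freeness E _ MM prZ V [::] [seq g j | j <- enum 'I_n] hV.
- by move=> w _ e /ZV.
- by move=> c _ j.
pose x2 := [seq iA z *: m j | j <- enum 'I_a].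
have nth2 (j : 'I_a) : x2`_j = iA z *: m j.
  by rewrite (nth_map j) ?size_enum_ord // nth_ord_enum.
have sz2 : size x2 = a by rewrite size_map size_enum_ord.
have comb2 (c : nat -> E) : lincomb c x2 = \sum_(j < a) c j *: (iA z *: m j).
  by rewrite /lincomb sz2; apply: eq_bigr => j _; rewrite nth2.
have [||y2 [s2 [ind2 ns2 hs2]]] := @generic_freeness E _ MM prZ [set 0] x2
    [seq iA z *: g j | j <- enum 'I_n] (submodule0 MM).
- move=> _ /mapP[j _ ->] e /(coord_zeroP hf tE _)[e' ->] /=.
  by rewrite scalerA mulrAC zz mul0r scale0r.
- move=> c /=; rewrite comb2 => /indm h j; rewrite sz2 => ja.
  exact: (h (Ordinal ja)).
have [phi1 c1] : exists phi, scalar_coord f tE phi s1 <> 0 by apply/existsNP.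
have [phi2 c2] : exists phi, scalar_coord f tE phi s2 <> 0 by apply/existsNP.
(* One nonzero coordinate of each denominator suffices: its value at t is a functional applied to
   the value of s1 or s2, which is therefore nonzero in O. *)
have [|t mt [tt0 nt]] := jacobson fgB domB mt0 t0tau tau0_0
    (b := scalar_coord f tE phi1 s1 * scalar_coord f tE phi2 s2).
  by move=> /domB[].
exists t => //; split=> // N p hp c hc j.
have [chi [chi_k et]] := maximal_point fgB mt.
have /prime_idealP[[m0 mD mM] m1 mp] := maximal_prime mt.
have [tau [ttau tau_0 val]] := curve_valuation cB mt.
have fib : forall e (m : MM), p (e *: m) = eval_at tE chi_k e *: p m.
  by apply: fibre_eval; rewrite -et.
pose ev e := f (eval_at tE chi_k e).
have evM e e' : ev (e * e') = ev e * ev e' by rewrite /ev evalM rmorphM.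
have ev1 : ev s1 <> 0.
  move=> h; apply: nt; rewrite et /= rmorphM chi_coord.
  by rewrite /ev in h; rewrite h linear0 mul0r.
have ev2 : ev s2 <> 0.
  move=> h; apply: nt; rewrite et /= rmorphM mulrC chi_coord.
  by rewrite /ev in h; rewrite h linear0 mul0r.
pose Q := \sum_j iA (c j) *: (iA z *: m j).
have pQ : p Q = 0.
  have pD (w1 w2 : MM) : p (w1 + w2) = p w1 + p w2 by exact: (linearD p).
  have p0 : p (0 : MM) = 0 by exact: (linear0 p).
  rewrite -[RHS]hc /Q (big_morph (fun x : MM => p x) pD p0); apply: eq_bigr => l _.
  by rewrite !fib !evalA.
(* Q vanishes in the fibre at t, and tau generates the ideal t up to factors outside t. *)
have [u [y [nu euy]]] : exists u y, ~ t u /\ iB u *: Q = iB tau *: y.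
  have [r [b [y [tb ->]]]] := (hp Q).1 pQ.
  have -> : \sum_i b i *: (y i : restrict iB MM) = \sum_i iB (b i) *: (y i : MM) by [].
  elim/big_ind: _ => [|w1 w2 [u1 [y1 [nu1 h1]]] [u2 [y2' [nu2 h2]]]|l _].
  - by exists 1, 0; rewrite !scaler0.
  - exists (u1 * u2), (iB u2 *: y1 + iB u1 *: y2'); split; first by move=> /mp[].
    rewrite rmorphM !scalerDr -{1}[iB u1 * _]mulrC -!scalerA h1 h2.
    by rewrite !scalerA ![iB tau * _]mulrC.
  - have [u [b' [nu ub]]] := curve_uniformizer_divides mt ttau val (tb l).
    by exists u, (iB b' *: y l); rewrite !scalerA -!rmorphM ub.
have span1 w : span_mod V x1 (s1 *: w).
  have [e ->] := gen w; rewrite scaler_sumr; apply: submodule_sum => [|l _].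
    exact: span_mod_submodule.
  rewrite scalerA mulrC -scalerA; have [_ _ SZ] := span_mod_submodule x1 hV.
  by apply: SZ; apply: hs1; rewrite map_f // mem_enum.
have span2 w : span_mod [set 0] (x2 ++ y2) (s2 *: (iA z *: w)).
  have [e ->] := gen w; rewrite !scaler_sumr; apply: submodule_sum => [|l _].
    exact/span_mod_submodule/submodule0.
  have [_ _ SZ] := span_mod_submodule (x2 ++ y2) (submodule0 MM).
  have -> : s2 *: (iA z *: (e l *: g l)) = e l *: (s2 *: (iA z *: g l)).
    by rewrite !scalerA; congr (_ *: _); ring.
  by apply: SZ; apply: hs2; apply/mapP; exists l => //; rewrite mem_enum.
have nZtau e : coord_zero f tE (iB tau * e) -> coord_zero f tE e.
  by move=> h phi; have := h phi; rewrite coordM => /domB[].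
(* tau s1 y = u s1 Q is a multiple of z, so tau times each coefficient of s1 y along x1 lies in z E;
   tau can be cancelled there. *)
have [w' ew'] : exists w', s1 *: y = iA z *: w'.
  have [d [v [[w ->] edw]]] := span1 y.
  suff [w'' ew] : V (lincomb d x1) by exists (w'' + w); rewrite edw ew scalerDr.
  have Vd : V (lincomb (fun l => iB tau * d l) x1).
    rewrite lincombZ -[lincomb d x1](addrK (iA z *: w)) -edw scalerBr.
    apply: submoduleB => //; last by exists (iB tau *: w); rewrite !scalerA mulrC.
    exists (\sum_j (iB u * s1 * iA (c j)) *: m j).
    rewrite scalerA mulrC -scalerA -euy scalerA /Q !scaler_sumr; apply: eq_bigr => l _.
    by rewrite !scalerA; congr (_ *: _); ring.
  rewrite /lincomb; apply: submodule_sum => // l _; apply: ZV; apply: nZtau.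
  exact: (ind1 _ Vd).
have [h [v [/= v0 eh]]] := span2 w'.
pose c' l := if insub l is Some i then iA (c i) else 0.
have Qc : Q = lincomb c' (x2 ++ y2).
  rewrite /lincomb size_cat sz2 big_split_ord /= [X in _ + X]big1 ?addr0 => [|l _].
    apply: eq_bigr => l _; rewrite nth_cat sz2 ltn_ord nth2 /c' valK.
  by [].
  by rewrite /c' insubF ?scale0r // ltnNge leq_addr.
(* u s1 s2 Q and tau times a combination of the second basis are equal. At t, where tau vanishes and
   u, s1, s2 do not, comparing coefficients leaves f (c_j) = 0. *)
have rel : lincomb (fun l => iB u * s1 * s2 * c' l - iB tau * h l) (x2 ++ y2) = 0.
  have -> : lincomb (fun l => iB u * s1 * s2 * c' l - iB tau * h l) (x2 ++ y2)
     = (iB u * s1 * s2) *: Q - iB tau *: lincomb h (x2 ++ y2).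
    rewrite Qc -!lincombZ -scaleN1r -lincombZ -lincombD.
    by apply: eq_bigr => l _; rewrite mulN1r.
  have -> : (iB u * s1 * s2) *: Q = iB tau *: (s2 *: (s1 *: y)).
    transitivity ((s1 * s2) *: (iB u *: Q)); first by rewrite scalerA; congr (_ *: _); ring.
    by rewrite euy !scalerA; congr (_ *: _); ring.
  by rewrite ew' eh v0 addr0 subrr.
have evD e e' : ev (e - e') = ev e - ev e' by rewrite /ev linearB rmorphB.
have : ev (iB u * s1 * s2 * c' j - iB tau * h j) = 0.
  by apply: coord_zero_eval; apply: (ind2 _ rel); rewrite size_cat sz2 ltn_addr.
rewrite evD !evM /c' valK.
have evB b : ev (iB b) = (chi b)%:A by rewrite /ev evalB linearZ /= rmorph1.
have -> : ev (iA (c j)) = f (c j) by rewrite /ev evalA.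
rewrite !evB; have -> : chi tau = 0 by move: ttau; rewrite et.
rewrite scale0r mul0r subr0 => /domO[/domO[/domO[]|]|] //.
move=> h0; exfalso; apply: nu; rewrite et /=.
by move/eqP: h0; rewrite scaler_eq0 oner_eq0 orbF => /eqP.
Qed.

End Necessity.

Lemma deformation_rank0_le (R : realType) (A O : comAlgType R[i])
    (f : {lrmorphism A -> O}) (z : A) (M : lmodType A) (r : int) :
  double_ring f z -> quasi_free f M ->
  deforms_to M (fun N => quasi_free f N /\ (rank0 f z N)%:Z = r) ->
  (rank0 f z M)%:Z <= r.
Proof.
move=> hf [a [b [phi phi_bij]]].
move=> [B [E [iA [iB [MM [t0 [[cB mt0 tE] [fg fl [p0 [p0s p0k]] fib]]]]]]]].
rewrite (rank0_quasi_free hf phi_bij).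
have [m' [hm' indm]] := (independent_zmul hf phi_bij a).2 (leqnn a).
have [m hm] := choice hm'.
have [mm hmm] := choice (fun j => p0s (m j)).
have indep0 (c : 'I_a -> A) :
    \sum_j c j *: (z *: (p0 (mm j) : M)) = 0 -> forall j, f (c j) = 0.
  move=> h; apply: indm => /=; rewrite -[RHS]h; apply: eq_bigr => j _.
  by rewrite hmm hm.
have indE := independent_lift hf tE cB fl mt0 p0k indep0.
have [t mt [tt0 hN]] := independent_generic hf cB fg mt0 indE.
have [N [p [ps pk]] [[a' [b' [psi psi_bij]]]]] := fib t mt tt0.
rewrite (rank0_quasi_free hf psi_bij) => <-.
have /(independent_zmul hf psi_bij) : independent_mod f (@zmul A z N) [set 0] a.
  exists (fun j => z *: (p (mm j) : N)); split=> [j|c /=]; first by exists (p (mm j)).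
  exact: hN.
by rewrite lez_nat.
Qed.

(** * The affine line *)

Lemma lrmorphism_ex (k : fieldType) (A B : comAlgType k) (g : {rmorphism A -> B}) :
  scalable g -> exists h : {lrmorphism A -> B}, h =1 g.
Proof.
move=> gZ; have gM : monoid_morphism g by split; [exact: rmorph1|exact: rmorphM].
by exists (HB.pack_for {lrmorphism A -> B} (g : A -> B)
  (GRing.isZmodMorphism.Build A B g (rmorphB g))
  (GRing.isMonoidMorphism.Build A B g gM) (GRing.isScalable.Build k A B *:%R g gZ)).
Qed.

Lemma alg_morph_polyE (k : fieldType) (B : comAlgType k)
    (h : {rmorphism {poly k} -> B}) (p : {poly k}) :
  (forall l, h l%:A = l%:A) -> h p = \sum_(i < size p) p`_i *: h 'X ^+ i.
Proof.
move=> hk; rewrite -{1}[p]coefK poly_def rmorph_sum; apply: eq_bigr => j _.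
by rewrite -mul_polyC rmorphM rmorphXn -alg_polyC hk mulr_algl.
Qed.

Section AffineLine.
Variable k : fieldType.

Lemma poly_finitely_generated : finitely_generated_algebra ({poly k} : comAlgType k).
Proof.
have [|F eF] := @lrmorphism_ex k {mpoly k[1]} {poly k} (mmap (@polyC k) (fun _ : 'I_1 => 'X)).
  by move=> c p; rewrite /= mmapZ mul_polyC.
exists 1%N, F => p; exists (\sum_(i < size p) p`_i *: 'X_ord0 ^+ i).
rewrite linear_sum -[RHS]coefK poly_def; apply: eq_bigr => j _.
rewrite linearZ rmorphXn /= eF; congr (_ *: _ ^+ _).
exact: etrans (mmapX _ _ _) (mmap1U _ _).
Qed.

Section Localization.
Variable c : k.

Definition regular_at : pred {fraction {poly k}} := fun x =>
  `[< exists p q : {poly k}, q.[c] != 0 /\ x = tofrac p / tofrac q >].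

Let den_neq0 (q : {poly k}) : q.[c] != 0 -> tofrac q != 0.
Proof. by move=> h; rewrite tofrac_eq0; apply: contraNneq h => ->; rewrite horner0. Qed.

Fact regular_at_subring : subring_closed regular_at.
Proof.
split.
- by apply/asboolP; exists 1, 1; rewrite hornerE oner_neq0 tofrac1 divr1.
- move=> x y /asboolP[p [q [q0 ->]]] /asboolP[p' [q' [q0' ->]]]; apply/asboolP.
  exists (p * q' - p' * q), (q * q'); rewrite hornerM mulf_neq0 //; split=> //.
  rewrite tofracB !tofracM -mulNr addf_div ?den_neq0 //.
  by rewrite mulNr.
- move=> x y /asboolP[p [q [q0 ->]]] /asboolP[p' [q' [q0' ->]]]; apply/asboolP.
  exists (p * p'), (q * q'); rewrite hornerM mulf_neq0 //; split=> //.
  by rewrite !tofracM mulf_div.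
Qed.

HB.instance Definition _ := GRing.isSubringClosed.Build {fraction {poly k}}
  regular_at regular_at_subring.

Record local_line := LocalLine { local_line_val : {fraction {poly k}};
                                 _ : regular_at local_line_val }.

HB.instance Definition _ := [isSub for local_line_val].
HB.instance Definition _ := [Choice of local_line by <:].
HB.instance Definition _ := [SubChoice_isSubComNzRing of local_line by <:].

Fact local_line_of_subproof (p : {poly k}) : regular_at (tofrac p).
Proof. by apply/asboolP; exists p, 1; rewrite hornerE oner_neq0 tofrac1 divr1. Qed.

Definition local_line_of p := LocalLine (local_line_of_subproof p).

Fact local_line_of_zmod : zmod_morphism local_line_of.
Proof. by move=> p q; apply: val_inj; rewrite /= tofracB. Qed.

Fact local_line_of_monoid : monoid_morphism local_line_of.
Proof. by split=> [|p q]; apply: val_inj; rewrite /= ?tofrac1 ?tofracM. Qed.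

HB.instance Definition _ := GRing.isZmodMorphism.Build {poly k} local_line
  local_line_of local_line_of_zmod.
HB.instance Definition _ := GRing.isMonoidMorphism.Build {poly k} local_line
  local_line_of local_line_of_monoid.

Lemma local_line_localization :
  is_localization [set p : {poly k} | p.[c] <> 0] local_line_of.
Proof.
split.
- move=> p /eqP /= pc.
  have h : regular_at (tofrac p)^-1.
    by apply/asboolP; exists 1, p; rewrite tofrac1 div1r.
  by exists (LocalLine h); apply: val_inj; rewrite /= divff ?den_neq0.
- case=> x hx; have /asboolP[p [q [q0 ex]]] := hx.
  exists q; first exact/eqP.
  by exists p; apply: val_inj; rewrite /= ex mulrC divfK ?den_neq0.
- move=> p /(congr1 val) /= /eqP; rewrite tofrac_eq0 => /eqP ->.
  by exists 1; rewrite ?mulr0 //= hornerE; apply/eqP; exact: oner_neq0.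
Qed.

(** The exponent of a fraction p / s is the multiplicity of c as a root of p. *)
Lemma local_line_uniformizer : uniformizer (local_line_of ('X - c%:P)).
Proof.
have Xc : ('X - c%:P).[c] = 0 by rewrite hornerXsubC subrr.
have [inv frac ker] := local_line_localization.
split.
- case=> y /(congr1 val) /=; have [s sc [p e]] := frac y.
  move: (congr1 val e) => /= {}e h.
  have : (tofrac (('X - c%:P) * p)) = tofrac s by rewrite tofracM -e mulrCA h mulr1.
  move/eqP; rewrite tofrac_eq => /eqP es; apply: sc.
  by rewrite -es hornerM Xc mul0r.
- move=> n /(congr1 val); rewrite -rmorphXn /= => /eqP.
  by rewrite tofrac_eq0 expf_eq0 polyXsubC_eq0 andbF.
- move=> x x0; have [s sc [p e]] := frac x.
  have p0 : p != 0.
    apply/eqP => p0; apply: x0; have [s' es'] := inv s sc.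
    by rewrite -[x]mul1r -es' mulrAC e p0 rmorph0 mul0r.
  have [n [q]] := multiplicity_XsubC p c; rewrite p0 /= => qc ep.
  have [s' es'] := inv s sc.
  exists n, (local_line_of q * s'); split.
    apply/invertibleM; split; first by apply: inv; exact/eqP.
    by exists (local_line_of s); rewrite mulrC.
  rewrite -[x]mul1r -es' mulrAC e ep rmorphM rmorphXn; exact: mulrAC.
Qed.

End Localization.

End AffineLine.

Lemma affine_line_smooth (R : realType) :
  smooth_connected_affine_curve ({poly R[i]} : comAlgType R[i]).
Proof.
split.
- exact: poly_finitely_generated.
- move=> e; move/eqP; rewrite -subr_eq0 -[X in _ - X]mulr1 -mulrBr mulf_eq0.
  by rewrite subr_eq0 => /orP[/eqP->|/eqP->]; [left|right].
- move=> m /(maximal_point (poly_finitely_generated _))[chi [chi_k ->]].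
  pose c := chi 'X.
  have chiE p : chi p = p.[c].
    rewrite (@alg_morph_polyE _ R[i]^o chi) ?horner_coef // => l.
    by rewrite chi_k; exact: (esym (mulr1 l)).
  exists (local_line c), (local_line_of c); split; last first.
    exact: uniformizer_regular (local_line_uniformizer c).
  suff -> : ~` [set b | chi b = 0] = [set p : {poly R[i]} | p.[c] <> 0].
    exact: local_line_localization.
  by apply/seteqP; split=> p /=; rewrite chiE.
Qed.

(** * Families over the affine line *)

Section PolynomialAlgebra.
Variables (k : fieldType) (A : comAlgType k).

(* {poly A} as a k-algebra; the library makes it an A-algebra. *)
Definition poly_alg : Type := {poly A}.

HB.instance Definition _ := GRing.ComNzRing.on poly_alg.

Let scale (c : k) (p : poly_alg) : poly_alg := (c%:A : A)%:P * (p : {poly A}).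

Fact poly_alg_scaleA c d p : scale c (scale d p) = scale (c * d) p.
Proof. by rewrite /scale mulrA -polyCM -scalerAl mul1r scalerA. Qed.

Fact poly_alg_scale1 : left_id 1 scale.
Proof. by move=> p; rewrite /scale scale1r mul1r. Qed.

Fact poly_alg_scaleDr : right_distributive scale +%R.
Proof. by move=> c p q; rewrite /scale mulrDr. Qed.

Fact poly_alg_scaleDl p : {morph scale^~ p : c d / c + d}.
Proof. by move=> c d; rewrite /scale scalerDl polyCD mulrDl. Qed.

HB.instance Definition _ := GRing.Zmodule_isLmodule.Build k poly_alg
  poly_alg_scaleA poly_alg_scale1 poly_alg_scaleDr poly_alg_scaleDl.

Fact poly_alg_scaleAl (c : k) (p q : poly_alg) : c *: (p * q) = c *: p * q.
Proof. exact: (mulrA (c%:A : A)%:P (p : {poly A}) q). Qed.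

HB.instance Definition _ := GRing.Lmodule_isLalgebra.Build k poly_alg poly_alg_scaleAl.
HB.instance Definition _ := GRing.Lalgebra_isComAlgebra.Build k poly_alg.

Lemma poly_alg_scaleE (c : k) (p : poly_alg) :
  c *: p = (c%:A : A) *: (p : {poly A}) :> {poly A}.
Proof. by rewrite -mul_polyC. Qed.

Lemma poly_alg_inl : exists h : {lrmorphism A -> poly_alg}, forall a, h a = a%:P :> {poly A}.
Proof.
have [|h eh] := @lrmorphism_ex k A poly_alg
  (@polyC A : {rmorphism A -> {poly A}}); last by exists h.
by move=> c a; rewrite /= -[c *: a]mulr_algl polyCM.
Qed.

Lemma poly_alg_inr : exists h : {lrmorphism {poly k} -> poly_alg},
  forall p, h p = map_poly (in_alg A) p :> {poly A}.
Proof.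
have [|h eh] := @lrmorphism_ex k {poly k} poly_alg
  (map_poly (in_alg A) : {rmorphism {poly k} -> {poly A}}); last by exists h.
by move=> c p; rewrite /= -mul_polyC rmorphM /= map_polyC.
Qed.

Definition poly_inl : {lrmorphism A -> poly_alg} := projT1 (cid poly_alg_inl).
Definition poly_inr : {lrmorphism {poly k} -> poly_alg} := projT1 (cid poly_alg_inr).

Lemma poly_inlE a : poly_inl a = a%:P :> {poly A}.
Proof. exact: (projT2 (cid poly_alg_inl)). Qed.

Lemma poly_inrE p : poly_inr p = map_poly (in_alg A) p :> {poly A}.
Proof. exact: (projT2 (cid poly_alg_inr)). Qed.

Lemma poly_inr_coef (p : {poly k}) (q : {poly A}) n :
  ((poly_inr p : {poly A}) * q)`_n = \sum_(j < n.+1) p`_j *: q`_(n - j).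
Proof.
rewrite poly_inrE coefM; apply: eq_bigr => j _.
by rewrite coef_map mulr_algl.
Qed.

(** A polynomial sum_j a_j X^j is the tensor sum_j a_j (x) X^j, which dictates the induced map. *)
Lemma poly_alg_tensor : is_tensor_algebra poly_inl poly_inr.
Proof.
split.
  split=> [a|p] c u v; first by rewrite linearP mulrDr scalerAr.
  by rewrite linearP mulrDl scalerAl.
move=> D delta [dr dl].
have dl0 p : delta 0 p = 0 by exact: (linear_zero (dl p)).
pose h (p : poly_alg) : D := \sum_(j < size (p : {poly A})) delta (p : {poly A})`_j 'X^j.
have hE n (p : {poly A}) : (size p <= n)%N -> h p = \sum_(j < n) delta p`_j 'X^j.
  move=> pn; rewrite /h (big_ord_widen n (fun j => delta p`_j 'X^j)) // big_mkcond /=.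
  by apply: eq_bigr => j _; case: ltnP => // jp; rewrite nth_default.
have [|g eg] := @linear_ex k poly_alg D *:%R h.
  move=> c p q; pose n := maxn (size (p : {poly A})) (size (q : {poly A})).
  have szp : (size (p : {poly A}) <= n)%N by rewrite leq_maxl.
  have szq : (size (q : {poly A}) <= n)%N by rewrite leq_maxr.
  rewrite /= (hE n p) // (hE n q) // (hE n); last first.
    rewrite (leq_trans (size_polyD _ _)) // geq_max szq andbT poly_alg_scaleE.
    by rewrite (leq_trans (size_scale_leq _ _)).
  rewrite scaler_sumr -big_split; apply: eq_bigr => j _ /=.
  rewrite coefD poly_alg_scaleE coefZ mulr_algl; exact: (dl 'X^j).
have polyE (a : A) (p : {poly k}) :
    (poly_inl a * poly_inr p : {poly A}) = \poly_(j < size p) (p`_j *: a).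
  apply/polyP => j; rewrite mulrC poly_inr_coef poly_inlE coef_poly big_ord_recr /=.
  rewrite subnn coefC eqxx big1 ?add0r => [|l _]; last first.
    by rewrite coefC subn_eq0 leqNgt ltn_ord scaler0.
  by case: ltnP => // jp; rewrite nth_default // scale0r.
exists g; split=> [a p|g' hg' p].
  rewrite eg polyE (hE (size p)) ?size_poly // -[p in RHS]coefK [in RHS]poly_def.
  rewrite (big_morph (delta a) (linear_add (dr a)) (linear_zero (dr a))).
  apply: eq_bigr => j _; rewrite coef_poly ltn_ord (linear_scale (dr a)).
  exact: (linear_scale (dl 'X^j)).
rewrite eg /h -[p in LHS]coefK poly_def linear_sum; apply: eq_bigr => j _.
rewrite -hg'; congr (g' _); rewrite poly_inlE poly_inrE map_polyXn.
exact: (esym (mul_polyC _ _)).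
Qed.

End PolynomialAlgebra.

(** The dual basis property, required for finitely many elements at a time: enough for flatness,
    stable under products, and available without a basis of A over k. *)
Definition locally_projective (B : comNzRingType) (M : lmodType B) : Prop :=
  forall s : seq M, exists n (e : 'I_n -> M) (phi : 'I_n -> {linear M -> B^o}),
    forall m, m \in s -> m = \sum_j (phi j m : B) *: e j.

(** A kernel element sum_p v_p (x) m_p is rewritten as sum_j v_j (x) e_j with the dual basis of the
    m_p. Applying id (x) phi_j to its image gives f (v_j) = 0, and f is injective. *)
Lemma locally_projective_flat (B : comNzRingType) (M : lmodType B) :
  locally_projective M -> flat M.
Proof.
move=> lpM V W f f_inj X Y beta gamma tX tY h hh.
suff ker0 x : h x = 0 -> x = 0.
  by move=> x y /eqP; rewrite -subr_eq0 -linearB => /eqP/ker0/eqP; rewrite subr_eq0 => /eqP.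
have [L ->] := tensor_span tX x => {x} hx.
have [n [e [phi hphi]]] := lpM [seq p.2 | p <- L].
have [[lr ll] _] := tX; have [_ univY] := tY.
pose v j := \sum_(p <- L) (phi j p.2 : B) *: p.1.
have eL : \sum_(p <- L) beta p.1 p.2 = \sum_j beta (v j) (e j).
  rewrite /v; clear v hx; elim: L hphi => [_|p L IH hp].
    by rewrite big_nil big1 // => j _; rewrite big_nil (linear_zero (ll _)).
  rewrite big_cons IH => [|m mL]; last by apply: hp; rewrite inE mL orbT.
  rewrite [in LHS](hp p.2) ?mem_head //.
  rewrite (big_morph (beta p.1) (linear_add (lr p.1)) (linear_zero (lr p.1))) -big_split.
  apply: eq_bigr => j _ /=.
  by rewrite big_cons (linear_add (ll _)) (linear_scale (ll _)) (linear_scale (lr _)).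
rewrite eL big1 // => j _.
have [|g [hg _]] := univY W (fun w m => (phi j m : B) *: w).
  split=> [w c m m'|m c w w'].
    rewrite linearP scalerDl; congr (_ + _).
    exact: (esym (scalerA c (phi j m : B) w)).
  by rewrite scalerDr !scalerA mulrC.
have : f (v j) = 0.
  have := congr1 g hx; rewrite linear0 !linear_sum => e0.
  rewrite -[RHS]e0; apply: eq_bigr => p _.
  by rewrite /= hh hg linearZ.
rewrite -(linear0 f) => /f_inj ->; exact: (linear_zero (ll _)).
Qed.

Section SubmoduleType.
Variables (B : comNzRingType) (X : lmodType B) (S : set X) (hS : submodule S).

Fact submodule_pred_submod : GRing.submod_closed (submodule_pred hS).
Proof.
have [S0 SD SZ] := hS; split=> [|a x y /asboolP Sx /asboolP Sy]; first exact/asboolP.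
by apply/asboolP; apply: (SD) => //; apply: SZ.
Qed.

HB.instance Definition _ := GRing.isSubmodClosed.Build B X (submodule_pred hS)
  submodule_pred_submod.

Record submodule_type := SubmoduleType { submodule_val : X;
                                         _ : submodule_pred hS submodule_val }.

HB.instance Definition _ := [isSub for submodule_val].
HB.instance Definition _ := [Choice of submodule_type by <:].
HB.instance Definition _ := [SubChoice_isSubLmodule of submodule_type by <:].

Lemma submodule_ex : exists (D : lmodType B) (iota : {linear D -> X}),
  [/\ injective iota, forall d, S (iota d) & forall x, S x -> exists d, iota d = x].
Proof.
exists submodule_type, (val : {linear submodule_type -> X}); split.
- exact: val_inj.
- by case=> x hx; apply/asboolP.
- by move=> x /asboolP Sx; exists (SubmoduleType Sx).
Qed.

End SubmoduleType.

Lemma finitely_generated_finType (B : comNzRingType) (M : lmodType B) (I : finType)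
    (g : I -> M) :
  (forall m, exists a : I -> B, m = \sum_i a i *: g i) -> finitely_generated M.
Proof.
move=> h; exists #|I|, (fun j => g (enum_val j)) => m.
have [a ->] := h m; exists (fun j => a (enum_val j)).
by rewrite -(big_enum_val (fun i => a i *: g i)).
Qed.

Lemma locally_projective_finType (B : comNzRingType) (M : lmodType B) :
  (forall s : seq M, exists (I : finType) (e : I -> M) (phi : I -> {linear M -> B^o}),
    forall m, m \in s -> m = \sum_i (phi i m : B) *: e i) -> locally_projective M.
Proof.
move=> h s; have [I [e [phi hs]]] := h s.
exists #|I|, (fun j => e (enum_val j)), (fun j => phi (enum_val j)) => m /hs em.
by rewrite -(big_enum_val (fun i => (phi i m : B) *: e i)).
Qed.

Lemma finitely_generated_prod (B : comNzRingType) (M N : lmodType B) :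
  finitely_generated M -> finitely_generated N ->
  finitely_generated (M * N)%type.
Proof.
move=> [n [g hg]] [n' [g' hg']].
apply: (@finitely_generated_finType B _ ('I_n + 'I_n')%type
  (fun i => match i with inl j => (g j, 0) | inr j => (0, g' j) end)) => -[x y].
have [a ->] := hg x; have [a' ->] := hg' y.
exists (fun i => match i with inl j => a j | inr j => a' j end).
rewrite big_sumType /= !sum_pair /=.
rewrite [X in (_, _) + (X, _)]big1 => [|j _]; last exact: scaler0.
rewrite [X in (_, X) + _]big1 => [|j _]; last exact: scaler0.
by congr pair; rewrite ?addr0 ?add0r.
Qed.

Lemma locally_projective_prod (B : comNzRingType) (M N : lmodType B) :
  locally_projective M -> locally_projective N ->
  locally_projective (M * N)%type.
Proof.
move=> hM hN; apply: locally_projective_finType => s.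
have [n [e [phi hs]]] := hM [seq m.1 | m <- s].
have [n' [e' [phi' hs']]] := hN [seq m.2 | m <- s].
pose ee (i : 'I_n + 'I_n') : M * N :=
  match i with inl j => (e j, 0) | inr j => (0, e' j) end.
have /choice[psi hpsi] : forall i : 'I_n + 'I_n', exists psi : {linear (M * N)%type -> B^o},
    forall m, psi m = match i with inl j => phi j m.1 | inr j => phi' j m.2 end.
  case=> j.
    have [|psi hpsi] := @linear_ex B (M * N)%type B^o *:%R (fun m => phi j m.1).
      by move=> a x y; exact: (linearP (phi j) a x.1 y.1).
    by exists psi.
  have [|psi hpsi] := @linear_ex B (M * N)%type B^o *:%R (fun m => phi' j m.2).
    by move=> a x y; exact: (linearP (phi' j) a x.2 y.2).
  by exists psi.
exists ('I_n + 'I_n')%type, ee, psi => -[x y] ms.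
rewrite big_sumType /= !sum_pair /=.
rewrite [X in (_, _) + (X, _)]big1 => [|j _]; last exact: scaler0.
rewrite [X in (_, X) + _]big1 => [|j _]; last exact: scaler0.
congr pair; rewrite /= ?addr0 ?add0r.
  rewrite [LHS](hs x); last by apply/mapP; exists (x, y).
  by apply: eq_bigr => j _; rewrite hpsi.
rewrite [LHS](hs' y); last by apply/mapP; exists (x, y).
by apply: eq_bigr => j _; rewrite hpsi.
Qed.

Lemma locally_projective_iso (B : comNzRingType) (M N : lmodType B)
    (u : {linear M -> N}) (v : {linear N -> M}) :
  cancel v u -> locally_projective M -> locally_projective N.
Proof.
move=> vK hM s; have [n [e [phi hs]]] := hM [seq v x | x <- s].
exists n, (fun j => u (e j)), (fun j => (phi j \o v)%FUN : {linear N -> B^o}) => x xs.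
rewrite -[LHS]vK (hs (v x)) ?map_f // linear_sum.
by apply: eq_bigr => j _; rewrite linearZ.
Qed.

Lemma polynomial_functional (k : fieldType) (M : lmodType {poly k}) (g : M -> nat -> k) :
  (forall m m' n, g (m + m') n = g m n + g m' n) ->
  (forall p m n, g (p *: m) n = \sum_(j < n.+1) p`_j * g m (n - j)%N) ->
  (forall m, exists N, forall n, (N <= n)%N -> g m n = 0) ->
  exists phi : {linear M -> {poly k}^o}, forall m n, (phi m : {poly k})`_n = g m n.
Proof.
move=> gD gM /choice[N hN].
pose h (m : M) : {poly k} := \poly_(n < N m) g m n.
have hE m n : (h m)`_n = g m n by rewrite coef_poly; case: ltnP => // /hN ->.
have [|phi ephi] := @linear_ex {poly k} M {poly k}^o *:%R h.
  move=> p m m'; apply/polyP => n; rewrite hE gD gM coefD hE; congr (_ + _).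
  by rewrite [RHS]coefM; apply: eq_bigr => j _; rewrite hE.
by exists phi => m n; rewrite ephi.
Qed.

(** M is V0 + X V[X], the polynomials over V with constant term in V0. Taking V0 = V gives the
    constant families, and V0 the kernel of f gives the ideal (z, X) of A[X]. The generators are e0
    for V0 and e1 X for a complement. *)
Lemma coefficients_locally_projective (k : fieldType) (V : lmodType k) (V0 : set V)
    (M : lmodType {poly k}) (co : M -> nat -> V) :
  submodule V0 ->
  (forall m m' n, co (m + m') n = co m n + co m' n) ->
  (forall p m n, co (p *: m) n = \sum_(j < n.+1) p`_j *: co m (n - j)%N) ->
  (forall m, exists N, forall n, (N <= n)%N -> co m n = 0) ->
  (forall m m', co m =1 co m' -> m = m') ->
  (forall m, V0 (co m 0%N)) ->
  (forall v, V0 v -> exists m, forall n, co m n = if n == 0%N then v else 0) ->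
  (forall v, exists m, forall n, co m n = if n == 1%N then v else 0) ->
  locally_projective M.
Proof.
move=> hV coD coM cofin coinj co0 real0 real1; apply: locally_projective_finType => s.
have [N hN] := choice cofin.
(* The coefficients of positive degree are recovered modulo V0 by e1. The remainders lie in V0 and
   join the constant terms in C0, so that e0 stays in V0. *)
pose C1 := flatten [seq [seq co m n.+1 | n <- iota 0 (N m)] | m <- s].
have [n1 [e1 [phi1 [phi1V dual1 _]]]] := local_dual_basis C1 hV.
pose P1 := dual_sum e1 phi1.
have P1V v : V0 v -> P1 v = 0.
  by move=> Vv; rewrite /P1 /dual_sum big1 // => j _; rewrite phi1V // scale0r.
pose C0 := [seq co m 0%N | m <- s] ++ [seq v - P1 v | v <- C1].
have [n0 [e0 [phi0 [_ dual0 e0V]]]] := local_dual_basis C0 (submodule0 V).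
have {}e0V j : V0 (e0 j).
  apply: e0V => // v; rewrite mem_cat => /orP[/mapP[m _ ->]|/mapP[w wC ->]] //.
  exact: dual1.
have decomp m n : m \in s -> co m n = P1 (co m n) + dual_sum e0 phi0 (co m n - P1 (co m n)).
  move=> ms; have [c0|[c0|]] : co m n = 0 \/ n = 0%N \/ co m n \in C1.
    case: n => [|n]; first by right; left.
    have [Nn|nN] := leqP (N m) n; first by left; rewrite hN // leqW.
    right; right; apply/flattenP; exists [seq co m n'.+1 | n' <- iota 0 (N m)].
      by apply/mapP; exists m.
    by apply/mapP; exists n => //; rewrite mem_iota.
  - have l0 n' (e : 'I_n' -> V) phi : dual_sum e phi 0 = 0.
      by rewrite /dual_sum big1 // => j _; rewrite linear0 scale0r.
    by rewrite c0 /P1 l0 subr0 l0 addr0.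
  - rewrite c0 P1V // add0r subr0; apply/eqP; rewrite -subr_eq0; apply/eqP.
    by apply: dual0; rewrite mem_cat map_f.
  - move=> cC; apply/eqP; rewrite addrC -subr_eq -subr_eq0; apply/eqP.
    by apply: dual0; rewrite mem_cat (map_f (fun v => v - P1 v)) ?orbT.
have /choice[psi hpsi] : forall j, exists psi : {scalar V},
    forall v, psi v = phi0 j (v - P1 v).
  move=> j; have [|psi hpsi] := @linear_ex k V k *%R (fun v => phi0 j (v - P1 v)).
    move=> a u v; rewrite -linearP; congr (phi0 j _).
    by rewrite /P1 dual_sum_linear scalerBr opprD addrACA.
  by exists psi.
have fin_ (phi : {scalar V}) m : exists N, forall n, (N <= n)%N -> phi (co m n) = 0.
  by exists (N m) => n Nn; rewrite hN // linear0.
have conv (phi : {scalar V}) p m n :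
    phi (co (p *: m) n) = \sum_(j < n.+1) p`_j * phi (co m (n - j)%N).
  by rewrite coM linear_sum; apply: eq_bigr => j _; rewrite linearZ.
have /choice[Phi0 hPhi0] : forall j, exists Phi : {linear M -> {poly k}^o},
    forall m n, (Phi m : {poly k})`_n = psi j (co m n).
  move=> j; apply: polynomial_functional => [m m' n|p m n|m].
  - by rewrite coD linearD.
  - exact: conv.
  - exact: fin_.
(* phi1 kills the constant term, so its polynomial is divisible by X; the quotient is the
   coefficient of e1 X, whence the shift to n.+1. *)
have /choice[Phi1 hPhi1] : forall j, exists Phi : {linear M -> {poly k}^o},
    forall m n, (Phi m : {poly k})`_n = phi1 j (co m n.+1).
  move=> j; apply: polynomial_functional => [m m' n|p m n|m].
  - by rewrite coD linearD.
  - rewrite conv big_ord_recr /= subnn phi1V // mulr0 addr0.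
    by apply: eq_bigr => l _; rewrite subSn // -ltnS.
  - by have [N' hN'] := fin_ (phi1 j) m; exists N' => n Nn; rewrite hN' // leqW.
have /choice[mu0 hmu0] := fun j => real0 (e0 j) (e0V j).
have /choice[mu1 hmu1] := fun j => real1 (e1 j).
exists ('I_n0 + 'I_n1)%type,
  (fun i => match i with inl j => mu0 j | inr j => mu1 j end),
  (fun i => match i with inl j => Phi0 j | inr j => Phi1 j end) => m ms.
rewrite big_sumType /=; apply: coinj => n.
have co00 n' : co 0 n' = 0.
  by have /eqP := coD 0 0 n'; rewrite addr0 -subr_eq0 opprD addrA subrr sub0r oppr_eq0 => /eqP.
have coS n' l (F : 'I_l -> M) : co (\sum_j F j) n' = \sum_j co (F j) n'.
  by apply: (big_morph (fun m => co m n')) => // x y; exact: coD.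
rewrite coD !coS {1}decomp // addrC; congr (_ + _).
  apply: eq_bigr => j _; rewrite -hpsi coM big_ord_recr /= subnn hmu0 eqxx hPhi0.
  rewrite big1 ?add0r // => l _.
  by rewrite hmu0 subn_eq0 leqNgt ltn_ord scaler0.
apply: eq_bigr => j _; rewrite coM; case: n => [|n].
  by rewrite phi1V // scale0r big_ord1 hmu1 scaler0.
rewrite big_ord_recr /= subnn hmu1 scaler0 addr0 big_ord_recr /= subSnn hmu1 /= hPhi1.
rewrite big1 ?add0r // => l _; rewrite hmu1.
rewrite (_ : (n.+1 - l == 1)%N = false) ?scaler0 //.
by rewrite subSn 1?ltnW // eqSS subn_eq0 leqNgt ltn_ord.
Qed.

Lemma prod_assoc_iso (A : comNzRingType) (P Q S T : lmodType A)
    (h : {linear (P * Q)%type -> S}) (h' : {linear (P * S)%type -> T}) :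
  bijective h -> bijective h' ->
  exists g : {linear (P * P * Q)%type -> T}, bijective g.
Proof.
move=> [hi hK hiK] [hi' hK' hiK'].
have [|g eg] := @linear_ex A (P * P * Q)%type T *:%R
    (fun w => h' (w.1.1, h (w.1.2, w.2))).
  move=> c x y; rewrite -[RHS](linearP h'); congr (h' _); congr pair.
  exact: (linearP h c (x.1.2, x.2) (y.1.2, y.2)).
exists g; apply: (@eq_bij _ _ _ _ _ (fun x => esym (eg x))).
exists (fun w => ((hi' w).1, (hi (hi' w).2).1, (hi (hi' w).2).2)).
  by move=> [[x y] w]; rewrite /= hK' /= hK.
move=> w /=; rewrite -[RHS]hiK'; congr (h' _).
by rewrite -surjective_pairing hiK -surjective_pairing.
Qed.

(** * Families over the line with constant general fibre *)

Section Families.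
Variables (k : fieldType) (A : comAlgType k).
Local Notation E := (poly_alg A).
Local Notation iA := (poly_inl A).
Local Notation iB := (poly_inr A).

Definition fibre_at (MM : lmodType E) (c : k) (N : lmodType A) : Prop :=
  exists p : {linear restrict iA MM -> N},
    (forall n, exists m, p m = n) /\
    forall m : MM, p m = 0 <-> exists m' : MM, m = iB ('X - c%:P) *: m'.

(** More than a deformation asks: the base is the line and all fibres off 0 are N1. Such families
    can be added, so besides constant ones only a family from O + O to A has to be built. *)
Definition deformable (N0 N1 : lmodType A) : Prop :=
  exists MM : lmodType E,
  [/\ finitely_generated MM, locally_projective (restrict iB MM),
      fibre_at MM 0 N0 & forall c, c != 0 -> fibre_at MM c N1].

Lemma fibre_at_prod MM MM' c N N' :
  fibre_at MM c N -> fibre_at MM' c N' -> fibre_at (MM * MM')%type c (N * N')%type.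
Proof.
move=> [p [ps pk]] [p' [ps' pk']].
have [|q eq] := @linear_ex A (restrict iA (MM * MM')%type) (N * N')%type *:%R
    (fun m : MM * MM' => (p m.1, p' m.2)).
  by move=> a x y; congr pair; [exact: (linearP p a x.1 y.1)|exact: (linearP p' a x.2 y.2)].
exists q; split=> [[n n']|[m m']].
  by have [m em] := ps n; have [m' em'] := ps' n'; exists (m, m'); rewrite eq /= em em'.
rewrite eq /=; split=> [[/pk[x ->] /pk'[y ->]]|[[x y] [ex ey]]]; first by exists (x, y).
congr pair; [apply/pk; exists x|apply/pk'; exists y] => //.
Qed.

Lemma deformable_prod N0 N1 N0' N1' : deformable N0 N1 -> deformable N0' N1' ->
  deformable (N0 * N0')%type (N1 * N1')%type.
Proof.
move=> [MM [fg lp f0 f1]] [MM' [fg' lp' f0' f1']]; exists (MM * MM')%type; split.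
- exact: finitely_generated_prod.
- have [|u eu] := @linear_ex {poly k} (restrict iB MM * restrict iB MM')%type
    (restrict iB (MM * MM')%type) *:%R id; first by [].
  have [|v ev] := @linear_ex {poly k} (restrict iB (MM * MM')%type)
    (restrict iB MM * restrict iB MM')%type *:%R id; first by [].
  apply: (locally_projective_iso (u := u) (v := v)).
    by move=> x; rewrite eu ev.
  exact: locally_projective_prod.
- exact: fibre_at_prod.
- by move=> c c0; apply: fibre_at_prod; [exact: f1|exact: f1'].
Qed.

Lemma fibre_at_iso MM c (N N' : lmodType A) (g : {linear N -> N'}) :
  bijective g -> fibre_at MM c N -> fibre_at MM c N'.
Proof.
move=> gb [p [ps pk]].
have [|q eq] := @linear_ex A (restrict iA MM) N' *:%R (g \o p).
  by move=> a x y /=; rewrite !linearP.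
exists q; split=> [n'|m].
  have [h hK gK] := gb; have [m em] := ps (h n').
  by exists m; rewrite eq /= em gK.
rewrite -pk eq /=; split=> [|->]; last exact: linear0.
by rewrite -(linear0 g) => /(bij_inj gb).
Qed.

Lemma deformable_iso (N0 N1 N0' N1' : lmodType A)
    (g0 : {linear N0 -> N0'}) (g1 : {linear N1 -> N1'}) :
  bijective g0 -> bijective g1 -> deformable N0 N1 -> deformable N0' N1'.
Proof.
move=> b0 b1 [MM [fg lp f0 f1]]; exists MM; split=> //.
  exact: fibre_at_iso b0 f0.
by move=> c /f1; apply: fibre_at_iso b1.
Qed.

Lemma poly_inr_linearE c : iB ('X - c%:P) = 'X - (c%:A)%:P :> {poly A}.
Proof. by rewrite poly_inrE rmorphB /= map_polyX map_polyC. Qed.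

Lemma poly_alg_rootP (p : {poly A}) c :
  p.[c%:A] = 0 <-> exists q : E, p = iB ('X - c%:P) * q :> E.
Proof.
split=> [/eqP/factor_theorem[q ->]|[q ->]].
  by exists q; rewrite mulrC; congr (_ * _); rewrite poly_inr_linearE.
by rewrite poly_inr_linearE hornerM hornerXsubC subrr mul0r.
Qed.

Lemma deformable_free : deformable A^o A^o.
Proof.
exists E^o.
have fib c : fibre_at E^o c A^o.
  have [|p ep] := @linear_ex A (restrict iA E^o) A^o *:%R (fun p : {poly A} => p.[c%:A]).
    move=> a p q; rewrite -[X in X + q]/((iA a : {poly A}) * p) hornerD poly_inlE.
    by rewrite hornerCM.
  exists p; split=> [a|q]; first by exists (a%:P); rewrite ep hornerC.
  by rewrite ep; exact: poly_alg_rootP.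
split=> //.
  exists 1%N, (fun=> 1) => m; exists (fun=> m); rewrite big_ord1; exact: (esym (mulr1 m)).
apply: (@coefficients_locally_projective k A setT (restrict iB E^o)
  (fun (p : {poly A}) n => p`_n)) => //.
- by move=> m m' n; exact: coefD.
- by move=> p m n; exact: poly_inr_coef.
- by move=> p; exists (size p) => n pn; rewrite nth_default.
- by move=> p q pq; apply/polyP.
- by move=> a _; exists (a%:P : {poly A}) => n; rewrite coefC.
- move=> a; exists (a%:P * 'X : {poly A}) => n.
  by rewrite coefCM coefX; case: eqP; rewrite ?mulr1 ?mulr0.
Qed.

Variables (O : comAlgType k) (f : {lrmorphism A -> O}) (z : A).
Hypothesis hf : double_ring f z.

Let f_alg c : f c%:A = c%:A. Proof. by rewrite linearZ /= rmorph1. Qed.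

Let reduced_model : exists (MM : lmodType E) (val : MM -> {poly O}),
  [/\ injective val, forall p, exists m, val m = p,
      forall m m', val (m + m') = val m + val m'
    & forall (e : E) m, val (e *: m) = map_poly f (e : {poly A}) * val m].
Proof.
pose F : {rmorphism E -> {poly O}} := map_poly f : {rmorphism {poly A} -> {poly O}}.
exists (restrict F {poly O}^o), id; split=> //.
by move=> p; exists p.
Qed.

Lemma deformable_reduced : deformable (restrict f O^o) (restrict f O^o).
Proof.
have [fs _ _ _] := hf.
have [MM [val [val_inj val_surj valD valZ]]] := reduced_model; exists MM.
have mapX c : map_poly f (iB ('X - c%:P) : {poly A}) = 'X - (c%:A)%:P.
  by rewrite poly_inr_linearE rmorphB /= map_polyX map_polyC /= f_alg.
have fib c : fibre_at MM c (restrict f O^o).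
  have [|p ep] := @linear_ex A (restrict iA MM) (restrict f O^o) *:%R
      (fun m => (val m).[c%:A]).
    move=> a m m'; rewrite -[a *: m]/(iA a *: (m : MM)) valD valZ poly_inlE map_polyC.
    by rewrite hornerD hornerCM.
  exists p; split=> [a|m].
    by have [m em] := val_surj a%:P; exists m; rewrite ep em hornerC.
  rewrite ep; split=> [/eqP/factor_theorem[q eq]|[m' ->]].
    have [m' em'] := val_surj q; exists m'; apply: val_inj.
    by rewrite valZ mapX em' eq mulrC.
  by rewrite valZ mapX hornerM hornerXsubC subrr mul0r.
split=> //.
  have [m1 em1] := val_surj 1.
  exists 1%N, (fun=> m1) => m; have [l hl] := choice (fun j => fs (val m)`_j).
  exists (fun=> \poly_(j < size (val m)) l j); rewrite big_ord1; apply: val_inj.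
  rewrite valZ em1 mulr1.
  apply/polyP => j; rewrite coef_map coef_poly; case: ltnP => [_|jm].
    exact: (esym (hl j)).
  by rewrite nth_default //; exact: (esym (rmorph0 f)).
apply: (@coefficients_locally_projective k O setT (restrict iB MM)
  (fun m n => (val m)`_n)) => //.
- by move=> m m' n; rewrite valD coefD.
- move=> p m n; rewrite -[p *: m]/(iB p *: (m : MM)) valZ coefM.
  apply: eq_bigr => j _; rewrite -mulr_algl; congr (_ * _).
  rewrite coef_map poly_inrE coef_map; exact: f_alg.
- by move=> m; exists (size (val m)) => n mn; rewrite nth_default.
- by move=> m m' mm; apply: val_inj; apply/polyP.
- by move=> a _; have [m em] := val_surj a%:P; exists m => n; rewrite em coefC.
- move=> a; have [m em] := val_surj (a%:P * 'X); exists m => n.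
  by rewrite em coefCM coefX; case: eqP; rewrite ?mulr1 ?mulr0.
Qed.

Let fz0 : f z = 0.
Proof. by have [_ h _ _] := hf; apply/h; exists 1; rewrite mulr1. Qed.

(* The ideal (z, X) of A[X]: its fibre at X = c <> 0 is A, while at X = 0 its
   two generators become independent and are annihilated by z. *)
Let split_model : exists (MM : lmodType E) (val : MM -> {poly A}),
  [/\ injective val, forall p : {poly A}, f p`_0 = 0 -> exists m, val m = p,
      forall m, f (val m)`_0 = 0,
      forall m m', val (m + m') = val m + val m'
    & forall (e : E) m, val (e *: m) = (e : {poly A}) * val m].
Proof.
have SD (p q : {poly A}) : f p`_0 = 0 -> f q`_0 = 0 -> f (p + q)`_0 = 0.
  by move=> hp hq; rewrite coefD rmorphD /= hp hq addr0.
have SM (p q : {poly A}) : f q`_0 = 0 -> f (p * q)`_0 = 0.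
  by move=> hq; rewrite coef0M rmorphM /= hq mulr0.
pose S : set E^o := [set p | f (p : {poly A})`_0 = 0].
have hS : submodule S.
  split=> [|p q hp hq|p q hq] /=.
  - exact: etrans (congr1 f (coef0 _ _)) (rmorph0 f).
  - exact: SD.
  - exact: SM.
have [MM [iota [iota_inj iotaS real]]] := submodule_ex hS.
exists MM, (fun m => iota m : {poly A}); split=> //.
- by move=> m m'; exact: linearD.
- by move=> e m; exact: (linearZZ iota e m).
Qed.

Lemma deformable_split : deformable (restrict f O^o * restrict f O^o)%type A^o.
Proof.
have [fs fker fann _] := hf.
have [MM [val [val_inj realS val0 valD valZ]]] := split_model.
exists MM; split.
(* z and X generate: an element is m_0 + X q with m_0 in the kernel of f, hence a multiple of z. *)
- have [|mz ez] := realS z%:P; first by rewrite coefC.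
  have [|mX eX] := realS 'X; first by rewrite coefX rmorph0.
  apply: (@finitely_generated_finType _ MM bool (fun b => if b then mz else mX)) => m.
  have [y ey] := (fker _).1 (val0 m).
  have /factor_theorem[q eq] : root (val m - ((val m)`_0)%:P) 0.
    by rewrite rootE hornerD hornerN hornerC horner_coef0 subrr.
  exists (fun b => if b then y%:P else q); apply: val_inj.
  rewrite big_bool /= valD !valZ ez eX -polyCM mulrC -ey.
  by rewrite -[LHS](subrK ((val m)`_0)%:P) eq subr0 addrC mulrC.
- apply: (@coefficients_locally_projective k A [set a | f a = 0] (restrict iB MM)
    (fun m n => (val m)`_n)).
  + split=> /= [|x y hx hy|a x hx]; first exact: rmorph0.
      by rewrite rmorphD /= hx hy addr0.
    by rewrite linearZ /= hx scaler0.
  + by move=> m m' n; rewrite valD coefD.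
  + move=> p m n; rewrite -[p *: m]/(iB p *: (m : MM)) valZ; exact: poly_inr_coef.
  + by move=> m; exists (size (val m)) => n mn; rewrite nth_default.
  + by move=> m m' mm; apply: val_inj; apply/polyP.
  + exact: val0.
  + move=> a fa; have [|m em] := realS a%:P; first by rewrite coefC.
    by exists m => n; rewrite em coefC.
  + move=> a; have [|m em] := realS (a%:P * 'X); first by rewrite coefMX rmorph0.
    by exists m => n; rewrite em coefCM coefX; case: eqP; rewrite ?mulr1 ?mulr0.
(* d is division by z, well defined because the annihilator of z is the kernel of f; it identifies z
   A with O. The fibre at 0 records m_0 / z and m_1 modulo z. *)
- have [d hd] : exists d : A -> O, forall b, d (z * b) = f b.
    have /choice[d hd] : forall x, exists y, forall b, x = z * b -> f b = y.
      move=> x; have [[b eb]|nb] := pselect (exists b, x = z * b).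
        exists (f b) => b' eb'; apply/eqP; rewrite -subr_eq0 -rmorphB; apply/eqP/fann.
        by rewrite mulrBr -eb -eb' subrr.
      by exists 0 => b eb; case: nb; exists b.
    by exists d => b; exact: (esym (hd _ b erefl)).
  have [|p ep] := @linear_ex A (restrict iA MM) (restrict f O^o * restrict f O^o)%type *:%R
      (fun m => (d (val m)`_0, f (val m)`_1)).
    move=> a m m'; rewrite -[a *: m]/(iA a *: (m : MM)) valD valZ poly_inlE !coefD !coefCM.
    have [y ->] := (fker _).1 (val0 m); have [y' ->] := (fker _).1 (val0 m').
    rewrite mulrCA -mulrDr !hd; congr pair; rewrite rmorphD rmorphM; exact: erefl.
  exists p; split=> [[x y]|m].
    have [b eb] := fs x; have [a ea] := fs y.
    have [|m em] := realS ((z * b)%:P + a%:P * 'X).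
      by rewrite coefD coefC coefMX addr0 rmorphM /= fz0 mul0r.
    by exists m; rewrite ep em !coefD !coefMX !coefC /= addr0 add0r hd eb ea.
  rewrite ep; split=> [[d0 f1]|[m' ->]].
    have m0 : (val m)`_0 = 0.
      by move: d0; have [y ->] := (fker _).1 (val0 m); rewrite hd => /fann.
    have /(poly_alg_rootP _ 0).1[q eq] : (val m).[0%:A] = 0.
      by rewrite scale0r horner_coef0.
    have e1 : val m = 'X * (q : {poly A}).
      by rewrite eq; congr (_ * _); rewrite poly_inr_linearE scale0r subr0.
    have [|m' em'] := realS q; first by rewrite -f1 e1 coefXM.
    by exists m'; apply: val_inj; rewrite valZ em' eq.
  rewrite valZ poly_inr_linearE scale0r subr0 !coefXM /= val0; congr pair.
  by rewrite -[0](mulr0 z) hd rmorph0.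
(* Evaluation at c maps the ideal onto A, with c^-1 a X over a. Its kernel is X - c times the ideal:
   if m = (X - c) q, then m_0 = - c q_0 with c invertible. *)
- move=> c c0.
  have [|p ep] := @linear_ex A (restrict iA MM) A^o *:%R (fun m => (val m).[c%:A]).
    move=> a m m'; rewrite -[a *: m]/(iA a *: (m : MM)) valD valZ poly_inlE.
    by rewrite hornerD hornerCM.
  exists p; split=> [a|m].
    have [|m em] := realS ((c^-1 *: a)%:P * 'X); first by rewrite coefMX rmorph0.
    by exists m; rewrite ep em hornerCM hornerX mulr_algr scalerA divff // scale1r.
  rewrite ep; split=> [/(poly_alg_rootP _ c).1[q eq]|[m' ->]].
    have [|m' em'] := realS q.
      have := val0 m; rewrite eq -[_ * q]/((iB ('X - c%:P) : {poly A}) * q).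
      rewrite poly_inr_linearE mulrBl coefB coefXM coefCM sub0r.
      rewrite rmorphN rmorphM /= f_alg mulr_algl.
      move/eqP; rewrite oppr_eq0 => /eqP h.
      by rewrite -[f _]scale1r -(mulVf c0) -scalerA h scaler0.
    by exists m'; apply: val_inj; rewrite valZ em' eq.
  by apply/poly_alg_rootP; exists (val m'); rewrite valZ.
Qed.

Lemma row_mx_headK (T : Type) n (u : 'rV[T]_(1 + n)) :
  row_mx (const_mx (u 0 (lshift n 0)) : 'rV_1) (rsubmx u) = u.
Proof.
rewrite -[RHS]hsubmxK; congr row_mx.
by apply/rowP => j; rewrite !mxE ord1.
Qed.

Definition quasi_free_module (a b : nat) : lmodType A :=
  ('rV[A]_a * restrict f 'rV[O]_b)%type.

Lemma deformable_add (N0 N1 N0' N1' N0'' N1'' : lmodType A)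
    (g0 : {linear (N0 * N0')%type -> N0''}) (g1 : {linear (N1 * N1')%type -> N1''}) :
  bijective g0 -> bijective g1 ->
  deformable N0 N1 -> deformable N0' N1' -> deformable N0'' N1''.
Proof. by move=> b0 b1 d d'; apply: deformable_iso b0 b1 (deformable_prod d d'). Qed.

Lemma add_free_iso a b :
  exists g : {linear (A^o * quasi_free_module a b)%type -> quasi_free_module a.+1 b},
    bijective g.
Proof.
have [|g eg] := @linear_ex A (A^o * quasi_free_module a b)%type
  (quasi_free_module a.+1 b) *:%R
  (fun w => (row_mx (const_mx w.1) w.2.1 : 'rV_(1 + a), w.2.2)).
  move=> c x y; congr pair; apply/rowP => j; rewrite !mxE.
  by case: splitP => l _; rewrite !mxE.
exists g; apply: (@eq_bij _ _ _ _ _ (fun x => esym (eg x))).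
exists (fun w : quasi_free_module a.+1 b =>
  ((w.1 : 'rV_(1 + a)) 0 (lshift a 0) : A^o, (rsubmx (w.1 : 'rV_(1 + a)), w.2))).
- by move=> [x [u v]] /=; rewrite row_mxEl mxE row_mxKr.
- by move=> [u v]; congr pair; exact: row_mx_headK.
Qed.

Lemma add_reduced_iso a b :
  exists g : {linear (restrict f O^o * quasi_free_module a b)%type ->
    quasi_free_module a b.+1}, bijective g.
Proof.
have [|g eg] := @linear_ex A (restrict f O^o * quasi_free_module a b)%type
  (quasi_free_module a b.+1) *:%R
  (fun w => (w.2.1, row_mx (const_mx (w.1 : O)) (w.2.2 : 'rV[O]_b) : 'rV_(1 + b))).
  move=> c x y; congr pair; apply/rowP => j; rewrite !mxE.
  by case: splitP => l _; rewrite !mxE.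
exists g; apply: (@eq_bij _ _ _ _ _ (fun x => esym (eg x))).
exists (fun w : quasi_free_module a b.+1 =>
  ((w.2 : 'rV[O]_(1 + b)) 0 (lshift b 0), (w.1, rsubmx (w.2 : 'rV[O]_(1 + b))))).
- by move=> [x [u v]] /=; rewrite row_mxEl mxE row_mxKr.
- by move=> [u v]; congr pair; exact: row_mx_headK.
Qed.

Lemma deformable_zero : deformable (quasi_free_module 0 0) (quasi_free_module 0 0).
Proof.
exists 'rV[E]_0.
have zero_all (m : 'rV[E]_0) : m = 0 by apply/rowP => -[].
have fib c : fibre_at 'rV[E]_0 c (quasi_free_module 0 0).
  have [|p ep] := @linear_ex A (restrict iA 'rV[E]_0) (quasi_free_module 0 0) *:%R (fun=> 0).
    by move=> x y w; rewrite /= scaler0 addr0.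
  exists p; split=> [[u v]|m]; first by exists 0; rewrite ep; congr pair; apply/rowP => -[].
  by rewrite ep; split=> // _; exists 0; rewrite scaler0; exact: zero_all.
split=> //.
  by exists 0%N, (fun=> 0) => m; exists (fun=> 0); rewrite big_ord0; exact: zero_all.
move=> s; exists 0%N, (fun=> 0), (fun=> \0%R) => m _.
by rewrite big_ord0; exact: zero_all.
Qed.

(** Each step on b adds the family from O + O to A; the summands a A and l O are carried along
    constantly. *)
Lemma deformable_quasi_free a b l :
  deformable (quasi_free_module a (b.*2 + l)) (quasi_free_module (b + a) l).
Proof.
elim: b => [|b IHb].
  rewrite add0n; elim: a => [|a IHa]; last first.
    have [g gb] := add_free_iso a l.
    exact: (deformable_add gb gb deformable_free IHa).
  rewrite add0n; elim: l => [|l IHl]; first exact: deformable_zero.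
  have [g gb] := add_reduced_iso 0 l.
  exact: (deformable_add gb gb deformable_reduced IHl).
rewrite doubleS !addSn; set n := (b.*2 + l)%N in IHb *.
have [g1 gb1] := add_free_iso (b + a) l.
have [h hb] := add_reduced_iso a n; have [h' hb'] := add_reduced_iso a n.+1.
have [g0 gb0] := prod_assoc_iso hb hb'.
exact: (deformable_add gb0 gb1 deformable_split IHb).
Qed.

End Families.

(** A maximal ideal of C[X] is the set of polynomials vanishing at the image c of X, and X - c
    generates it, so the fibre is the cokernel of X - c. *)
Lemma deformable_deforms_to (R : realType) (A : comAlgType R[i]) (N0 N1 : lmodType A)
    (property : lmodType A -> Prop) :
  deformable N0 N1 -> property N1 -> deforms_to N0 property.
Proof.
move=> [MM [fg lp fib0 fib1]] pN1.
pose B := {poly R[i]} : comAlgType R[i].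
have fibre_ex c N : fibre_at MM c N ->
    is_fibre (poly_inl A) (poly_inr A) MM [set p : B | (p : {poly R[i]}).[c] = 0] N.
  move=> [p [ps pk]]; exists p; split=> // m; rewrite pk; split=> [[m' ->]|].
    exists 1%N, (fun=> 'X - c%:P), (fun=> m'); split; last by rewrite big_ord1.
    by move=> _; rewrite /mkset hornerXsubC subrr.
  move=> [n [b [y [hb ->]]]].
  have /choice[q hq] : forall j, exists q : {poly R[i]}, b j = q * ('X - c%:P).
    by move=> j; have /eqP/factor_theorem[q ->] := hb j; exists q.
  exists (\sum_j poly_inr A (q j) *: (y j : MM)); rewrite scaler_sumr.
  apply: eq_bigr => j _; rewrite scalerA -rmorphM mulrC -hq //.
have chi_alg (chi : {rmorphism B -> R[i]}) : (forall l, chi l%:A = l) ->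
    [set b | chi b = 0] = [set p : B | (p : {poly R[i]}).[chi 'X] = 0].
  move=> chi_k; suff chiE p : chi p = (p : {poly R[i]}).[chi 'X].
    by apply/seteqP; split=> p /=; rewrite (chiE p).
  rewrite (@alg_morph_polyE _ R[i]^o chi) ?horner_coef // => l.
  by rewrite chi_k; exact: (esym (mulr1 l)).
exists B, (poly_alg A), (poly_inl A), (poly_inr A), MM,
  [set p : B | (p : {poly R[i]}).[0] = 0]; split; split.
- exact: affine_line_smooth.
- have h l : horner_eval (0 : R[i]) l%:A = l by rewrite /horner_eval hornerZ hornerC mulr1.
  exact: (@point_maximal R B (horner_eval (0 : R[i])) h).
- exact: poly_alg_tensor.
- exact: fg.
- exact: locally_projective_flat.
- exact: fibre_ex.
- move=> t mt tt0; have [chi [chi_k et]] := maximal_point (poly_finitely_generated _) mt.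
  exists N1 => //; rewrite et chi_alg //; apply: fibre_ex; apply: fib1.
  by apply/eqP => c0; apply: tt0; rewrite et chi_alg // c0.
Qed.

Lemma quasi_free_deforms (R : realType) (A O : comAlgType R[i])
    (f : {lrmorphism A -> O}) (z : A) (M : lmodType A) (r : int) :
  double_ring f z -> quasi_free f M ->
  2 * r <= (generalized_rank f z M)%:Z -> (rank0 f z M)%:Z <= r ->
  deforms_to M (fun N => quasi_free f N /\ (rank0 f z N)%:Z = r).
Proof.
move=> hf [a [b [phi phi_bij]]].
rewrite (rank0_quasi_free hf phi_bij) (generalized_rank_quasi_free hf phi_bij).
case: r => // r; rewrite -PoszM !lez_nat => rR ar.
(* n pairs of copies of O become copies of A and l copies of O remain; 2 r <= 2 a + b says exactly
   that 2 n <= b. *)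
pose n := (r - a)%N; pose l := (b - n.*2)%N.
have eb : b = (n.*2 + l)%N by rewrite /l /n; lia.
have er : r = (n + a)%N by rewrite subnK.
have [psi phiK psiK] := phi_bij.
rewrite eb in phi phi_bij psi phiK psiK *.
have [|g eg] := @linear_ex A (quasi_free_module f a (n.*2 + l)) M *:%R psi.
  by move=> c x y; apply: (bij_inj phi_bij); rewrite linearP !psiK.
have gb : bijective g by exists phi => x; rewrite eg ?psiK ?phiK.
have idb (N : lmodType A) : bijective (idfun : {linear N -> N}) by exists id.
apply: (@deformable_deforms_to R A M (quasi_free_module f (n + a) l)).
  exact: deformable_iso gb (idb _) (deformable_quasi_free hf a n l).
have qb := idb (quasi_free_module f (n + a) l).
by split; [exists (n + a)%N, l, idfun|rewrite (rank0_quasi_free hf qb) er].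
Qed.

Theorem mainTheorem10 (R : realType) (X C2 C : ringed_space R[i])
  (c : morphism C C2) (i : morphism C2 X)
  (hC2 : primitive_double_curve c i)
  (P : C) (hP : closed [set P])
  (z : stalk (c P))
  (hz : forall a, comorphism c P a = 0 <-> exists b, a = z * b)
  (M : lmodType (stalk (c P))) (hM : quasi_free (comorphism c P) M)
  (r0 : int)
  (hr0 : 0 < 2 * r0)
  (hr0R : 2 * r0 <= (generalized_rank (comorphism c P) z M)%:Z) :
  deforms_to M (fun N => quasi_free (comorphism c P) N /\
                         (rank0 (comorphism c P) z N)%:Z = r0) <->
  (rank0 (comorphism c P) z M)%:Z <= r0.
Proof.
have hf := pdc_double_ring hC2 hP hz; split.
  exact: deformation_rank0_le.
exact: quasi_free_deforms.
Qed.
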